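(* Let $\mathbf{k}$ be an algebraically closed field of characteristic $p\in\{2,3\}$ and let $X$ be an object with $\mathbf{N}(X)<\infty$ in a tensor category over $\mathbf{k}$. Then $\mathbf{N}(X)$ is a multiple of $p^2$.
   Context: A tensor category over $\mathbf{k}$ is a symmetric rigid monoidal $\mathbf{k}$-linear abelian category with $\mathrm{End}(\mathbb{1})\cong\mathbf{k}$ and all objects of finite length. With braiding $c$, $\Lambda^2X\subseteq X\otimes X$ is the image of $\mathrm{id}_{X\otimes X}-c_{X,X}$; $\mathrm{Sym}^nX$ is the quotient of $X^{\otimes n}$ by $\sum_{i=1}^{n-1}X^{\otimes i-1}\otimes\Lambda^2X\otimes X^{\otimes n-i-1}$; and $\Lambda^nX=\bigcap_{i=1}^{n-1}X^{\otimes i-1}\otimes\Lambda^2X\otimes X^{\otimes n-i-1}$ (degree $0$: $\mathbb{1}$; degree $1$: $X$). Set $m(X)=\sup\{m\mid\mathrm{Sym}^mX\neq0\}$, $n(X)=\sup\{n\mid\Lambda^nX\neq0\}$, and $\mathbf{N}(X)=m(X)+n(X)\in\mathbb{N}\cup\{\infty\}$; for $X=0$ one has $\mathbf{N}(X)=0$. *)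

(* Defs.v *)
From mathcomp Require Import all_boot all_order all_algebra.
From mathcomp Require Import boolp.

Set Implicit Arguments.
Unset Strict Implicit.
Unset Printing Implicit Defensive.

Import GRing.Theory.
Local Open Scope ring_scope.

Declare Scope tcat_scope.
Delimit Scope tcat_scope with tcat.

Reserved Notation "g \oc f" (at level 45, left associativity).
Reserved Notation "X \ox Y" (at level 40, left associativity).
Reserved Notation "f \om g" (at level 40, left associativity).

Record linCategory (k : fieldType) := LinCategory {
  obj :> Type;
  mor : obj -> obj -> lmodType k;
  idm : forall X, mor X X;
  mcomp : forall X Y Z, mor Y Z -> mor X Y -> mor X Z;
  compA : forall X Y Z W (h : mor Z W) (g : mor Y Z) (f : mor X Y),
    mcomp h (mcomp g f) = mcomp (mcomp h g) f;
  comp1m : forall X Y (f : mor X Y), mcomp (idm Y) f = f;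
  compm1 : forall X Y (f : mor X Y), mcomp f (idm X) = f;
  comp_linl : forall X Y Z (f : mor X Y) (a : k) (g h : mor Y Z),
    mcomp (a *: g + h) f = a *: mcomp g f + mcomp h f;
  comp_linr : forall X Y Z (g : mor Y Z) (a : k) (f h : mor X Y),
    mcomp g (a *: f + h) = a *: mcomp g f + mcomp g h
}.

Arguments mor {k l} X Y.
Arguments idm {k l} X.
Arguments mcomp {k l X Y Z} g f.
Notation "g \oc f" := (mcomp g f) : tcat_scope.
Local Open Scope tcat_scope.

Section LinearNotions.
Variables (k : fieldType) (C : linCategory k).
Implicit Types X Y Z : C.

Definition isIso X Y (f : mor X Y) : Prop :=
  exists g : mor Y X, g \oc f = idm X /\ f \oc g = idm Y.

Definition isZero Z : Prop :=
  (forall X (f : mor Z X), f = 0) /\ (forall X (f : mor X Z), f = 0).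

Definition isMono X Y (f : mor X Y) : Prop :=
  forall W (g h : mor W X), f \oc g = f \oc h -> g = h.

Definition isEpi X Y (f : mor X Y) : Prop :=
  forall W (g h : mor Y W), g \oc f = h \oc f -> g = h.

Definition isKernel X Y K (f : mor X Y) (i : mor K X) : Prop :=
  f \oc i = 0 /\
  forall W (g : mor W X), f \oc g = 0 -> exists! h : mor W K, i \oc h = g.

Definition isCokernel X Y Q (f : mor X Y) (q : mor Y Q) : Prop :=
  q \oc f = 0 /\
  forall W (g : mor Y W), g \oc f = 0 -> exists! h : mor Q W, h \oc q = g.

Definition shortExact X Y Z (i : mor X Y) (q : mor Y Z) : Prop :=
  isKernel q i /\ isCokernel i q.

Definition isSimple X : Prop :=
  ~ isZero X /\
  forall Y (i : mor Y X), isMono i -> isZero Y \/ isIso i.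

(* Existence of a finite filtration with simple subquotients. *)
Inductive finiteLength : C -> Prop :=
| FinLen0 X : isZero X -> finiteLength X
| FinLenS X Y Z (i : mor X Y) (q : mor Y Z) :
    shortExact i q -> finiteLength X -> isSimple Z -> finiteLength Y.

Lemma kernel_monic X Y K (f : mor X Y) (i : mor K X) :
  isKernel f i -> isMono i.
Proof.
move=> [fi0 ker_i] W g h eq_gh.
have fig0 : f \oc (i \oc g) = 0.
  have comp0m : (0 : mor K Y) \oc g = 0.
    have := comp_linl g (-1) (0 : mor K Y) 0.
    by rewrite scaler0 addr0 scaleN1r addNr.
  by rewrite compA fi0.
have [u [_ u_uniq]] := ker_i W _ fig0.
by rewrite -(u_uniq g erefl) -(u_uniq h (esym eq_gh)).
Qed.

End LinearNotions.

(* The zero object, biproducts, kernels and cokernels are chosen. *)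
Record abelianCategory (k : fieldType) := AbelianCategory {
  lincat :> linCategory k;
  zob : lincat;
  zobP : isZero zob;
  bip : lincat -> lincat -> lincat;
  in1 : forall X Y, mor X (bip X Y);
  in2 : forall X Y, mor Y (bip X Y);
  pr1 : forall X Y, mor (bip X Y) X;
  pr2 : forall X Y, mor (bip X Y) Y;
  pr1_in1 : forall X Y, pr1 X Y \oc in1 X Y = idm X;
  pr2_in2 : forall X Y, pr2 X Y \oc in2 X Y = idm Y;
  bip_id : forall X Y,
    in1 X Y \oc pr1 X Y + in2 X Y \oc pr2 X Y = idm (bip X Y);
  kerob : forall X Y, mor X Y -> lincat;
  kerm : forall X Y (f : mor X Y), mor (kerob f) X;
  kermP : forall X Y (f : mor X Y), isKernel f (kerm f);
  cokerob : forall X Y, mor X Y -> lincat;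
  cokerm : forall X Y (f : mor X Y), mor Y (cokerob f);
  cokermP : forall X Y (f : mor X Y), isCokernel f (cokerm f);
  monic_normal : forall (X Y : lincat) (f : mor X Y), isMono f ->
    exists (Z : lincat) (g : mor Y Z), isKernel g f;
  epic_normal : forall (X Y : lincat) (f : mor X Y), isEpi f ->
    exists (Z : lincat) (g : mor Z X), isCokernel g f
}.

Arguments zob {k a}.
Arguments in1 {k a} X Y.
Arguments in2 {k a} X Y.
Arguments pr1 {k a} X Y.
Arguments pr2 {k a} X Y.

Section Subobjects.
Variables (k : fieldType) (C : abelianCategory k).
Implicit Types X Y Z : C.

Record subobject Y := Subobject {
  sob : C;
  sinc : mor sob Y;
  sinc_monic : isMono sinc
}.

Definition kerSub X Y (f : mor X Y) : subobject X :=
  Subobject (kernel_monic (kermP f)).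

Definition imSub X Y (f : mor X Y) : subobject Y := kerSub (cokerm f).

Definition quot Y (S : subobject Y) : C := cokerob (sinc S).

Definition subBot Y : subobject Y := imSub (0 : mor zob Y).

Definition subTop Y : subobject Y := kerSub (0 : mor Y zob).

(* The image of S (+) T -> Y. *)
Definition subSum Y (S T : subobject Y) : subobject Y :=
  imSub (sinc S \oc pr1 (sob S) (sob T) + sinc T \oc pr2 (sob S) (sob T)).

(* The kernel of Y -> Y/S (+) Y/T. *)
Definition subCap Y (S T : subobject Y) : subobject Y :=
  kerSub (in1 (quot S) (quot T) \oc cokerm (sinc S)
          + in2 (quot S) (quot T) \oc cokerm (sinc T)).

End Subobjects.

(* [assocV], [lunitV], [runitV] are the inverses of the structural
   isomorphisms; [dual], [ev], [coev] choose a dual of every object. *)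
Record tensorCategory (k : fieldType) := TensorCategory {
  abcat :> abelianCategory k;

  tens : abcat -> abcat -> abcat;
  tensm : forall X X' Y Y', mor X X' -> mor Y Y' -> mor (tens X Y) (tens X' Y');
  tens_id : forall X Y, tensm (idm X) (idm Y) = idm (tens X Y);
  tens_comp : forall X X' X'' Y Y' Y''
    (f' : mor X' X'') (f : mor X X') (g' : mor Y' Y'') (g : mor Y Y'),
    tensm (f' \oc f) (g' \oc g) = tensm f' g' \oc tensm f g;
  tens_linl : forall X X' Y Y' (g : mor Y Y') (a : k) (f f' : mor X X'),
    tensm (a *: f + f') g = a *: tensm f g + tensm f' g;
  tens_linr : forall X X' Y Y' (f : mor X X') (a : k) (g g' : mor Y Y'),
    tensm f (a *: g + g') = a *: tensm f g + tensm f g';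

  tunit : abcat;
  assoc : forall X Y Z, mor (tens (tens X Y) Z) (tens X (tens Y Z));
  assocV : forall X Y Z, mor (tens X (tens Y Z)) (tens (tens X Y) Z);
  assocK : forall X Y Z, assocV X Y Z \oc assoc X Y Z = idm _;
  assocVK : forall X Y Z, assoc X Y Z \oc assocV X Y Z = idm _;
  assoc_nat : forall X X' Y Y' Z Z'
    (f : mor X X') (g : mor Y Y') (h : mor Z Z'),
    assoc X' Y' Z' \oc tensm (tensm f g) h
    = tensm f (tensm g h) \oc assoc X Y Z;
  lunit : forall X, mor (tens tunit X) X;
  lunitV : forall X, mor X (tens tunit X);
  lunitK : forall X, lunitV X \oc lunit X = idm _;
  lunitVK : forall X, lunit X \oc lunitV X = idm _;
  lunit_nat : forall X Y (f : mor X Y),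
    lunit Y \oc tensm (idm tunit) f = f \oc lunit X;
  runit : forall X, mor (tens X tunit) X;
  runitV : forall X, mor X (tens X tunit);
  runitK : forall X, runitV X \oc runit X = idm _;
  runitVK : forall X, runit X \oc runitV X = idm _;
  runit_nat : forall X Y (f : mor X Y),
    runit Y \oc tensm f (idm tunit) = f \oc runit X;
  pentagon : forall W X Y Z,
    assoc W X (tens Y Z) \oc assoc (tens W X) Y Z
    = tensm (idm W) (assoc X Y Z) \oc assoc W (tens X Y) Z
      \oc tensm (assoc W X Y) (idm Z);
  triangle : forall X Y,
    tensm (idm X) (lunit Y) \oc assoc X tunit Y = tensm (runit X) (idm Y);

  braid : forall X Y, mor (tens X Y) (tens Y X);
  braid_nat : forall X X' Y Y' (f : mor X X') (g : mor Y Y'),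
    braid X' Y' \oc tensm f g = tensm g f \oc braid X Y;
  braid_sym : forall X Y, braid Y X \oc braid X Y = idm (tens X Y);
  hexagon : forall X Y Z,
    assoc Y Z X \oc braid X (tens Y Z) \oc assoc X Y Z
    = tensm (idm Y) (braid X Z) \oc assoc Y X Z
      \oc tensm (braid X Y) (idm Z);

  dual : abcat -> abcat;
  ev : forall X, mor (tens (dual X) X) tunit;
  coev : forall X, mor tunit (tens X (dual X));
  zigzag : forall X,
    runit X \oc tensm (idm X) (ev X) \oc assoc X (dual X) X
      \oc tensm (coev X) (idm X)
    = lunit X;
  zagzig : forall X,
    lunit (dual X) \oc tensm (ev X) (idm (dual X))
      \oc assocV (dual X) X (dual X) \oc tensm (idm (dual X)) (coev X)
    = runit (dual X);

  end_unit : bijective (fun a : k => a *: idm tunit);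
  finlen : forall X : abcat, finiteLength X
}.

Arguments tunit {k t}.
Arguments tensm {k t X X' Y Y'} f g.
Arguments assoc {k t} X Y Z.
Arguments braid {k t} X Y.
Notation "X \ox Y" := (tens X Y) : tcat_scope.
Notation "f \om g" := (tensm f g) : tcat_scope.

(* Least upper bound in N u {oo} of a set of natural numbers; None is oo. *)
Definition nsup (A : nat -> Prop) : option nat :=
  match pselect (exists b, `[< forall n, A n -> (n <= b)%N >]) with
  | left bdA => Some (ex_minn bdA)
  | right _ => None
  end.

Section SymExt.
Variables (k : fieldType) (C : tensorCategory k).
Implicit Types X : C.

(* Right-bracketed: X (x) (X (x) ... (X (x) 1)); degree 1 is X (x) 1 rather
   than X, the two being identified by the unit constraint. *)
Fixpoint tpow X (n : nat) : C :=
  if n is n'.+1 then X \ox tpow X n' else tunit.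

Definition alt2 X : subobject (X \ox X) := imSub (idm (X \ox X) - braid X X).

(* Entry number i-1 of [alts X n], for 1 <= i <= n-1, is the subobject
   X^(i-1) (x) Lambda^2 X (x) X^(n-i-1) of X^n: the entry i = 1 comes from the
   inclusion of Lambda^2 X, the others are X (x) M for M an entry of degree
   n-1.  As (x) is exact, each [imSub] below is the image of a monomorphism. *)
Fixpoint alts X (n : nat) : seq (subobject (tpow X n)) :=
  if n is n'.+1 then
    (if n' is m.+1 return seq (subobject (tpow X n'.+1)) then
       [:: imSub (assoc X X (tpow X m) \oc (sinc (alt2 X) \om idm (tpow X m)))]
     else [::])
    ++ [seq imSub (idm X \om sinc M) | M <- alts X n']
  else [::].

Definition symPow X (n : nat) : C :=
  quot (\big[@subSum k C (tpow X n) / subBot (tpow X n)]_(M <- alts X n) M).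

Definition extPow X (n : nat) : C :=
  sob (\big[@subCap k C (tpow X n) / subTop (tpow X n)]_(M <- alts X n) M).

Definition symDeg X : option nat := nsup (fun m => ~ isZero (symPow X m)).

Definition extDeg X : option nat := nsup (fun n => ~ isZero (extPow X n)).

Definition totalDeg X : option nat :=
  if (symDeg X, extDeg X) is (Some m, Some n) then Some (m + n)%N else None.

End SymExt.

(* Main.v *)
(* Let d be the dimension of X in k. On Sym^m X the contraction against the dual
   of X satisfies der mu = 1 + mu sigma der, whose partial trace over X is d + m.
   In the top degree m = m(X) the left side is zero, so d = -m in k. The same
   computation with P = Sym^p X in place of X, for p = 2 or 3, gives
   dim P = (-1)^p C(m,p). Exterior powers are symmetric powers in the opposite
   category for the braiding -c, so also d = n and dim Lambda^p X = C(n,p) with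
   n = n(X). Finally the exact sequences
     0 -> Lambda^2 -> X X -> Sym^2 -> 0,
     0 -> Lambda^3 -> Lambda^2 X -> X Sym^2 -> Sym^3 -> 0
   give dim Sym^2 + dim Lambda^2 = d^2 and dim Sym^3 - dim Lambda^3 = d^2, which
   together with m + n = 0 mod p forces m + n = 0 mod p^2.
   Objects are replaced by the functors Z (x) -, whose composition is strictly
   associative. *)

(* Modulo p, C(m,p) is the second base-p digit of m. So dim Sym^p X and dim Lambda^p X see m and n
   modulo p^2, while d sees them only modulo p; any relation between the two dimensions becomes a
   condition modulo p^2. The degree-p contraction has to be a divided power: iterating the
   contraction p times and multiplying back gives p! C(m,p), which is 0 in k. There are no elements
   to define it on, so it is specified by a Leibniz rule on products, and its existence is checked
   on the quadratic relations. For p = 3 the rule involves a divided square, obtained by halving.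
   After p multiplications the divided contraction vanishes above the top degree; its partial trace
   over Sym^p X contains the identity, whose trace is the wanted dimension. The restriction to p =
   2, 3 makes the exact sequences cheap: Lambda^3 and Sym^3 are by construction the kernel and
   cokernel of Lambda^2 X (x) X -> X (x) Sym^2 X, so no exactness of a longer Koszul complex is
   involved. Additivity of the dimension itself still has to be proved from duality. *)
From mathcomp Require Import all_boot all_order all_algebra.
From mathcomp Require Import boolp ring zify.
Require Import Defs.

Set Implicit Arguments.
Unset Strict Implicit.
Unset Printing Implicit Defensive.

Import GRing.Theory.
Local Open Scope ring_scope.
Local Open Scope tcat_scope.

(** * Linear categories and functors *)

Section LinearCategory.
Variables (k : fieldType) (C : linCategory k).
Implicit Types X Y Z W : C.

Lemma compDl X Y Z (g h : mor Y Z) (f : mor X Y) :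
  (g + h) \oc f = g \oc f + h \oc f.
Proof. by have := comp_linl f 1 g h; rewrite !scale1r. Qed.

Lemma compDr X Y Z (g : mor Y Z) (f h : mor X Y) :
  g \oc (f + h) = g \oc f + g \oc h.
Proof. by have := comp_linr g 1 f h; rewrite !scale1r. Qed.

Lemma comp0m X Y Z (f : mor X Y) : (0 : mor Y Z) \oc f = 0.
Proof. by apply: (addrI (0 \oc f)); rewrite -compDl !addr0. Qed.

Lemma compm0 X Y Z (g : mor Y Z) : g \oc (0 : mor X Y) = 0.
Proof. by apply: (addrI (g \oc 0)); rewrite -compDr !addr0. Qed.

Lemma compZl X Y Z (a : k) (g : mor Y Z) (f : mor X Y) :
  (a *: g) \oc f = a *: (g \oc f).
Proof. by have := comp_linl f a g 0; rewrite comp0m !addr0. Qed.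

Lemma compZr X Y Z (a : k) (g : mor Y Z) (f : mor X Y) :
  g \oc (a *: f) = a *: (g \oc f).
Proof. by have := comp_linr g a f 0; rewrite compm0 !addr0. Qed.

Lemma compNl X Y Z (g : mor Y Z) (f : mor X Y) : (- g) \oc f = - (g \oc f).
Proof. by rewrite -!scaleN1r compZl. Qed.

Lemma compNr X Y Z (g : mor Y Z) (f : mor X Y) : g \oc (- f) = - (g \oc f).
Proof. by rewrite -!scaleN1r compZr. Qed.

Definition compD := (compDl, compDr).
Definition compZ := (compZl, compZr).
Definition compN := (compNl, compNr).

(** Appends a generic tail to both sides, so that the rewriting rules below, which expect one, also
    apply at the end of a composite. *)
Lemma morP X Y (f g : mor X Y) :
  (forall W (x : mor W X), f \oc x = g \oc x) -> f = g.
Proof. by move=> fg; rewrite -(compm1 f) fg compm1. Qed.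

(* Composites are kept associated to the right; these turn an equation into a
   rewriting rule that also applies in front of a tail [x]. *)
Lemma tl2 X Y Z (a : mor Y Z) (b : mor X Y) c : a \oc b = c ->
  forall W (x : mor W X), a \oc (b \oc x) = c \oc x.
Proof. by move=> <- W x; rewrite compA. Qed.

Lemma tl22 X Y Y' Z (a : mor Y Z) (b : mor X Y) (c : mor Y' Z) (d : mor X Y') :
  a \oc b = c \oc d ->
  forall W (x : mor W X), a \oc (b \oc x) = c \oc (d \oc x).
Proof. by move=> ab W x; rewrite compA ab compA. Qed.

Lemma tl3 X Y Z V (a : mor Z V) (b : mor Y Z) (c : mor X Y) d :
  a \oc (b \oc c) = d ->
  forall W (x : mor W X), a \oc (b \oc (c \oc x)) = d \oc x.
Proof. by move=> <- W x; rewrite !compA. Qed.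

Lemma isZero_id Z : idm Z = 0 -> isZero Z.
Proof.
by move=> id0; split=> X f; [rewrite -(compm1 f) id0 compm0
  | rewrite -(comp1m f) id0 comp0m].
Qed.

Lemma scalar_eq0 Z (a : k) : ~ isZero Z -> a *: idm Z = 0 -> a = 0.
Proof.
move=> Zn0 aid; have [//|an0] := eqVneq a 0; case: Zn0; apply: isZero_id.
by rewrite -(scale1r (idm Z)) -(mulVf an0) -scalerA aid scaler0.
Qed.

(** The default value 0 lets the contractions be defined by recursion before the factorisation is
    known to exist; [factorP] supplies the equation afterwards. *)
Definition factor X Y Z (q : mor X Y) (g : mor X Z) : mor Y Z :=
  if pselect (exists h, h \oc q = g) is left e then projT1 (cid e) else 0.

Lemma factorP X Y Z (q : mor X Y) (g : mor X Z) :
  (exists h, h \oc q = g) -> factor q g \oc q = g.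
Proof. by rewrite /factor; case: pselect => // e _; case: (cid e). Qed.

Record linFunctor := LinFunctor {
  fob :> C -> C;
  fm : forall X Y, mor X Y -> mor (fob X) (fob Y);
  fid : forall X, fm (idm X) = idm (fob X);
  fcomp : forall X Y Z (g : mor Y Z) (f : mor X Y),
    fm (g \oc f) = fm g \oc fm f;
  flin : forall X Y (a : k) (f g : mor X Y), fm (a *: f + g) = a *: fm f + fm g
}.

Variable F : linFunctor.

Lemma fD X Y (f g : mor X Y) : fm F (f + g) = fm F f + fm F g.
Proof. by have := flin F 1 f g; rewrite !scale1r. Qed.

Lemma f0 X Y : fm F (0 : mor X Y) = 0.
Proof. by apply: (addrI (fm F 0)); rewrite -fD !addr0. Qed.

Lemma fZ X Y (a : k) (f : mor X Y) : fm F (a *: f) = a *: fm F f.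
Proof. by have := flin F a f 0; rewrite f0 !addr0. Qed.

Lemma fN X Y (f : mor X Y) : fm F (- f) = - fm F f.
Proof. by rewrite -!scaleN1r fZ. Qed.

Lemma fob_zero Z : isZero Z -> isZero (F Z).
Proof. by case=> /(_ _ (idm Z)) id0 _; apply: isZero_id; rewrite -fid id0 f0. Qed.

Lemma fm2 X Y Z (a : mor Y Z) (b : mor X Y) c :
  a \oc b = c -> fm F a \oc fm F b = fm F c.
Proof. by move=> <-; rewrite fcomp. Qed.

Lemma fm22 X Y Y' Z (a : mor Y Z) (b : mor X Y) (c : mor Y' Z) (d : mor X Y') :
  a \oc b = c \oc d -> fm F a \oc fm F b = fm F c \oc fm F d.
Proof. by rewrite -!fcomp => ->. Qed.

Lemma fm3 X Y Z V (a : mor Z V) (b : mor Y Z) (c : mor X Y) d :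
  a \oc (b \oc c) = d -> fm F a \oc (fm F b \oc fm F c) = fm F d.
Proof. by move=> <-; rewrite !fcomp. Qed.

End LinearCategory.

Arguments fm {k C} l {X Y} f.
Arguments linFunctor {k} C.

(** * The functor T = X (x) - with its braiding and partial trace *)

Section QuadraticData.
Variables (k : fieldType) (C : linCategory k).

(* [qfun] is tensoring with an object X, [qsw] the braiding on the first two
   factors, [qk] the inclusion of the quadratic relations, [qtr] the partial
   trace over X. All axioms are invariant under passing to the opposite category. *)
Record quadData := QuadData {
  qfun :> linFunctor C;
  qsw : forall Y, mor (qfun (qfun Y)) (qfun (qfun Y));
  qsw_nat : forall Y Y' (f : mor Y Y'),
    qsw Y' \oc fm qfun (fm qfun f) = fm qfun (fm qfun f) \oc qsw Y;
  qsw_inv : forall Y, qsw Y \oc qsw Y = idm _;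
  qsw_braid : forall Y,
    qsw (qfun Y) \oc (fm qfun (qsw Y) \oc qsw (qfun Y))
    = fm qfun (qsw Y) \oc (qsw (qfun Y) \oc fm qfun (qsw Y));
  qrel : linFunctor C;
  qk : forall Y, mor (qrel Y) (qfun (qfun Y));
  qk_nat : forall Y Y' (f : mor Y Y'),
    fm qfun (fm qfun f) \oc qk Y = qk Y' \oc fm qrel f;
  qk_anti : forall Y, qsw Y \oc qk Y = - qk Y;
  qk_im : forall Y, exists r, idm _ - qsw Y = qk Y \oc r;
  qk_pass : forall Y, exists r,
    qsw (qfun Y) \oc (fm qfun (qsw Y) \oc qk (qfun Y)) = fm qfun (qk Y) \oc r;
  qtr : forall Y Y', mor (qfun Y) (qfun Y') -> mor Y Y';
  qtr_lin : forall Y Y' a (f g : mor (qfun Y) (qfun Y')),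
    qtr (a *: f + g) = a *: qtr f + qtr g;
  qtr_natl : forall X Y Z (g : mor Y Z) (f : mor (qfun X) (qfun Y)),
    qtr (fm qfun g \oc f) = g \oc qtr f;
  qtr_natr : forall X Y Z (g : mor (qfun Y) (qfun Z)) (f : mor X Y),
    qtr (g \oc fm qfun f) = qtr g \oc f;
  qtr_sw : forall Y, qtr (qsw Y) = idm _;
  qdim : k;
  qtr_id : forall Y, qtr (idm (qfun Y)) = qdim *: idm Y
}.

Variable T : quadData.

Fixpoint tn p (Y : C) : C := if p is p'.+1 then T (tn p' Y) else Y.

Fixpoint tnm p Y Y' (f : mor Y Y') : mor (tn p Y) (tn p Y') :=
  if p is p'.+1 then fm T (tnm p' f) else f.

Fixpoint trn p Y Y' : mor (tn p Y) (tn p Y') -> mor Y Y' :=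
  if p is p'.+1 then fun f => trn (qtr f) else id.

(** The cyclic permutation carrying the outermost factor inside the [p] others; [prho] is the map it
    induces on the symmetric power. *)
Fixpoint cyc p Y : mor (T (tn p Y)) (tn p (T Y)) :=
  if p is p'.+1 then fm T (cyc p' Y) \oc qsw T (tn p' Y) else idm _.

(** The relations of the second and third symmetric powers, one for each pair of adjacent factors.
    Other values of [p] do not occur and get a placeholder. *)
Definition kills p Y W : mor (tn p Y) W -> Prop :=
  match p with
  | 2 => fun g => g \oc qk T Y = 0
  | 3 => fun g => g \oc qk T (T Y) = 0 /\ g \oc fm T (qk T Y) = 0
  | _ => fun => True
  end.

(* [S n.+3] plays the role of the n-th symmetric power; the padding by zero
   objects makes the recursion for the derivations below uniform. *)
Record symTower := SymTower {
  st :> nat -> C;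
  mu : forall n, mor (T (st n)) (st n.+1);
  st_zero : forall n, (n < 3)%N -> isZero (st n);
  mu_rel : forall n, mu n.+1 \oc (fm T (mu n) \oc qk T (st n)) = 0;
  mu_fac : forall n W (g : mor (T (st n.+1)) W),
    g \oc (fm T (mu n) \oc qk T (st n)) = 0 -> exists h, h \oc mu n.+1 = g;
  mu_epi : forall n, isEpi (mu n.+3);
  Tmu_epi : forall n, isEpi (fm T (mu n.+3))
}.

(* [pw] is tensoring with the p-th symmetric power, a quotient [ppi] of the p-th
   iterate of [T]; [prho] and [ptau] braid it past [T] and past itself. *)
Record powData p := PowData {
  pw :> linFunctor C;
  ppi : forall Y, mor (tn p Y) (pw Y);
  ppi_nat : forall Y Y' (f : mor Y Y'), ppi Y' \oc tnm p f = fm pw f \oc ppi Y;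
  ppi_kills : forall Y, kills (ppi Y);
  ppi_fac : forall Y W (g : mor (tn p Y) W), kills g -> exists h, h \oc ppi Y = g;
  ppi_epi : forall Y, isEpi (ppi Y);
  Tppi_epi : forall Y, isEpi (fm T (ppi Y));
  prho : forall Y, mor (T (pw Y)) (pw (T Y));
  prho_nat : forall Y Y' (f : mor Y Y'),
    prho Y' \oc fm T (fm pw f) = fm pw (fm T f) \oc prho Y;
  prho_pi : forall Y, prho Y \oc fm T (ppi Y) = ppi (T Y) \oc cyc p Y;
  prho_pass : forall Y, exists r,
    prho (T Y) \oc (fm T (prho Y) \oc qk T (pw Y)) = fm pw (qk T Y) \oc r;
  prhon := fix prhon n Y : mor (tn n (pw Y)) (pw (tn n Y)) :=
    if n is n'.+1 then prho (tn n' Y) \oc fm T (prhon n' Y) else idm _;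
  ptau : forall Y, mor (pw (pw Y)) (pw (pw Y));
  ptau_pi : forall Y, ptau Y \oc ppi (pw Y) = fm pw (ppi Y) \oc prhon p Y;
  ptr : forall Y Y', mor (pw Y) (pw Y') -> mor Y Y';
  ptr_lin : forall Y Y' a (f g : mor (pw Y) (pw Y')),
    ptr (a *: f + g) = a *: ptr f + ptr g;
  ptr_natl : forall X Y Z (g : mor Y Z) (f : mor (pw X) (pw Y)),
    ptr (fm pw g \oc f) = g \oc ptr f;
  ptr_natr : forall X Y Z (g : mor (pw Y) (pw Z)) (f : mor X Y),
    ptr (g \oc fm pw f) = ptr g \oc f;
  ptr_pi : forall Y Y' (g : mor (pw Y) (tn p Y')),
    ptr (ppi Y' \oc g) = trn (g \oc ppi Y);
  ptr_tau : forall Y, ptr (ptau Y) = idm _;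
  pdim : k;
  ptr_id : forall Y, ptr (idm (pw Y)) = pdim *: idm Y
}.

End QuadraticData.

Ltac mnorm := rewrite ?(fid, fcomp, fD, fN, fZ, compD, compN, compZ, comp1m, compm1) -?compA.

(** * Derivations on the symmetric powers *)

Section Derivation.
Variables (k : fieldType) (C : linCategory k) (T : quadData C) (S : symTower T).

Lemma qtr0 Y Y' : qtr (0 : mor (T Y) (T Y')) = 0.
Proof.
by have := qtr_lin (-1) (0 : mor (T Y) (T Y')) 0; rewrite scaler0 addr0 scaleN1r addNr.
Qed.

Lemma qtrD Y Y' (f g : mor (T Y) (T Y')) : qtr (f + g) = qtr f + qtr g.
Proof. by have := qtr_lin 1 f g; rewrite !scale1r. Qed.

Lemma qtrZ Y Y' a (f : mor (T Y) (T Y')) : qtr (a *: f) = a *: qtr f.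
Proof. by have := qtr_lin a f 0; rewrite qtr0 !addr0. Qed.

Lemma qtr_fm Y Y' (f : mor Y Y') : qtr (fm T f) = qdim T *: f.
Proof.
by rewrite -(compm1 (fm T f)) qtr_natl qtr_id compZr compm1.
Qed.

(* The contraction, determined by the Leibniz rule [der_mu]. *)
Fixpoint der n : mor (S n.+1) (T (S n)) :=
  if n is m.+1 then factor (mu S m.+1)
    (idm _ + fm T (mu S m) \oc (qsw T (S m) \oc fm T (der m)))
  else 0.

Lemma zero_dom n V (f g : mor (S n) V) : (n < 3)%N -> f = g.
Proof. by move=> /(st_zero S) [z _]; rewrite (z _ f) (z _ g). Qed.

Lemma zero_Tdom n V (f g : mor (T (S n)) V) : (n < 3)%N -> f = g.
Proof. by move=> /(st_zero S)/(fob_zero T) [z _]; rewrite (z _ f) (z _ g). Qed.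

(** The right-hand side must kill the relations of the next symmetric power. Expanding [der] once
    more, the first two terms cancel because the braiding is -1 on the relations. In the third one
    [qk_pass] moves the relations past the extra factor, where [mu_rel] kills them. *)
Lemma der_mu n : der n.+1 \oc mu S n.+1
  = idm _ + fm T (mu S n) \oc (qsw T (S n) \oc fm T (der n)).
Proof.
elim: n => [|n IHn]; first exact: zero_Tdom.
have [n_small|n_big] := ltnP n.+2 3; first exact: zero_Tdom.
apply: factorP; apply: mu_fac;
have [r Hr] := qk_pass T (S n).
apply: morP => W x; mnorm.
rewrite (tl2 (fm2 T (IHn))); mnorm.
rewrite (tl2 (qk_anti T _)) (tl2 (qk_nat T _)); mnorm.
rewrite [qsw T (S n.+1) \oc _](tl2 (qsw_nat T _)); mnorm.
rewrite (tl3 Hr); mnorm.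
rewrite (tl3 (fm3 T (mu_rel S n))) f0 comp0m addr0 subrr comp0m.
by [].
Qed.

Lemma mu_sw n : mu S n.+1 \oc (fm T (mu S n) \oc qsw T (S n)) = mu S n.+1 \oc fm T (mu S n).
Proof.
have [r Hr] := qk_im T (S n).
have: mu S n.+1 \oc (fm T (mu S n) \oc (idm _ - qsw T (S n))) = 0.
  by rewrite Hr (tl3 (mu_rel S n)) comp0m.
by mnorm => /eqP; rewrite subr_eq0 => /eqP.
Qed.

(** Euler's identity. With the shift by 3, [S n.+1] sits in degree n - 2, and truncated subtraction
    gives the right value 0 on the padding. *)
Lemma mu_der n : mu S n \oc der n = (n - 2)%:R *: idm _.
Proof.
elim: n => [|n IHn]; first by apply: zero_dom.
have [n_small|] := ltnP n 2.
  rewrite (@zero_Tdom _ _ (mu S n.+1) 0) // comp0m.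
  by case: n n_small {IHn} => [|[|]] // _; rewrite scale0r.
case: n IHn => [|[|n]] // IHn _; apply: mu_epi.
rewrite -compA der_mu; apply: morP => W x; mnorm.
rewrite (tl3 (mu_sw _)); mnorm.
rewrite (tl2 (fm2 T IHn)); mnorm.
by rewrite -[X in X + _]scale1r -scalerDl -natr1 addrC subn2.
Qed.

(* The partial trace of the Leibniz rule is dim X + m, and its left-hand side
   vanishes in top degree. *)
Theorem top_dim m : ~ isZero (S m.+3) -> isZero (S m.+4) -> qdim T = - m%:R.
Proof.
move=> S_m [_ S_m1].
apply/eqP; rewrite -subr_eq0 opprK; apply/eqP; apply: (scalar_eq0 S_m).
have: qtr (der m.+3 \oc mu S m.+3) = 0 by rewrite (S_m1 _ (mu S m.+3)) compm0 qtr0.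
rewrite der_mu qtrD qtr_natl qtr_natr qtr_id qtr_sw comp1m mu_der.
by rewrite -scalerDl => <-; rewrite subn2.
Qed.

End Derivation.

Section PowData.
Variables (k : fieldType) (C : linCategory k) (T : quadData C).
Variables (p : nat) (P : powData T p).

Lemma ptr0 Y Y' : ptr (0 : mor (P Y) (P Y')) = 0.
Proof.
by have := ptr_lin (-1) (0 : mor (P Y) (P Y')) 0; rewrite scaler0 addr0 scaleN1r addNr.
Qed.

Lemma ptrD Y Y' (f g : mor (P Y) (P Y')) : ptr (f + g) = ptr f + ptr g.
Proof. by have := ptr_lin 1 f g; rewrite !scale1r. Qed.

Lemma ptrZ Y Y' a (f : mor (P Y) (P Y')) : ptr (a *: f) = a *: ptr f.
Proof. by have := ptr_lin a f 0; rewrite ptr0 !addr0. Qed.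

End PowData.

(** * The symmetric square *)

Section SymmetricSquare.
Variables (k : fieldType) (C : linCategory k) (T : quadData C) (S : symTower T).
Variable P : powData T 2.

Let pi Y : mor (T (T Y)) (P Y) := ppi P Y.

Lemma prho_pi2 Y : prho P Y \oc fm T (pi Y)
  = pi (T Y) \oc (fm T (qsw T Y) \oc qsw T (T Y)).
Proof. by apply: (etrans (prho_pi P Y)); rewrite /=; mnorm. Qed.

Lemma pi2_k Y : pi Y \oc qk T Y = 0.
Proof. exact: (ppi_kills P Y). Qed.

Lemma pi2_epi Y : isEpi (pi Y).
Proof. exact: (@ppi_epi _ _ _ _ P Y). Qed.

Lemma Tpi2_epi Y : isEpi (fm T (pi Y)).
Proof. exact: (@Tppi_epi _ _ _ _ P Y). Qed.

Lemma pi2_nat Y Y' (f : mor Y Y') : fm P f \oc pi Y = pi Y' \oc fm T (fm T f).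
Proof. exact/esym/(ppi_nat P). Qed.

(* The divided square of the contraction: twice it is [pi] applied to [der] twice. *)
Fixpoint der2 n : mor (S n.+2) (P (S n)) :=
  if n is m.+1 then factor (mu S m.+2)
    (pi (S m.+1) \oc fm T (der S m.+1) + fm P (mu S m) \oc (prho P (S m) \oc fm T (der2 m)))
  else 0.

(** Follows the pattern of [der_mu]: [pi] kills the term in which both contractions return the new
    factors, the two mixed terms cancel by antisymmetry, and [prho_pass] reduces the last one to
    [mu_rel]. *)
Lemma der2_mu n : der2 n.+1 \oc mu S n.+2
  = pi (S n.+1) \oc fm T (der S n.+1)
    + fm P (mu S n) \oc (prho P (S n) \oc fm T (der2 n)).
Proof.
elim: n => [|n IHn]; first exact: zero_Tdom.
apply: factorP; apply: mu_fac.
have [r Hr] := prho_pass P (S n).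
apply: morP => W x; mnorm.
rewrite (tl2 (fm2 T (der_mu S _))) (tl2 (fm2 T IHn)); mnorm.
rewrite (tl2 (pi2_k _)) comp0m add0r.
rewrite !(tl2 (qk_nat T _)); mnorm.
rewrite [prho P (S n.+1) \oc _](tl2 (prho_pi2 _)); mnorm.
rewrite (tl2 (qk_anti T _)); mnorm.
rewrite (tl2 (pi2_nat _)); mnorm.
rewrite [prho P (S n.+1) \oc _](tl2 (prho_nat P _)); mnorm.
rewrite (tl3 Hr); mnorm.
rewrite (tl3 (fm3 P (mu_rel S n))) f0 comp0m addr0.
exact: subrr.
Qed.

Definition mu2 n : mor (P (S n)) (S n.+2) :=
  factor (pi (S n)) (mu S n.+1 \oc fm T (mu S n)).

Lemma mu2_pi n : mu2 n \oc pi (S n) = mu S n.+1 \oc fm T (mu S n).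
Proof.
by apply: factorP; apply: (ppi_fac (p:=2)); rewrite /= -compA mu_rel.
Qed.

Lemma mu2_rho n : mu2 n.+1 \oc (fm P (mu S n) \oc prho P (S n)) = mu S n.+2 \oc fm T (mu2 n).
Proof.
apply: Tpi2_epi; apply: morP => W x; mnorm.
rewrite (tl2 (prho_pi2 _)); mnorm.
rewrite (tl2 (pi2_nat _)) -compA (tl2 (mu2_pi _)); mnorm.
rewrite (tl2 (fm2 T (mu2_pi _))); mnorm.
rewrite (tl3 (fm3 T (mu_sw _ _))); mnorm.
rewrite -[fm T (fm T (mu S n)) \oc _](tl22 (qsw_nat T _)).
by rewrite (tl3 (mu_sw _ _)); mnorm.
Qed.

(** The divided Euler identity, [S n.+2] being in degree n - 1. Under the Leibniz rule the induction
    step becomes Pascal's rule. *)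
Lemma mu2_der2 n : mu2 n \oc der2 n = 'C(n - 1, 2)%:R *: idm _.
Proof.
elim: n => [|n IHn]; first by apply: zero_dom.
case: n IHn => [|n] IHn.
  by rewrite (_ : der2 1 = 0) ?compm0 ?scale0r //;
     apply: (fob_zero P (st_zero S (isT : (1 < 3)%N))).2.
apply: mu_epi; rewrite -compA der2_mu; apply: morP => W x; mnorm.
rewrite (tl2 (mu2_pi _)); mnorm.
rewrite (tl3 (mu2_rho _)); mnorm.
rewrite !(tl2 (fm2 T (mu_der _ _))) (tl2 (fm2 T IHn)); mnorm.
rewrite -scalerDl -natrD; congr (_ %:R *: _).
by rewrite !subSS !subn0 binS bin1 addnC.
Qed.

Lemma ptau_pi2 Y : ptau P Y \oc pi (P Y)
  = fm P (pi Y) \oc (prho P (T Y) \oc fm T (prho P Y)).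
Proof. by apply: (etrans (ptau_pi P Y)); rewrite /=; mnorm. Qed.

Lemma ptr_pi2 Y Y' (g : mor (P Y) (T (T Y'))) :
  ptr (pi Y' \oc g) = qtr (qtr (g \oc pi Y)).
Proof. exact: (ptr_pi (p:=2)). Qed.

(** The composite of [der2] with two multiplications vanishes since Sym^(m+2) does. By the Leibniz
    rules it is the identity of Sym^2, plus terms exchanging one factor ([A]), plus a term
    exchanging both ([B]). The partial traces of the three over Sym^2 are the three summands. *)
Theorem top_square m : ~ isZero (S m.+3) -> isZero (S m.+4.+1) ->
  pdim P + m%:R * (qdim T + 1) + 'C(m, 2)%:R = 0.
Proof.
move=> S_m [_ S_m2]; apply: (scalar_eq0 S_m).
(* The norm 1 + sigma descended to Sym^2. It merges the two mixed terms into one map that passes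
   through the tensor square, so that its trace over Sym^2 becomes a double trace over X. *)
pose del := factor (pi (T (S m.+2))) (idm _ + qsw T (T (S m.+2))).
have delP : del \oc pi _ = idm _ + qsw T (T (S m.+2)).
  apply/factorP/(ppi_fac (p:=2)).
  by rewrite /= compDl qk_anti comp1m subrr.
pose A := fm T (fm T (mu S m.+2)) \oc (fm T (qsw T _) \oc (del \oc fm P (der S m.+2))).
pose B := fm P (mu2 m.+1) \oc (ptau P _ \oc fm P (der2 m.+1)).
have E : idm _ + pi _ \oc A + B = 0.
  apply: pi2_epi; rewrite comp0m.
  have <- : der2 m.+3 \oc (mu S m.+4 \oc fm T (mu S m.+3)) = 0 :> mor _ (P (S m.+3)).
    by rewrite (S_m2 _ (mu S m.+4 \oc _)) compm0.
  rewrite compA der2_mu /A /B; apply: morP => W x; mnorm.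
  rewrite (tl2 (fm2 T (der_mu _ _))) (tl2 (fm2 T (der2_mu _))); mnorm.
  rewrite !(tl2 (pi2_nat _)); mnorm.
  rewrite (tl2 (prho_pi2 _)) (tl2 delP); mnorm.
  rewrite (tl2 (ptau_pi2 _)); mnorm.
  rewrite (tl2 (fm2 P (mu2_pi _))) (tl2 (pi2_nat _)); mnorm.
  by rewrite (tl2 (prho_nat P _)); mnorm; rewrite !addrA.
have trA : qtr (qtr (A \oc pi _)) = (m%:R * (qdim T + 1)) *: idm (S m.+3).
  have -> : A \oc pi _ = fm T (fm T (mu S m.+2)) \oc ((fm T (qsw T _)
      + fm T (qsw T _) \oc qsw T _) \oc fm T (fm T (der S m.+2))).
    apply: morP => W x; rewrite /A; mnorm.
    by rewrite (tl2 (pi2_nat _)); mnorm; rewrite (tl2 delP); mnorm.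
  rewrite !qtr_natl !qtr_natr !qtrD qtr_natl qtr_fm !qtr_sw qtrZ compm1.
  rewrite qtr_sw; mnorm; rewrite mu_der subn2 /=.
  by rewrite mulrC mulrDl mul1r scalerDl scalerA.
have trB : ptr B = 'C(m, 2)%:R *: idm (S m.+3).
  by rewrite ptr_natl ptr_natr ptr_tau comp1m mu2_der2 subn1.
have : ptr (idm _ + pi _ \oc A + B) = 0 by rewrite E ptr0.
by rewrite !ptrD ptr_pi2 trA trB ptr_id -!scalerDl.
Qed.

End SymmetricSquare.

(** * The symmetric cube *)

Section SymmetricCube.
Variables (k : fieldType) (C : linCategory k) (T : quadData C) (S : symTower T).
Variables (P : powData T 3) (e : k).
Hypothesis e_half : e + e = 1.

Let pi Y : mor (T (T (T Y))) (P Y) := ppi P Y.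
Let s1 Y : mor (T (T (T Y))) (T (T (T Y))) := qsw T (T Y).
Let s2 Y : mor (T (T (T Y))) (T (T (T Y))) := fm T (qsw T Y).

Lemma prho_pi3 Y : prho P Y \oc fm T (pi Y)
  = pi (T Y) \oc (fm T (fm T (qsw T Y)) \oc (fm T (qsw T (T Y)) \oc qsw T (T (T Y)))).
Proof. by apply: (etrans (prho_pi P Y)); rewrite /=; mnorm. Qed.

Lemma pi3_k1 Y : pi Y \oc qk T (T Y) = 0.
Proof. exact: (ppi_kills P Y).1. Qed.

Lemma pi3_k2 Y : pi Y \oc fm T (qk T Y) = 0.
Proof. exact: (ppi_kills P Y).2. Qed.

Lemma pi3_epi Y : isEpi (pi Y).
Proof. exact: (@ppi_epi _ _ _ _ P Y). Qed.

Lemma Tpi3_epi Y : isEpi (fm T (pi Y)).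
Proof. exact: (@Tppi_epi _ _ _ _ P Y). Qed.

Lemma pi3_nat Y Y' (f : mor Y Y') : fm P f \oc pi Y = pi Y' \oc fm T (fm T (fm T f)).
Proof. exact/esym/(ppi_nat P). Qed.

Lemma pi3_s1 Y : pi Y \oc qsw T (T Y) = pi Y.
Proof.
have [r Hr] := qk_im T (T Y).
have: pi Y \oc (idm _ - qsw T (T Y)) = 0 by rewrite Hr (tl2 (pi3_k1 Y)) comp0m.
by mnorm => /eqP; rewrite subr_eq0 => /eqP.
Qed.

Lemma pi3_s2 Y : pi Y \oc fm T (qsw T Y) = pi Y.
Proof.
have [r Hr] := qk_im T Y.
have: pi Y \oc fm T (idm _ - qsw T Y) = 0.
  by rewrite Hr fcomp (tl2 (pi3_k2 Y)) comp0m.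
by mnorm => /eqP; rewrite subr_eq0 => /eqP.
Qed.

(* The divided cube of the contraction; its Leibniz rule needs the divided square,
   which is available since 2 is invertible. *)
Fixpoint der3 n : mor (S n.+3) (P (S n)) :=
  if n is m.+1 then factor (mu S m.+3)
    (e *: (pi (S m.+1) \oc (fm T (fm T (der S m.+1)) \oc fm T (der S m.+2)))
     + fm P (mu S m) \oc (prho P (S m) \oc fm T (der3 m)))
  else 0.

Lemma der3_mu n : der3 n.+1 \oc mu S n.+3
  = e *: (pi (S n.+1) \oc (fm T (fm T (der S n.+1)) \oc fm T (der S n.+2)))
    + fm P (mu S n) \oc (prho P (S n) \oc fm T (der3 n)).
Proof.
elim: n => [|n IHn].
  have [_ z] := fob_zero P (st_zero S (isT : (1 < 3)%N)).
  by rewrite [LHS]z [RHS]z.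
apply: factorP; apply: mu_fac.
have [r Hr] := prho_pass P (S n).
apply: morP => W x; mnorm.
rewrite (tl2 (fm2 T (der_mu S _))) (tl2 (fm2 T IHn)); mnorm.
rewrite !(tl22 (qk_nat T _)).
rewrite (tl2 (pi3_k1 _)) comp0m add0r.
rewrite (tl2 (fm2 T (fm2 T (der_mu S _)))); mnorm.
rewrite (tl2 (pi3_s2 _)) (tl2 (pi3_k1 _)) comp0m add0r.
rewrite (tl2 (fm2 T (esym (qsw_nat T _)))); mnorm.
rewrite !(tl22 (qk_nat T _)).
rewrite [prho P (S n.+1) \oc _](tl2 (prho_pi3 _)); mnorm.
rewrite (tl2 (qk_anti T _)); mnorm.
rewrite (tl2 (pi3_nat _)); mnorm.
rewrite [prho P (S n.+1) \oc _](tl2 (prho_nat P _)); mnorm.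
rewrite (tl3 Hr); mnorm.
rewrite (tl3 (fm3 P (mu_rel S n))) f0 comp0m addr0.
by rewrite scalerN subrr comp0m.
Qed.

Definition mu3 n : mor (P (S n)) (S n.+3) :=
  factor (pi (S n)) (mu S n.+2 \oc (fm T (mu S n.+1) \oc fm T (fm T (mu S n)))).

Lemma mu3_pi n : mu3 n \oc pi (S n)
  = mu S n.+2 \oc (fm T (mu S n.+1) \oc fm T (fm T (mu S n))).
Proof.
apply: factorP; apply: (ppi_fac (p:=3)); split.
  rewrite -!compA qk_nat compA; apply: (etrans (esym (compA _ _ _))).
  by rewrite (tl3 (mu_rel S _)) comp0m.
by rewrite -!compA (fm3 T (mu_rel S n)) f0 compm0.
Qed.

Lemma mu3_rho n : mu3 n.+1 \oc (fm P (mu S n) \oc prho P (S n)) = mu S n.+3 \oc fm T (mu3 n).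
Proof.
apply: Tpi3_epi; apply: morP => W x; mnorm.
rewrite (tl2 (prho_pi3 _)); mnorm.
rewrite (tl2 (pi3_nat _)); mnorm.
rewrite (tl2 (mu3_pi _)); mnorm.
rewrite (tl2 (fm2 T (mu3_pi _))); mnorm.
rewrite (tl3 (fm3 T (fm3 T (mu_sw _ _)))); mnorm.
rewrite -[fm T (fm T (fm T (mu S n))) \oc _](tl22 (fm22 T (qsw_nat T _))).
rewrite (tl3 (fm3 T (mu_sw _ _))); mnorm.
rewrite -[fm T (fm T (fm T (mu S n))) \oc _](tl22 (qsw_nat T _)).
rewrite -[fm T (fm T (mu S n.+1)) \oc _](tl22 (qsw_nat T _)).
by rewrite (tl3 (mu_sw _ _)); mnorm.
Qed.

Lemma mu3_der3 n : mu3 n \oc der3 n = 'C(n, 3)%:R *: idm _.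
Proof.
elim: n => [|n IHn].
  by rewrite (_ : der3 0 = 0) // compm0 scale0r.
have [n_small|] := ltnP n 2.
  rewrite (_ : der3 n.+1 = 0) ?compm0 ?bin_small ?scale0r //.
  exact: (fob_zero P (st_zero S (n_small : (n.+1 < 3)%N))).2.
case: n IHn => [|[|n]] // IHn _.
apply: mu_epi; rewrite -compA der3_mu; apply: morP => W x; mnorm.
rewrite (tl2 (mu3_pi _)); mnorm.
rewrite (tl3 (mu3_rho _)); mnorm.
rewrite (tl2 (fm2 T (fm2 T (mu_der _ _)))); mnorm.
rewrite (tl2 (fm2 T (mu_der _ _))) (tl2 (fm2 T IHn)); mnorm.
rewrite !scalerA -scalerDl; congr (_ *: _).
(* The coefficient [e] turns this product of consecutive integers into the second binomial of
   Pascal's rule. *)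
have bin2R : (n.+1%:R * n.+2%:R : k) = 'C(n.+2, 2)%:R + 'C(n.+2, 2)%:R.
  by rewrite -natrM mulnC -{2}(bin1 n.+1) mul_bin_diag mulSn mul1n natrD.
rewrite !subSS !subn0 [in RHS]binS natrD addrC -mulrA bin2R mulrDr -mulrDl.
by rewrite e_half mul1r.
Qed.

(* [exch1] exchanges the third explicit factor with one factor of the symmetric
   power, [exch2] the second and third with two. *)
Definition exch1 n : mor (T (T (T (S n.+1)))) (T (T (T (S n.+1)))) :=
  fm T (fm T (fm T (mu S n)))
  \oc (fm T (fm T (qsw T (S n))) \oc fm T (fm T (fm T (der S n)))).

Definition exch2 n : mor (T (T (T (S n.+2)))) (T (T (T (S n.+2)))) :=
  fm T (fm T (fm T (mu S n.+1))) \oc (fm T (fm T (fm T (fm T (mu S n))))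
  \oc (fm T (fm T (qsw T (T (S n)))) \oc (fm T (qsw T (T (T (S n))))
  \oc (fm T (fm T (fm T (qsw T (S n)))) \oc (fm T (fm T (qsw T (T (S n))))
  \oc (fm T (fm T (fm T (fm T (der S n)))) \oc fm T (fm T (fm T (der S n.+1))))))))).

Lemma pi_exch1_s1 n : pi _ \oc (exch1 n \oc s1 _) = pi _ \oc exch1 n.
Proof.
apply: morP => W x; rewrite /exch1 /s1; mnorm.
rewrite -[fm T (fm T (fm T (der S n))) \oc _](tl22 (qsw_nat T _)).
rewrite -[fm T (fm T (qsw T (S n))) \oc _](tl22 (qsw_nat T _)).
rewrite -[fm T (fm T (fm T (mu S n))) \oc _](tl22 (qsw_nat T _)).
by rewrite (tl2 (pi3_s1 _)).
Qed.

(** The braid relation carries the transposition through the exchange to the two factors being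
    multiplied into the symmetric power, where commutativity absorbs it. *)
Lemma exch2_s2 n : exch2 n \oc s2 _ = exch2 n.
Proof.
apply: morP => W x; rewrite /exch2 /s2; mnorm.
rewrite (tl22 (fm22 T (esym (qsw_nat T (der S n.+1))))).
rewrite (tl22 (fm22 T (esym (qsw_nat T (fm T (der S n)))))).
rewrite (tl22 (fm22 T (qsw_nat T (qsw T _)))).
rewrite (tl3 (fm3 T (qsw_braid T _))); mnorm.
rewrite (tl3 (fm3 T (fm3 T (qsw_braid T _)))); mnorm.
rewrite (tl3 (fm3 T (fm3 T (fm3 T (mu_sw S _))))); mnorm.
by rewrite (tl22 (fm22 T (qsw_nat T (qsw T _)))).
Qed.

(** The contraction of the left exchange meets the multiplication of the right one. The Leibniz rule
    splits the composite: either the factor just inserted is taken back, leaving a single exchange,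
    or another one is, giving a double exchange. *)
Lemma pi_exch1_s2_exch1 n : pi _ \oc (exch1 n.+1 \oc (s2 _ \oc exch1 n.+1))
  = pi _ \oc (exch1 n.+1 \oc s2 _) + pi _ \oc exch2 n.
Proof.
apply: morP => W x; rewrite /exch1 /exch2 /s2; mnorm.
rewrite (tl22 (fm22 T (esym (qsw_nat T (der S n.+1))))).
rewrite (tl2 (fm2 T (fm2 T (fm2 T (der_mu S _))))); mnorm.
congr (_ + _).
  rewrite (tl3 (fm3 T (esym (qsw_braid T _)))); mnorm.
  rewrite -(tl22 (fm22 T (qsw_nat T (mu S n.+1)))) (tl2 (pi3_s2 _)).
  by rewrite -(tl22 (fm22 T (qsw_nat T (der S n.+1)))).
rewrite (tl22 (fm22 T (qsw_nat T (fm T (mu S n))))).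
rewrite (tl22 (fm22 T (fm22 T (qsw_nat T (mu S n))))).
by rewrite (tl22 (fm22 T (fm22 T (esym (qsw_nat T (der S n)))))).
Qed.

Lemma pi_exch1_s2_s1_exch1 n : pi _ \oc (exch1 n.+1 \oc (s2 _ \oc (s1 _ \oc exch1 n.+1)))
  = pi _ \oc (exch1 n.+1 \oc (s2 _ \oc s1 _)) + pi _ \oc (exch2 n \oc s1 _).
Proof.
apply: morP => W x; rewrite /exch1 /exch2 /s2 /s1; mnorm.
rewrite (tl22 (fm22 T (esym (qsw_nat T (der S n.+1))))).
rewrite (tl22 (esym (qsw_nat T (fm T (der S n.+1))))).
rewrite (tl2 (fm2 T (fm2 T (fm2 T (der_mu S _))))); mnorm.
congr (_ + _).
  rewrite (tl22 (qsw_nat T (qsw T (S n.+1)))).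
  rewrite (tl3 (fm3 T (esym (qsw_braid T _)))); mnorm.
  rewrite -(tl22 (fm22 T (qsw_nat T (mu S n.+1)))) (tl2 (pi3_s2 _)).
  rewrite (tl22 (qsw_nat T (fm T (der S n.+1)))).
  by rewrite (tl22 (fm22 T (qsw_nat T (der S n.+1)))).
rewrite (tl22 (qsw_nat T (fm T (fm T (mu S n))))).
rewrite (tl22 (fm22 T (qsw_nat T (fm T (mu S n))))).
rewrite (tl22 (fm22 T (fm22 T (qsw_nat T (mu S n))))).
rewrite (tl22 (fm22 T (fm22 T (esym (qsw_nat T (der S n)))))).
rewrite (tl22 (esym (qsw_nat T (fm T (der S n.+1))))).
rewrite (tl22 (esym (qsw_nat T (fm T (fm T (der S n)))))).
by rewrite (tl22 (qsw_nat T (fm T (qsw T _)))) (tl22 (qsw_nat T (qsw T _))).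
Qed.

(** Terms are grouped by the number of factors exchanged with the symmetric power: none, one, two or
    all three. Within a group the permutations are coset representatives for the symmetries of the
    exchange. *)
Lemma der3_mu3 m : der3 m.+3 \oc (mu S m.+4.+1 \oc (fm T (mu S m.+4) \oc fm T (fm T (mu S m.+3))))
  = pi (S m.+3) + pi _ \oc exch1 m.+2 + pi _ \oc (exch1 m.+2 \oc s2 _)
    + pi _ \oc (exch1 m.+2 \oc (s2 _ \oc s1 _))
    + e *: (pi _ \oc exch2 m.+1 + pi _ \oc (exch2 m.+1 \oc s1 _)
            + pi _ \oc (exch2 m.+1 \oc (s1 _ \oc s2 _)))
    + fm P (mu S m.+2) \oc (fm P (fm T (mu S m.+1)) \oc (fm P (fm T (fm T (mu S m)))
      \oc (prho P _ \oc (fm T (prho P _) \oc (fm T (fm T (prho P _))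
      \oc fm T (fm T (fm T (der3 m)))))))).
Proof.
(* Generic names for the exchanges and transpositions, so that reassociating composites does not
   unfold them. *)
have [b Eb] : {b | b = exch1 m.+2} by exists (exch1 m.+2).
have [b2 Eb2] : {b2 | b2 = exch2 m.+1} by exists (exch2 m.+1).
have [s Es] : {s | s = s2 (S m.+3)} by exists (s2 (S m.+3)).
have [t Et] : {t | t = s1 (S m.+3)} by exists (s1 (S m.+3)).
have Hb W (x : mor W _) : fm T (fm T (der S m.+3)) \oc (fm T (fm T (mu S m.+3)) \oc x)
      = x + b \oc x.
  by rewrite (tl2 (fm2 T (fm2 T (der_mu S _)))) Eb /exch1; mnorm.
have Hs W (x : mor W _) : pi _ \oc (s \oc x) = pi _ \oc x.
  by rewrite Es (tl2 (pi3_s2 _)).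
have Hbsb W (x : mor W _) : pi _ \oc (b \oc (s \oc (b \oc x)))
    = pi _ \oc (b \oc (s \oc x)) + pi _ \oc (b2 \oc x).
  have := congr1 (fun f => f \oc x) (pi_exch1_s2_exch1 m.+1).
  by rewrite -Eb -Eb2 -Es; mnorm.
have Hbstb W (x : mor W _) : pi _ \oc (b \oc (s \oc (t \oc (b \oc x))))
    = pi _ \oc (b \oc (s \oc (t \oc x))) + pi _ \oc (b2 \oc (t \oc x)).
  have := congr1 (fun f => f \oc x) (pi_exch1_s2_s1_exch1 m.+1).
  by rewrite -Eb -Eb2 -Es -Et; mnorm.
have Hrho W (x : mor W _) : fm P (mu S m.+2) \oc (prho P _ \oc (fm T (pi _)
    \oc (fm T (fm T (fm T (der S m.+2))) \oc x))) = pi _ \oc (b \oc (s \oc (t \oc x))).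
  rewrite (tl2 (prho_pi3 _)) Eb Es Et /exch1 /s2 /s1; mnorm.
  rewrite (tl2 (pi3_nat _)); mnorm.
  rewrite (tl22 (qsw_nat T (fm T (der S m.+2)))).
  by rewrite (tl22 (fm22 T (qsw_nat T (der S m.+2)))).
have Hrho2 W (x : mor W _) : fm P (mu S m.+2) \oc (prho P _ \oc (fm T (fm P (mu S m.+1))
    \oc (fm T (prho P _) \oc (fm T (fm T (pi _)) \oc (fm T (fm T (fm T (fm T (der S m.+1))))
    \oc (fm T (fm T (fm T (der S m.+2))) \oc x)))))) = pi _ \oc (b2 \oc (t \oc (s \oc x))).
  rewrite (tl2 (fm2 T (prho_pi3 _))) Eb2 Es Et /exch2 /s2 /s1; mnorm.
  rewrite (tl2 (prho_nat P _)); mnorm.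
  rewrite (tl2 (prho_pi3 _)); mnorm.
  rewrite (tl2 (pi3_nat _)); mnorm.
  rewrite (tl2 (pi3_nat _)); mnorm.
  rewrite (tl22 (esym (qsw_nat T (fm T (der S m.+2))))).
  rewrite (tl22 (esym (qsw_nat T (fm T (fm T (der S m.+1)))))).
  rewrite (tl22 (fm22 T (esym (qsw_nat T (der S m.+2))))).
  rewrite (tl22 (fm22 T (esym (qsw_nat T (fm T (der S m.+1)))))).
  by rewrite (tl22 (qsw_nat T (fm T (qsw T _)))) (tl22 (qsw_nat T (qsw T _))).
rewrite -Eb -Eb2 -Es -Et; apply: morP => W x; mnorm.
rewrite (tl2 (der3_mu _)); mnorm.
rewrite (tl2 (fm2 T (der_mu S _))); mnorm.
rewrite (tl2 (fm2 T (der3_mu _))); mnorm.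
rewrite !Hb (tl2 (fm2 T (fm2 T (der3_mu _)))); mnorm.
rewrite (_ : fm T (qsw T (S m.+3)) = s) ?Es // -Es.
rewrite !Hrho !Hrho2; mnorm.
rewrite !Hs Hbsb Hbstb !(tl2 (prho_nat P _)) !(tl2 (fm2 T (prho_nat P _))); mnorm.
rewrite (tl2 (prho_nat P _)); mnorm.
(* Each term with at most one exchange arises twice with coefficient [e]; the reordering below
   brings the equal halves together. *)
have halves V Z (f : mor V Z : lmodType k) : e *: f + e *: f = f.
  by rewrite -scalerDl e_half scale1r.
rewrite !scalerDr (AC ((2*(2*(1*2)))*((1*2)*2)) ((1*3)*(2*4)*(5*6)*(8*9)*(7*10*11)*12)).
by rewrite /= !halves.
Qed.

Lemma ptau_pi3 Y : ptau P Y \oc pi (P Y)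
  = fm P (pi Y) \oc (prho P (T (T Y)) \oc (fm T (prho P (T Y)) \oc fm T (fm T (prho P Y)))).
Proof. by apply: (etrans (ptau_pi P Y)); rewrite /=; mnorm. Qed.

Lemma ptr_pi3 Y Y' (g : mor (P Y) (T (T (T Y')))) :
  ptr (pi Y' \oc g) = qtr (qtr (qtr (g \oc pi Y))).
Proof. exact: (ptr_pi (p:=3)). Qed.

(** Right multiplication by either transposition pairs off the six permutations, and it acts by -1
    on the corresponding relations, so the terms cancel in pairs. For the second transposition the
    longest permutation is first rewritten by the braid relation. *)
Lemma norm3_factor Y : exists h, h \oc pi Y = idm _ + s1 Y + s2 Y
  + s1 Y \oc s2 Y + s2 Y \oc s1 Y + s1 Y \oc (s2 Y \oc s1 Y).
Proof.
apply: (ppi_fac (p:=3)); split; rewrite /s1 /s2.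
  rewrite /=; mnorm; rewrite !qk_anti; mnorm.
  by rewrite (AC 6 ((1*2)*(3*5)*(4*6))) /= !subrr !addr0.
rewrite (qsw_braid T Y) /=; mnorm; rewrite -!fcomp qk_anti; mnorm.
by rewrite (AC 6 ((1*3)*(2*4)*(5*6))) /= !subrr !addr0.
Qed.

(** Closing the three outer strands turns each of the six permutations into a power of d = [qdim T]
    counting closed loops. The sum is d^2 + 3d + 2, and the remaining strand contributes
    [mu_der]. *)
Lemma qtr_exch1 n : qtr (qtr (qtr (exch1 n.+2 \oc (idm _ + s1 _ + s2 _
  + s1 _ \oc s2 _ + s2 _ \oc s1 _ + s1 _ \oc (s2 _ \oc s1 _)))))
  = (n%:R * (qdim T + 1) * (qdim T + 1 + 1)) *: idm (S n.+3).
Proof.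
pose q Y Y' (f : mor (T (T (T Y))) (T (T (T Y')))) := qtr (qtr (qtr f)).
have qD Y Y' f g : @q Y Y' (f + g) = q _ _ f + q _ _ g by rewrite /q !qtrD.
have qb w w' : fm T (fm T (fm T (der S n.+2))) \oc w = w' \oc fm T (fm T (fm T (der S n.+2))) ->
   q _ _ (exch1 n.+2 \oc w) = mu S n.+2 \oc (q _ _ (fm T (fm T (qsw T _)) \oc w') \oc der S n.+2).
  rewrite /exch1 => Hw; rewrite -2!compA Hw (compA (fm T (fm T (qsw T _)))).
  by rewrite /q !(qtr_natl, qtr_natr).
have D1 : fm T (fm T (fm T (der S n.+2))) \oc s1 _ = qsw T _ \oc fm T (fm T (fm T (der S n.+2))).
  by rewrite /s1 qsw_nat.
have D2 : fm T (fm T (fm T (der S n.+2))) \oc s2 _ = fm T (qsw T _) \oc fm T (fm T (fm T (der S n.+2))).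
  by rewrite /s2 (fm22 T (qsw_nat T _)).
rewrite -/(q _ _ _) !compDr !qD.
rewrite (qb _ (idm _)) ?compm1 ?comp1m // (qb _ _ D1) (qb _ _ D2).
rewrite (qb _ (qsw T _ \oc fm T (qsw T _))); last by rewrite compA D1 -!compA D2.
rewrite (qb _ (fm T (qsw T _) \oc qsw T _)); last by rewrite compA D2 -!compA D1.
rewrite (qb _ (fm T (qsw T _) \oc (qsw T _ \oc fm T (qsw T _)))); last first.
  by rewrite /s1 /s2 qsw_braid -/(s1 _) -/(s2 _) compA D2 -!compA (tl2 D1) -!compA D2.
rewrite /q; mnorm.
do 5!rewrite ?(qtr_natl, qtr_natr, qtr_fm, qtr_id, qtrZ, qtr_sw, qsw_inv, compZ, comp1m, compm1).
rewrite mu_der !scalerA.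
rewrite -!scalerDl !subSS subn0; congr (_ *: _).
by ring.
Qed.

(** The permutation exchanging factors 2 and 3, as a block, with factors 4 and 5. *)
Definition blocksw Y := fm T (fm T (qsw T (T Y))) \oc (fm T (qsw T (T (T Y)))
  \oc (fm T (fm T (fm T (qsw T Y))) \oc fm T (fm T (qsw T (T Y))))).

Lemma qtr_blocksw Y : qtr (qtr (qtr (blocksw Y))) = qdim T *: idm (T (T Y)).
Proof.
rewrite /blocksw -!fcomp qtr_fm !qtrZ qtr_natl qtr_natr qtr_sw comp1m.
by rewrite qsw_braid qtr_natl qtr_natr qtr_sw comp1m qsw_inv.
Qed.

Lemma qtr_blocksw_s1 Y : qtr (qtr (qtr (blocksw Y \oc qsw T _))) = idm (T (T Y)).
Proof.
rewrite /blocksw -!fcomp qtr_natl qtr_sw compm1.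
rewrite qtr_natl qtr_natr qtr_sw comp1m.
by rewrite qsw_braid qtr_natl qtr_natr qtr_sw comp1m qsw_inv.
Qed.

Lemma qtr_blocksw_s1s2 Y :
  qtr (qtr (qtr (blocksw Y \oc (qsw T _ \oc fm T (qsw T _))))) = qsw T Y.
Proof.
rewrite /blocksw -!fcomp qtr_natl qtr_natr qtr_sw comp1m.
rewrite !fcomp -!compA !qtr_natl.
rewrite (tl22 (qsw_nat T (qsw T Y))) qsw_braid.
by rewrite !qtr_natl qtr_natr qtr_sw comp1m qsw_inv compm1 qtr_natr qtr_sw comp1m.
Qed.

(** The three traces are d, 1 and a transposition of the two factors multiplied into the symmetric
    power; the latter acts trivially by commutativity ([MswD]), hence the factor d + 2. *)
Lemma qtr_exch2 n : qtr (qtr (qtr (exch2 n.+1 \oc (idm _ + s1 _ + s1 _ \oc s2 _))))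
  = (n%:R * (n - 1)%:R * (qdim T + 1 + 1)) *: idm (S n.+3).
Proof.
pose M := mu S n.+2 \oc fm T (mu S n.+1).
pose D := fm T (der S n.+1) \oc der S n.+2.
have MD : M \oc D = (n%:R * (n - 1)%:R) *: idm _.
  apply: morP => W x; rewrite /M /D; mnorm.
  rewrite (tl2 (fm2 T (mu_der _ _))); mnorm.
  by rewrite (tl2 (mu_der _ _)); mnorm; rewrite !subSS !subn0 scalerA mulrC.
have MswD : M \oc (qsw T _ \oc D) = M \oc D.
  by rewrite /M -!compA (tl3 (mu_sw S n.+1)) -compA.
have -> : exch2 n.+1 \oc (idm _ + s1 _ + s1 _ \oc s2 _)
   = fm T (fm T (fm T M)) \oc ((blocksw _ + blocksw _ \oc qsw T _
       + blocksw _ \oc (qsw T _ \oc fm T (qsw T _))) \oc fm T (fm T (fm T D))).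
  apply: morP => W x; rewrite /exch2 /blocksw /M /D /s1 /s2; mnorm.
  rewrite !(tl22 (esym (qsw_nat T (fm T (der S n.+2))))).
  rewrite !(tl22 (esym (qsw_nat T (fm T (fm T (der S n.+1)))))).
  rewrite (tl22 (fm22 T (esym (qsw_nat T (der S n.+2))))).
  by rewrite (tl22 (fm22 T (esym (qsw_nat T (fm T (der S n.+1)))))).
rewrite !(qtr_natl, qtr_natr) !qtrD qtr_blocksw qtr_blocksw_s1 qtr_blocksw_s1s2.
rewrite !(compDl, compDr) compZl compZr comp1m MswD MD scalerA -!scalerDl; congr (_ *: _).
by ring.
Qed.

(** As for the square, with the partial sums of [der3_mu3] completed to the norm over all six
    permutations. Since [pi \oc exch1] is invariant under [s1] on the right and [exch2] under [s2],
    each completion doubles the sum, which accounts for one factor [e] for [exch1] and a further one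
    for [exch2]. *)
Theorem top_cube m : ~ isZero (S m.+3) -> isZero (S m.+4.+2) ->
  pdim P + e * (m%:R * (qdim T + 1) * (qdim T + 2%:R))
    + e * (m%:R * (m - 1)%:R * (qdim T + 2%:R)) + 'C(m, 3)%:R = 0.
Proof.
move=> S_m [_ S_m3]; apply: (scalar_eq0 S_m).
pose N := idm _ + s1 (S m.+3) + s2 (S m.+3) + s1 (S m.+3) \oc s2 (S m.+3)
  + s2 (S m.+3) \oc s1 (S m.+3) + s1 (S m.+3) \oc (s2 (S m.+3) \oc s1 (S m.+3)).
(* As [del \oc pi] is the norm, partial traces over [P] of maps through [del] become
   traces of permutations over the third iterate of [T]. *)
pose del := factor (pi (S m.+3)) N.
have delP : del \oc pi _ = N by apply/factorP/norm3_factor.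
pose B := fm P (mu3 m) \oc (ptau P _ \oc fm P (der3 m)).
have bN : e *: (pi _ \oc (exch1 m.+2 \oc N)) = pi _ \oc exch1 m.+2
    + pi _ \oc (exch1 m.+2 \oc s2 _) + pi _ \oc (exch1 m.+2 \oc (s2 _ \oc s1 _)).
  have Ht W (x : mor W _) : pi (S m.+3) \oc (exch1 m.+2 \oc (s1 _ \oc x)) = pi _ \oc (exch1 m.+2 \oc x).
    by have := congr1 (fun f => f \oc x) (pi_exch1_s1 m.+2); rewrite /= -!compA.
  rewrite /N !compDr compm1 pi_exch1_s1 !Ht.
  rewrite (AC 6 ((1*2)*(3*4)*(5*6))) /= !scalerDr.
  by rewrite -!scalerDl e_half !scale1r.
have b2N : exch2 m.+1 \oc N = (exch2 m.+1 \oc (idm _ + s1 _ + s1 _ \oc s2 _))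
    + (exch2 m.+1 \oc (idm _ + s1 _ + s1 _ \oc s2 _)).
  have Hs W (x : mor W _) : exch2 m.+1 \oc (s2 _ \oc x) = exch2 m.+1 \oc x.
    by rewrite compA exch2_s2.
  have -> : N = idm _ + s1 _ + s2 _ + s1 _ \oc s2 _ + s2 _ \oc s1 _ + s2 _ \oc (s1 _ \oc s2 _).
    by rewrite /N /s1 /s2 qsw_braid.
  rewrite !compDr compm1 exch2_s2 !Hs.
  by rewrite (AC 6 ((1*2*4)*(3*5*6))).
have trb : qtr (qtr (qtr (exch1 m.+2 \oc N)))
    = (m%:R * (qdim T + 1) * (qdim T + 2%:R)) *: idm (S m.+3).
  by rewrite qtr_exch1 -addrA.
have trb2 : qtr (qtr (qtr (exch2 m.+1 \oc N)))
    = (m%:R * (m - 1)%:R * (qdim T + 2%:R)) *: idm (S m.+3)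
      + (m%:R * (m - 1)%:R * (qdim T + 2%:R)) *: idm (S m.+3).
  by rewrite b2N !qtrD qtr_exch2 -addrA.
have H := der3_mu3 m.
move: (exch1 m.+2) (exch2 m.+1) bN b2N trb trb2 H => b b2 bN b2N trb trb2 H.
have E : idm _ + e *: (pi _ \oc (b \oc del)) + e *: (e *: (pi _ \oc (b2 \oc del))) + B = 0.
  apply: pi3_epi; rewrite comp0m.
  have <- : der3 m.+3 \oc (mu S m.+4.+1 \oc (fm T (mu S m.+4) \oc fm T (fm T (mu S m.+3)))) = 0.
    by rewrite (S_m3 _ (mu S m.+4.+1 \oc _)) compm0.
  rewrite H !compDl !compZl -!compA delP bN b2N comp1m 2!compDr scalerDr -scalerDl e_half scale1r.
  congr (_ + _ + _); first by rewrite !addrA.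
    by rewrite !compDr compm1.
  apply: morP => W x; rewrite /B; mnorm.
  rewrite [fm P (der3 m) \oc _](tl2 (pi3_nat _)); mnorm.
  rewrite (tl2 (ptau_pi3 _)); mnorm.
  by rewrite (tl2 (fm2 P (mu3_pi _))); mnorm.
have trB : ptr B = 'C(m, 3)%:R *: idm (S m.+3).
  by rewrite ptr_natl ptr_natr ptr_tau comp1m mu3_der3.
have := congr1 (@ptr _ _ _ _ P _ _) E; rewrite ptr0 !ptrD !ptrZ !ptr_pi3 trB ptr_id.
rewrite -!compA delP trb trb2 scalerDr -[in X in _ + X + _]scalerDl => <-.
by rewrite e_half scale1r !scalerA -!scalerDl.
Qed.

End SymmetricCube.

(** * Coherence and partial traces in tensor categories *)

Section Coherence.
Variables (k : fieldType) (C : tensorCategory k).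
Implicit Types X Y Z V W : C.

Fact lwh_id Z Y : idm Z \om idm Y = idm (Z \ox Y). Proof. exact: tens_id. Qed.

Fact lwh_comp Z X Y W (g : mor Y W) (f : mor X Y) :
  idm Z \om (g \oc f) = (idm Z \om g) \oc (idm Z \om f).
Proof. by rewrite -tens_comp comp1m. Qed.

Fact lwh_lin Z X Y (a : k) (f g : mor X Y) :
  idm Z \om (a *: f + g) = a *: (idm Z \om f) + idm Z \om g.
Proof. exact: tens_linr. Qed.

Definition lwh Z : linFunctor C := LinFunctor (lwh_id Z) (@lwh_comp Z) (@lwh_lin Z).

Definition rwh Z Z' (b : mor Z Z') Y : mor (lwh Z Y) (lwh Z' Y) := b \om idm Y.

Lemma rwh_id Z Y : rwh (idm Z) Y = idm _. Proof. exact: tens_id. Qed.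

Lemma rwh_comp Z Z' Z'' (c : mor Z' Z'') (b : mor Z Z') Y :
  rwh (c \oc b) Y = rwh c Y \oc rwh b Y.
Proof. by rewrite /rwh -tens_comp comp1m. Qed.

Lemma rwhD Z Z' (b c : mor Z Z') Y : rwh (b + c) Y = rwh b Y + rwh c Y.
Proof. by have := tens_linl (idm Y) 1 b c; rewrite !scale1r. Qed.

Lemma rwh0 Z Z' Y : rwh (0 : mor Z Z') Y = 0.
Proof. by apply: (addrI (rwh 0 Y)); rewrite -rwhD !addr0. Qed.

Lemma rwhZ Z Z' (a : k) (b : mor Z Z') Y : rwh (a *: b) Y = a *: rwh b Y.
Proof. by have := tens_linl (idm Y) a b 0; rewrite -/(rwh _ _) -/(rwh 0 _) rwh0 !addr0. Qed.

Lemma rwhN Z Z' (b : mor Z Z') Y : rwh (- b) Y = - rwh b Y.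
Proof. by rewrite -!scaleN1r rwhZ. Qed.

Lemma lwh_rwh Z Z' (b : mor Z Z') Y Y' (f : mor Y Y') :
  fm (lwh Z') f \oc rwh b Y = rwh b Y' \oc fm (lwh Z) f.
Proof. by rewrite /rwh /= -!tens_comp !comp1m !compm1. Qed.

Lemma rwh2 Z1 Z2 Z3 (a : mor Z2 Z3) (b : mor Z1 Z2) c Y :
  a \oc b = c -> rwh a Y \oc rwh b Y = rwh c Y.
Proof. by move=> <-; rewrite rwh_comp. Qed.

Lemma rwh22 Z1 Z2 Z2' Z3 (a : mor Z2 Z3) (b : mor Z1 Z2) (c : mor Z2' Z3)
    (d : mor Z1 Z2') Y :
  a \oc b = c \oc d -> rwh a Y \oc rwh b Y = rwh c Y \oc rwh d Y.
Proof. by rewrite -!rwh_comp => ->. Qed.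

(** The associator with its type written through the functors [lwh], the form in which the
    naturality rules match. *)
Definition asc Z V Y : mor (lwh (Z \ox V) Y) (lwh Z (lwh V Y)) := assoc Z V Y.
Definition ascV Z V Y : mor (lwh Z (lwh V Y)) (lwh (Z \ox V) Y) := assocV Z V Y.

Lemma ascK Z V Y : ascV Z V Y \oc asc Z V Y = idm _. Proof. exact: assocK. Qed.
Lemma ascVK Z V Y : asc Z V Y \oc ascV Z V Y = idm _. Proof. exact: assocVK. Qed.

Lemma asc_nat3 Z V Y Y' (f : mor Y Y') :
  asc Z V Y' \oc fm (lwh (Z \ox V)) f = fm (lwh Z) (fm (lwh V) f) \oc asc Z V Y.
Proof. by have := assoc_nat (idm Z) (idm V) f; rewrite tens_id. Qed.

Lemma asc_nat1 Z Z' (b : mor Z Z') V Y :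
  asc Z' V Y \oc rwh (rwh b V) Y = rwh b (V \ox Y) \oc asc Z V Y.
Proof. by have := assoc_nat b (idm V) (idm Y); rewrite tens_id. Qed.

Lemma asc_nat2 Z V V' (v : mor V V') Y :
  asc Z V' Y \oc rwh (fm (lwh Z) v) Y = fm (lwh Z) (rwh v Y) \oc asc Z V Y.
Proof. exact: (assoc_nat (idm Z) v (idm Y)). Qed.

Lemma flip_square X X' Y Y' (a : mor X X') (aV : mor X' X) (b : mor Y Y')
    (bV : mor Y' Y) (f : mor X Y) (g : mor X' Y') :
  a \oc aV = idm _ -> bV \oc b = idm _ -> b \oc f = g \oc a -> f \oc aV = bV \oc g.
Proof.
move=> aK bK H; rewrite -(comp1m (f \oc aV)) -bK -compA (compA b) H.
by rewrite -(compA g) aK compm1.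
Qed.

Lemma ascV_nat3 Z V Y Y' (f : mor Y Y') :
  fm (lwh (Z \ox V)) f \oc ascV Z V Y = ascV Z V Y' \oc fm (lwh Z) (fm (lwh V) f).
Proof. exact: (flip_square (ascVK _ _ _) (ascK _ _ _) (asc_nat3 Z V f)). Qed.

Lemma ascV_nat1 Z Z' (b : mor Z Z') V Y :
  rwh (rwh b V) Y \oc ascV Z V Y = ascV Z' V Y \oc rwh b (V \ox Y).
Proof. exact: (flip_square (ascVK _ _ _) (ascK _ _ _) (asc_nat1 b V Y)). Qed.

Lemma ascV_nat2 Z V V' (v : mor V V') Y :
  rwh (fm (lwh Z) v) Y \oc ascV Z V Y = ascV Z V' Y \oc fm (lwh Z) (rwh v Y).
Proof. exact: (flip_square (ascVK _ _ _) (ascK _ _ _) (asc_nat2 Z v Y)). Qed.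

Lemma penta W X Y Z : asc W X (Y \ox Z) \oc asc (W \ox X) Y Z
  = fm (lwh W) (asc X Y Z) \oc (asc W (X \ox Y) Z \oc rwh (asc W X Y) Z).
Proof. by rewrite (compA (fm _ _)); apply: pentagon. Qed.

(* The braiding as a transformation Z (x) (V (x) Y) -> V (x) (Z (x) Y). It and the
   maps below are locked so that reassociating composites does not unfold them. *)
Definition bet Z V Y : mor (lwh Z (lwh V Y)) (lwh V (lwh Z Y)) :=
  locked (asc V Z Y \oc (rwh (braid Z V) Y \oc ascV Z V Y)).

Lemma betE Z V Y : bet Z V Y = asc V Z Y \oc (rwh (braid Z V) Y \oc ascV Z V Y).
Proof. by rewrite /bet -lock. Qed.

Lemma bet_asc Z V Y : bet Z V Y \oc asc Z V Y = asc V Z Y \oc rwh (braid Z V) Y.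
Proof. by rewrite !betE -!compA ascK compm1. Qed.

Lemma bet_nat3 Z V Y Y' (f : mor Y Y') :
  bet Z V Y' \oc fm (lwh Z) (fm (lwh V) f) = fm (lwh V) (fm (lwh Z) f) \oc bet Z V Y.
Proof.
rewrite !betE -!compA -ascV_nat3 (tl22 (esym (lwh_rwh (braid Z V) f))).
by rewrite (tl22 (asc_nat3 V Z f)).
Qed.

Lemma bet_nat1 Z Z' (b : mor Z Z') V Y :
  bet Z' V Y \oc rwh b (lwh V Y) = fm (lwh V) (rwh b Y) \oc bet Z V Y.
Proof.
rewrite !betE -!compA -ascV_nat1.
have H : braid Z' V \oc rwh b V = fm (lwh V) b \oc braid Z V by exact: braid_nat.
by rewrite (tl22 (rwh22 Y H)) (tl22 (asc_nat2 V b Y)).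
Qed.

Lemma bet_nat2 Z V V' (v : mor V V') Y :
  bet Z V' Y \oc fm (lwh Z) (rwh v Y) = rwh v (lwh Z Y) \oc bet Z V Y.
Proof.
rewrite !betE -!compA -ascV_nat2.
have H : braid Z V' \oc fm (lwh Z) v = rwh v Z \oc braid Z V by exact: braid_nat.
by rewrite (tl22 (rwh22 Y H)) (tl22 (asc_nat1 v Z Y)).
Qed.

Lemma bet_inv Z V Y : bet V Z Y \oc bet Z V Y = idm _.
Proof.
rewrite !betE -!compA (tl2 (ascK _ _ _)) comp1m.
by rewrite (tl2 (rwh2 Y (braid_sym _ _))) rwh_id comp1m ascVK.
Qed.

(** Crossing a tensor product amounts to crossing its factors one after the other: the hexagon, with
    pentagons absorbing the extra argument [Y]. *)
Lemma bet_hex X Z V Y : asc Z V (lwh X Y) \oc bet X (Z \ox V) Y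
  = fm (lwh Z) (bet X V Y) \oc (bet X Z (lwh V Y) \oc fm (lwh X) (asc Z V Y)).
Proof.
have hexV : asc Z V X \oc braid X (Z \ox V)
    = fm (lwh Z) (braid X V) \oc (asc Z X V \oc (rwh (braid X Z) V \oc ascV X Z V)).
  have := hexagon X Z V; rewrite -!/(asc _ _ _) => /(congr1 (fun f => f \oc ascV X Z V)).
  by rewrite -!compA ascVK compm1.
rewrite {1}betE (tl2 (penta _ _ _ _)) -!compA (tl2 (rwh2 Y hexV)).
rewrite !rwh_comp -!compA (tl22 (asc_nat2 Z (braid X V) Y)).
rewrite !betE !fcomp -!compA; congr (_ \oc (_ \oc _)).
have pV : asc Z (X \ox V) Y \oc rwh (asc Z X V) Y
    = fm (lwh Z) (ascV X V Y) \oc (asc Z X (V \ox Y) \oc asc (Z \ox X) V Y).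
  by rewrite penta (tl2 (fm2 (lwh Z) (ascK X V Y))) fid comp1m.
rewrite (tl2 pV) -!compA; congr (_ \oc (_ \oc _)).
rewrite (tl22 (asc_nat1 _ _ _)); congr (_ \oc _).
have <- : ascV X Z (V \ox Y) \oc (asc X Z (V \ox Y) \oc (asc (X \ox Z) V Y
    \oc (rwh (ascV X Z V) Y \oc ascV X (Z \ox V) Y)))
  = asc (X \ox Z) V Y \oc (rwh (ascV X Z V) Y \oc ascV X (Z \ox V) Y).
  by rewrite (tl2 (ascK _ _ _)) comp1m.
congr (_ \oc _).
rewrite (tl2 (penta _ _ _ _)) -!compA (tl2 (rwh2 Y (ascVK _ _ _))) rwh_id comp1m.
by rewrite ascVK compm1.
Qed.

Lemma bet_hexV X Z V Y : fm (lwh X) (asc Z V Y) \oc bet (Z \ox V) X Y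
  = bet Z X (lwh V Y) \oc (fm (lwh Z) (bet V X Y) \oc asc Z V (lwh X Y)).
Proof.
rewrite -[LHS]comp1m -(bet_inv X Z) -compA; congr (_ \oc _).
rewrite -[LHS]comp1m -(fid (lwh Z)) -(bet_inv X V) fcomp -compA; congr (_ \oc _).
by rewrite (tl3 (esym (bet_hex X Z V Y))) -compA bet_inv compm1.
Qed.

(** The Yang-Baxter equation: naturality of the crossing of [X] past [Z \ox V] with respect to the
    braiding of [Z] and [V], expanded by the hexagon on both sides. *)
Lemma bet_braid X Z V Y :
  fm (lwh V) (bet X Z Y) \oc (bet X V (lwh Z Y) \oc fm (lwh X) (bet Z V Y))
  = bet Z V (lwh X Y) \oc (fm (lwh Z) (bet X V Y) \oc bet X Z (lwh V Y)).
Proof.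
have cancel_asc f g : f \oc fm (lwh X) (asc Z V Y) = g \oc fm (lwh X) (asc Z V Y) ->
    f = g :> mor _ (lwh V (lwh Z (lwh X Y))).
  move=> fg; rewrite -(compm1 f) -(compm1 g) -(fid (lwh X)) -(ascVK Z V Y) fcomp.
  by rewrite !compA fg.
apply: cancel_asc; rewrite -!compA -(bet_hex X Z V Y) -fcomp bet_asc fcomp.
rewrite (compA (bet Z V _)) bet_asc -compA -bet_nat2 (compA (asc _ _ _)) bet_hex.
by rewrite -!compA.
Qed.

Definition lun Y : mor (lwh tunit Y) Y := lunit Y.
Definition lunV Y : mor Y (lwh tunit Y) := lunitV Y.

Lemma lunK Y : lunV Y \oc lun Y = idm _. Proof. exact: lunitK. Qed.
Lemma lunVK Y : lun Y \oc lunV Y = idm _. Proof. exact: lunitVK. Qed.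

Lemma lun_nat Y Y' (f : mor Y Y') : lun Y' \oc fm (lwh tunit) f = f \oc lun Y.
Proof. exact: lunit_nat. Qed.

Lemma lunV_nat Y Y' (f : mor Y Y') : fm (lwh tunit) f \oc lunV Y = lunV Y' \oc f.
Proof. exact: (flip_square (lunVK _) (lunK _) (lun_nat f)). Qed.

Lemma triang Z Y : fm (lwh Z) (lun Y) \oc asc Z tunit Y = rwh (runit Z) Y.
Proof. exact: triangle. Qed.

(** Kelly's argument: tensoring with the unit is faithful, and after doing so the claim follows from
    the pentagon and two triangles. *)
Lemma lun_asc Z Y : lun (lwh Z Y) \oc asc tunit Z Y = rwh (lun Z) Y.
Proof.
have inj f g : fm (lwh tunit) f = fm (lwh tunit) g -> f = g :> mor (lwh (tunit \ox Z) Y) (lwh Z Y).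
  move=> fg; rewrite -(compm1 f) -(compm1 g) -lunVK !compA -!lun_nat.
  by rewrite fg.
apply: inj; rewrite fcomp.
have E : asc tunit (tunit \ox Z) Y \oc (rwh (asc tunit tunit Z) Y
    \oc (rwh (ascV tunit tunit Z) Y \oc ascV tunit (tunit \ox Z) Y)) = idm _.
  by rewrite (tl2 (rwh2 Y (ascVK _ _ _))) rwh_id comp1m ascVK.
rewrite -[LHS]compm1 -[RHS]compm1 -E -!compA.
rewrite (tl3 (esym (penta tunit tunit Z Y))) -!compA.
rewrite (tl2 (triang tunit (lwh Z Y))) -(tl22 (asc_nat2 tunit (lun Z) Y)).
rewrite (tl2 (rwh2 Y (triang tunit Z))) (tl22 (asc_nat1 (runit tunit) Z Y)).
by [].
Qed.

Lemma lun_bet X Y : lun (lwh X Y) \oc bet X tunit Y = fm (lwh X) (lun Y).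
Proof.
(* First for arguments [Z \ox W], where an added crossing with [Z] allows the hexagon to apply;
   every [Y] is isomorphic to such an argument with [Z] the unit. *)
have base Z W : lun (lwh X (lwh Z W)) \oc bet X tunit (lwh Z W)
    = fm (lwh X) (lun (lwh Z W)).
  have E : fm (lwh X) (asc tunit Z W) \oc fm (lwh X) (ascV tunit Z W) = idm _.
    by rewrite -fcomp ascVK fid.
  rewrite -[LHS]comp1m -[RHS]comp1m -(bet_inv X Z) -!compA; congr (_ \oc _).
  rewrite -[LHS]compm1 -[RHS]compm1 -E -!compA.
  rewrite -(tl22 (lun_nat (bet X Z W))) (tl3 (esym (bet_hex X tunit Z W))) -compA.
  rewrite (tl2 (lun_asc Z _)) -(tl22 (bet_nat2 X (lun Z) W)).
  by rewrite (tl2 (fm2 (lwh X) (lun_asc Z W))).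
have E : fm (lwh X) (fm (lwh tunit) (lun Y)) \oc fm (lwh X) (fm (lwh tunit) (lunV Y)) = idm _.
  by rewrite -!fcomp lunVK !fid.
rewrite -[LHS]compm1 -[RHS]compm1 -E -!compA (tl22 (bet_nat3 X tunit (lun Y))).
rewrite (tl22 (lun_nat (fm (lwh X) (lun Y)))) (tl2 (base tunit Y)).
by rewrite (tl22 (fm22 (lwh X) (lun_nat (lun Y)))).
Qed.

Lemma lun_betV X Y : fm (lwh X) (lun Y) \oc bet tunit X Y = lun (lwh X Y).
Proof. by rewrite -lun_bet -compA bet_inv compm1. Qed.

(** * Evaluation and coevaluation as natural transformations *)

Definition dcup Z Y : mor Y (lwh Z (lwh (dual Z) Y)) :=
  locked (asc Z (dual Z) Y \oc (rwh (coev Z) Y \oc lunV Y)).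

Definition dcap Z Y : mor (lwh (dual Z) (lwh Z Y)) Y :=
  locked (lun Y \oc (rwh (ev Z) Y \oc ascV (dual Z) Z Y)).

Lemma dcupE Z Y : dcup Z Y = asc Z (dual Z) Y \oc (rwh (coev Z) Y \oc lunV Y).
Proof. by rewrite /dcup -lock. Qed.

Lemma dcapE Z Y : dcap Z Y = lun Y \oc (rwh (ev Z) Y \oc ascV (dual Z) Z Y).
Proof. by rewrite /dcap -lock. Qed.

Lemma dcup_nat Z Y Y' (f : mor Y Y') :
  dcup Z Y' \oc f = fm (lwh Z) (fm (lwh (dual Z)) f) \oc dcup Z Y.
Proof.
rewrite !dcupE -!compA -lunV_nat (tl22 (esym (lwh_rwh (coev Z) f))).
by rewrite (tl22 (asc_nat3 Z _ f)).
Qed.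

Lemma dcap_nat Z Y Y' (f : mor Y Y') :
  dcap Z Y' \oc fm (lwh (dual Z)) (fm (lwh Z) f) = f \oc dcap Z Y.
Proof.
rewrite !dcapE -!compA -ascV_nat3 (tl22 (esym (lwh_rwh (ev Z) f))).
by rewrite (tl22 (lun_nat f)).
Qed.

Lemma ascV_asc W X Y Z : fm (lwh W) (ascV X Y Z) \oc asc W X (lwh Y Z)
  = asc W (X \ox Y) Z \oc (rwh (asc W X Y) Z \oc ascV (W \ox X) Y Z).
Proof.
rewrite -[LHS]compm1 -(ascVK (W \ox X) Y Z) -!compA (tl2 (penta W X Y Z)) -!compA.
by rewrite (tl2 (fm2 (lwh W) (ascK _ _ _))) fid comp1m.
Qed.

Lemma ascV_ascV W X Y Z : ascV W X (lwh Y Z) \oc fm (lwh W) (asc X Y Z)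
  = asc (W \ox X) Y Z \oc (rwh (ascV W X Y) Z \oc ascV W (X \ox Y) Z).
Proof.
rewrite -[RHS]comp1m -(ascK W X) -compA; congr (_ \oc _).
rewrite (tl2 (penta W X Y Z)) -!compA (tl2 (rwh2 Z (ascVK W X Y))) rwh_id comp1m.
by rewrite ascVK compm1.
Qed.

Lemma dual_zig Z Y : fm (lwh Z) (dcap Z Y) \oc dcup Z (lwh Z Y) = idm _.
Proof.
have zz : runit Z \oc (fm (lwh Z) (ev Z) \oc (asc Z (dual Z) Z \oc rwh (coev Z) Z)) = lun Z.
  by rewrite !compA; exact: zigzag.
rewrite dcapE dcupE !fcomp -!compA (tl2 (ascV_asc Z (dual Z) Z Y)) -!compA.
rewrite -(tl22 (ascV_nat1 (coev Z) Z Y)) -(tl22 (asc_nat2 Z (ev Z) Y)) (tl2 (triang Z Y)).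
rewrite (tl2 (rwh2 Y erefl)) (tl2 (rwh2 Y erefl)) (tl2 (rwh2 Y erefl)) -!compA zz.
by rewrite -lun_asc -compA (tl2 (ascVK _ _ _)) comp1m lunVK.
Qed.

Lemma dual_zag Z Y : dcap Z (lwh (dual Z) Y) \oc fm (lwh (dual Z)) (dcup Z Y) = idm _.
Proof.
have zz : lun (dual Z) \oc (rwh (ev Z) (dual Z) \oc (ascV (dual Z) Z (dual Z)
    \oc fm (lwh (dual Z)) (coev Z))) = runit (dual Z).
  by rewrite !compA; exact: zagzig.
rewrite dcapE dcupE !fcomp -!compA (tl2 (ascV_ascV (dual Z) Z (dual Z) Y)) -!compA.
rewrite -(tl22 (asc_nat1 (ev Z) (dual Z) Y)) (tl2 (lun_asc (dual Z) Y)).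
rewrite -(tl22 (ascV_nat2 (dual Z) (coev Z) Y)).
rewrite (tl2 (rwh2 Y erefl)) (tl2 (rwh2 Y erefl)) (tl2 (rwh2 Y erefl)) -!compA zz.
by rewrite -triang -compA (tl2 (ascVK _ _ _)) comp1m -fcomp lunVK fid.
Qed.

(** A strand can be pulled across the evaluation: the hexagon merges the two crossings, naturality
    moves the result past [ev], and crossing the unit is trivial. *)
Lemma dcap_cross V Z Y :
  fm (lwh V) (dcap Z Y) \oc (bet (dual Z) V (lwh Z Y) \oc fm (lwh (dual Z)) (bet Z V Y))
  = dcap Z (lwh V Y).
Proof.
have H : fm (lwh V) (ascV (dual Z) Z Y) \oc (bet (dual Z) V (lwh Z Y)
    \oc fm (lwh (dual Z)) (bet Z V Y))
  = bet (dual Z \ox Z) V Y \oc ascV (dual Z) Z (lwh V Y).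
  rewrite -[LHS]compm1 -(ascVK (dual Z) Z (lwh V Y)) -!compA.
  rewrite (tl3 (esym (bet_hexV V (dual Z) Z Y))) -compA.
  by rewrite (tl2 (fm2 (lwh V) (ascK _ _ _))) fid comp1m.
rewrite !dcapE !fcomp -!compA H.
by rewrite -(tl22 (bet_nat1 (ev Z) V Y)) (tl2 (lun_betV V Y)).
Qed.

Lemma dcup_cross V Z Y :
  fm (lwh Z) (bet V (dual Z) Y) \oc (bet V Z (lwh (dual Z) Y) \oc fm (lwh V) (dcup Z Y))
  = dcup Z (lwh V Y).
Proof.
rewrite !dcupE !fcomp (tl3 (esym (bet_hex V Z (dual Z) Y))) -compA; congr (_ \oc _).
rewrite (tl22 (bet_nat2 V (coev Z) Y)); congr (_ \oc _).
rewrite -[LHS]comp1m -(lunK (lwh V Y)) -compA (tl2 (lun_bet V Y)).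
by rewrite -fcomp lunVK fid compm1.
Qed.

(** * Partial traces and transposed morphisms *)

Definition ptrace Z Y Y' (f : mor (lwh Z Y) (lwh Z Y')) : mor Y Y' :=
  dcap Z Y' \oc (fm (lwh (dual Z)) f \oc (bet Z (dual Z) Y \oc dcup Z Y)).

Lemma ptrace_lin Z Y Y' a (f g : mor (lwh Z Y) (lwh Z Y')) :
  ptrace (a *: f + g) = a *: ptrace f + ptrace g.
Proof. by rewrite /ptrace flin compDl compDr compZl compZr. Qed.

Lemma ptrace_natl Z X Y W (g : mor Y W) (f : mor (lwh Z X) (lwh Z Y)) :
  ptrace (fm (lwh Z) g \oc f) = g \oc ptrace f.
Proof. by rewrite /ptrace fcomp -!compA (tl22 (dcap_nat Z g)). Qed.

Lemma ptrace_natr Z X Y W (g : mor (lwh Z Y) (lwh Z W)) (f : mor X Y) :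
  ptrace (g \oc fm (lwh Z) f) = ptrace g \oc f.
Proof.
rewrite /ptrace fcomp -!compA dcup_nat.
by rewrite (tl22 (bet_nat3 Z (dual Z) f)).
Qed.

Lemma ptrace_bet Z Y : ptrace (bet Z Z Y) = idm _.
Proof.
rewrite /ptrace -dcap_cross -!compA (tl2 (fm2 (lwh (dual Z)) (bet_inv Z Z Y))).
by rewrite fid comp1m (tl2 (bet_inv _ _ _)) comp1m dual_zig.
Qed.

(** The zigzag identity writes [f] with all of it moved out of the trace by naturality, so that only
    the trace of a crossing remains. Traces are identified by checking these axioms, as in
    [ptrace_tens]. *)
Lemma ptrace_unique Z
    (t : forall Y Y', mor (lwh Z Y) (lwh Z Y') -> mor Y Y') :
  (forall X Y W (g : mor Y W) (f : mor (lwh Z X) (lwh Z Y)),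
     t _ _ (fm (lwh Z) g \oc f) = g \oc t _ _ f) ->
  (forall X Y W (g : mor (lwh Z Y) (lwh Z W)) (f : mor X Y),
     t _ _ (g \oc fm (lwh Z) f) = t _ _ g \oc f) ->
  (forall Y, t _ _ (bet Z Z Y) = idm _) ->
  forall Y Y' (f : mor (lwh Z Y) (lwh Z Y')), t _ _ f = ptrace f.
Proof.
move=> t_natl t_natr t_bet Y Y' f; rewrite /ptrace.
rewrite -[f in LHS]comp1m -dual_zig -compA dcup_nat t_natl t_natl; congr (_ \oc (_ \oc _)).
by rewrite -dcup_cross t_natl t_natr t_bet comp1m.
Qed.

Lemma ptrace_super V Z Y Y' (f : mor (lwh Z Y) (lwh Z Y')) :
  ptrace (bet V Z Y' \oc (fm (lwh V) f \oc bet Z V Y)) = fm (lwh V) (ptrace f).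
Proof.
rewrite /ptrace !fcomp -!compA -dcup_cross -dcap_cross -!compA.
rewrite (tl3 (esym (bet_braid V Z (dual Z) Y))) -!compA.
rewrite (tl2 (fm2 (lwh (dual Z)) (bet_inv V Z Y))) fid comp1m.
rewrite -(tl22 (bet_nat3 V (dual Z) f)).
rewrite (tl2 (fm2 (lwh (dual Z)) (bet_inv V Z Y'))) fid comp1m.
by rewrite (tl2 (bet_inv V (dual Z) _)) comp1m.
Qed.

Lemma bet_ascV X Z V W : bet (Z \ox V) X W \oc ascV Z V (lwh X W)
  = fm (lwh X) (ascV Z V W) \oc (bet Z X (lwh V W) \oc fm (lwh Z) (bet V X W)).
Proof.
rewrite -[LHS]comp1m -(fid (lwh X)) -(ascK Z V W) fcomp -compA; congr (_ \oc _).
by rewrite (tl2 (bet_hexV X Z V W)) -!compA ascVK compm1.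
Qed.

Lemma ptrace_tens Z V Y Y' (f : mor (lwh (Z \ox V) Y) (lwh (Z \ox V) Y')) :
  ptrace (ptrace (asc Z V Y' \oc (f \oc ascV Z V Y))) = ptrace f.
Proof.
pose t A B (g : mor (lwh (Z \ox V) A) (lwh (Z \ox V) B)) :=
  ptrace (ptrace (asc Z V B \oc (g \oc ascV Z V A))).
apply: (@ptrace_unique _ t) => {Y Y' f} [X Y W g f|X Y W g f|Y]; rewrite /t.
- by rewrite -compA (tl22 (asc_nat3 Z V g)) !ptrace_natl.
- by rewrite -compA ascV_nat3 2!compA !ptrace_natr -compA.
have E : fm (lwh (Z \ox V)) (asc Z V Y) \oc ascV Z V (lwh (Z \ox V) Y)
  = ascV Z V (lwh Z (lwh V Y)) \oc fm (lwh Z) (fm (lwh V) (asc Z V Y)) by exact: ascV_nat3.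
rewrite (tl2 (bet_hex (Z \ox V) Z V Y)) -!compA E (tl2 (bet_ascV _ _ _ _)) -!compA.
rewrite !ptrace_natl -fcomp ptrace_natr ptrace_bet comp1m.
rewrite (tl2 (bet_ascV _ _ _ _)) -!compA ptrace_natl.
rewrite 2!compA ptrace_natr -compA ptrace_super ptrace_bet fid comp1m.
exact: ascK.
Qed.

(** [bs] is tensoring with the transpose of [b], obtained by bending [b] with a cup and a cap. The
    clauses say that [b] slides over the cap and the cup as its transpose, and that the transpose is
    natural and commutes with crossings. *)
Lemma dual_mate Z Z' (b : mor Z' Z) : exists bs : forall Y, mor (lwh (dual Z) Y) (lwh (dual Z') Y),
  (forall Y, dcap Z Y \oc fm (lwh (dual Z)) (rwh b Y) = dcap Z' Y \oc bs (lwh Z' Y)) /\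
  (forall Y, bs (lwh Z Y) \oc (bet Z (dual Z) Y \oc dcup Z Y)
     = fm (lwh (dual Z')) (rwh b Y) \oc (bet Z' (dual Z') Y \oc dcup Z' Y)) /\
  (forall Y Y' (f : mor Y Y'), bs Y' \oc fm (lwh (dual Z)) f = fm (lwh (dual Z')) f \oc bs Y) /\
  (forall V Y, bs (lwh V Y) \oc bet V (dual Z) Y = bet V (dual Z') Y \oc fm (lwh V) (bs Y)).
Proof.
pose bs Y := dcap Z (lwh (dual Z') Y) \oc (fm (lwh (dual Z)) (rwh b (lwh (dual Z') Y))
  \oc fm (lwh (dual Z)) (dcup Z' Y)).
have bs_nat Y Y' (f : mor Y Y') : bs Y' \oc fm (lwh (dual Z)) f = fm (lwh (dual Z')) f \oc bs Y.
  rewrite /bs -!compA (fm22 (lwh (dual Z)) (dcup_nat Z' f)).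
  rewrite (tl22 (fm22 (lwh (dual Z)) (esym (lwh_rwh b _)))).
  by rewrite (tl22 (dcap_nat Z _)).
have bs_cap Y : dcap Z Y \oc fm (lwh (dual Z)) (rwh b Y) = dcap Z' Y \oc bs (lwh Z' Y).
  rewrite /bs -(tl22 (dcap_nat Z (dcap Z' Y))).
  rewrite (tl22 (fm22 (lwh (dual Z)) (lwh_rwh b (dcap Z' Y)))).
  by rewrite (fm2 (lwh (dual Z)) (dual_zig Z' Y)) fid compm1.
have bs_cup Y : fm (lwh Z) (bs Y) \oc dcup Z Y = rwh b _ \oc dcup Z' Y.
  rewrite /bs !fcomp -!compA -dcup_nat -(tl22 (dcup_nat Z (rwh b _))).
  by rewrite (tl2 (dual_zig Z _)) comp1m.
have bs_bet V Y : bs (lwh V Y) \oc bet V (dual Z) Y = bet V (dual Z') Y \oc fm (lwh V) (bs Y).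
  rewrite /bs -!compA -dcup_cross !fcomp -!compA.
  rewrite (tl22 (fm22 (lwh (dual Z)) (esym (lwh_rwh b _)))).
  rewrite (tl22 (dcap_nat Z _)) -(bet_nat3 V (dual Z)); congr (_ \oc _).
  rewrite -(tl22 (fm22 (lwh (dual Z)) (bet_nat2 V b _))).
  rewrite -(tl22 (bet_nat3 V (dual Z) (rwh b _))) -dcap_cross -!compA.
  rewrite (tl2 (fm2 (lwh (dual Z)) (bet_inv V Z _))) fid comp1m.
  by rewrite (tl2 (bet_inv V (dual Z) _)) comp1m.
exists bs; split=> //; split; last by split.
by move=> Y; rewrite (tl22 (bs_bet Z Y)) bs_cup -(tl22 (bet_nat1 b (dual Z') Y)).
Qed.

(** Cyclicity: [b] slides around the closed strand through its transpose. *)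
Lemma ptrace_dinat Z Z' (b : mor Z' Z) Y Y' (f : mor (lwh Z Y) (lwh Z' Y')) :
  ptrace (rwh b Y' \oc f) = ptrace (f \oc rwh b Y).
Proof.
have [bs [bs_cap [bs_cup [bs_nat _]]]] := dual_mate b.
rewrite /ptrace !fcomp -!compA (tl22 (bs_cap Y')) -bs_cup.
by rewrite (tl22 (bs_nat _ _ f)).
Qed.

(** Composed with the braiding, evaluation and coevaluation make the dual of [Z] a dual on the other
    side as well, so tensoring with it is both left and right adjoint to tensoring with [Z]. *)
Definition cap' Z Y := locked (dcap Z Y \oc bet Z (dual Z) Y).
Definition cup' Z Y := locked (bet Z (dual Z) Y \oc dcup Z Y).

Lemma cap'E Z Y : cap' Z Y = dcap Z Y \oc bet Z (dual Z) Y.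
Proof. by rewrite /cap' -lock. Qed.

Lemma cup'E Z Y : cup' Z Y = bet Z (dual Z) Y \oc dcup Z Y.
Proof. by rewrite /cup' -lock. Qed.

Lemma dual_zig' Z Y : cap' Z (lwh Z Y) \oc fm (lwh Z) (cup' Z Y) = idm _.
Proof.
rewrite cap'E cup'E -dcap_cross !fcomp -!compA.
rewrite (tl3 (bet_braid Z Z (dual Z) Y)) -!compA (tl2 (bet_inv _ _ _)) comp1m.
by rewrite dcup_cross dual_zig.
Qed.

Lemma dual_zag' Z Y : fm (lwh (dual Z)) (cap' Z Y) \oc cup' Z (lwh (dual Z) Y) = idm _.
Proof.
rewrite cap'E cup'E -dcup_cross !fcomp -!compA.
rewrite (tl3 (bet_braid Z (dual Z) (dual Z) Y)) -!compA.
rewrite (tl2 (bet_inv _ _ _)) comp1m -dual_zag -dcap_cross -!compA.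
by [].
Qed.

End Coherence.

(** * Exactness and additivity of the dimension *)

Section KernelsCokernels.
Variables (k : fieldType) (C : linCategory k).
Implicit Types X Y Z W : C.

Lemma cokernel_epi X Y Q (f : mor X Y) (q : mor Y Q) : isCokernel f q -> isEpi q.
Proof.
move=> [qf0 qU] W g h gh.
have gqf0 : g \oc q \oc f = 0 by rewrite -compA qf0 compm0.
have [u [_ u_uniq]] := qU W _ gqf0.
by rewrite -(u_uniq g erefl) -(u_uniq h (esym gh)).
Qed.

Lemma isCokernelP X Y Q (f : mor X Y) (q : mor Y Q) :
  isEpi q -> q \oc f = 0 ->
  (forall W (g : mor Y W), g \oc f = 0 -> exists h, h \oc q = g) -> isCokernel f q.
Proof.
move=> q_epi qf0 qU; split=> // W g /qU [h hq]; exists h; split=> // h' h'q.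
by apply: q_epi; rewrite hq.
Qed.

Lemma cokernel_fac X Y Q (f : mor X Y) (q : mor Y Q) W (g : mor Y W) :
  isCokernel f q -> g \oc f = 0 -> exists h, h \oc q = g.
Proof. by case=> _ qU /qU [h [hq _]]; exists h. Qed.

Lemma isKernelP X Y K (f : mor X Y) (i : mor K X) :
  isMono i -> f \oc i = 0 ->
  (forall W (g : mor W X), f \oc g = 0 -> exists h, i \oc h = g) -> isKernel f i.
Proof.
move=> i_mono fi0 iU; split=> // W g /iU [h ih]; exists h; split=> // h' ih'.
by apply: i_mono; rewrite ih.
Qed.

Lemma kernel_fac X Y K (f : mor X Y) (i : mor K X) W (g : mor W X) :
  isKernel f i -> f \oc g = 0 -> exists h, i \oc h = g.
Proof. by case=> _ iU /iU [h [ih _]]; exists h. Qed.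

Lemma epi_eq0 X Y Z (q : mor X Y) (g : mor Y Z) : isEpi q -> g \oc q = 0 -> g = 0.
Proof. by move=> q_epi gq; apply: q_epi; rewrite gq comp0m. Qed.

Lemma mono_eq0 X Y Z (i : mor Y Z) (g : mor X Y) : isMono i -> i \oc g = 0 -> g = 0.
Proof. by move=> i_mono ig; apply: i_mono; rewrite ig compm0. Qed.

Lemma epi_comp X Y Z (f : mor X Y) (g : mor Y Z) : isEpi f -> isEpi g -> isEpi (g \oc f).
Proof. by move=> f_epi g_epi W a b; rewrite !compA => /f_epi /g_epi. Qed.

Lemma mono_comp X Y Z (f : mor X Y) (g : mor Y Z) : isMono f -> isMono g -> isMono (g \oc f).
Proof. by move=> f_mono g_mono W a b; rewrite -!compA => /g_mono /f_mono. Qed.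

Lemma iso_epi X Y (f : mor X Y) (g : mor Y X) : f \oc g = idm _ -> isEpi f.
Proof. by move=> fg W a b ab; rewrite -(compm1 a) -(compm1 b) -fg !compA ab. Qed.

Lemma iso_mono X Y (f : mor X Y) (g : mor Y X) : g \oc f = idm _ -> isMono f.
Proof. by move=> gf W a b ab; rewrite -(comp1m a) -(comp1m b) -gf -!compA ab. Qed.

End KernelsCokernels.

Section Exactness.
Variables (k : fieldType) (C : tensorCategory k).
Implicit Types X Y Z W : C.

(** The two adjunctions between [lwh Z] and [lwh (dual Z)]. Being a left adjoint, [lwh Z] preserves
    epimorphisms and cokernels; being a right adjoint, monomorphisms and kernels. *)
Definition ladj Z Y W (g : mor (lwh Z Y) W) : mor Y (lwh (dual Z) W) :=
  fm (lwh (dual Z)) g \oc cup' Z Y.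

Definition ladjV Z Y W (h : mor Y (lwh (dual Z) W)) : mor (lwh Z Y) W :=
  cap' Z W \oc fm (lwh Z) h.

Definition radj Z Y W (g : mor W (lwh Z Y)) : mor (lwh (dual Z) W) Y :=
  dcap Z Y \oc fm (lwh (dual Z)) g.

Definition radjV Z Y W (h : mor (lwh (dual Z) W) Y) : mor W (lwh Z Y) :=
  fm (lwh Z) h \oc dcup Z W.

Lemma cup'_nat Z Y Y' (f : mor Y Y') :
  cup' Z Y' \oc f = fm (lwh (dual Z)) (fm (lwh Z) f) \oc cup' Z Y.
Proof. by rewrite !cup'E -compA dcup_nat (tl22 (bet_nat3 Z (dual Z) f)). Qed.

Lemma cap'_nat Z Y Y' (f : mor Y Y') :
  cap' Z Y' \oc fm (lwh Z) (fm (lwh (dual Z)) f) = f \oc cap' Z Y.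
Proof. by rewrite !cap'E -compA bet_nat3 (tl22 (dcap_nat Z f)). Qed.

Lemma ladjK Z Y W (g : mor (lwh Z Y) W) : ladjV (ladj g) = g.
Proof. by rewrite /ladj /ladjV fcomp compA cap'_nat -compA dual_zig' compm1. Qed.

Lemma ladjVK Z Y W (h : mor Y (lwh (dual Z) W)) : ladj (ladjV h) = h.
Proof. by rewrite /ladj /ladjV fcomp -compA -cup'_nat compA dual_zag' comp1m. Qed.

Lemma radjK Z Y W (g : mor W (lwh Z Y)) : radjV (radj g) = g.
Proof. by rewrite /radj /radjV fcomp -compA -dcup_nat compA dual_zig comp1m. Qed.

Lemma radjVK Z Y W (h : mor (lwh (dual Z) W) Y) : radj (radjV h) = h.
Proof. by rewrite /radj /radjV fcomp compA dcap_nat -compA dual_zag compm1. Qed.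

Lemma ladj_comp Z Y Y' W (g : mor (lwh Z Y) W) (f : mor Y' Y) :
  ladj (g \oc fm (lwh Z) f) = ladj g \oc f.
Proof. by rewrite /ladj fcomp -!compA cup'_nat. Qed.

Lemma radj_comp Z Y Y' W (g : mor W (lwh Z Y)) (f : mor Y Y') :
  radj (fm (lwh Z) f \oc g) = f \oc radj g.
Proof. by rewrite /radj fcomp compA dcap_nat compA. Qed.

Lemma ladj0 Z Y W : ladj (0 : mor (lwh Z Y) W) = 0.
Proof. by rewrite /ladj f0 comp0m. Qed.

Lemma radj0 Z Y W : radj (0 : mor W (lwh Z Y)) = 0.
Proof. by rewrite /radj f0 compm0. Qed.

Lemma ladj_inj Z Y W : injective (@ladj Z Y W).
Proof. exact: can_inj (@ladjK Z Y W). Qed.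

Lemma radj_inj Z Y W : injective (@radj Z Y W).
Proof. exact: can_inj (@radjK Z Y W). Qed.

Lemma lwh_epi Z Y Y' (f : mor Y Y') : isEpi f -> isEpi (fm (lwh Z) f).
Proof.
by move=> f_epi W g h /(congr1 (@ladj _ _ _)); rewrite !ladj_comp => /f_epi /ladj_inj.
Qed.

Lemma lwh_mono Z Y Y' (f : mor Y Y') : isMono f -> isMono (fm (lwh Z) f).
Proof.
by move=> f_mono W g h /(congr1 (@radj _ _ _)); rewrite !radj_comp => /f_mono /radj_inj.
Qed.

Lemma lwh_cokernel Z X Y Q (f : mor X Y) (q : mor Y Q) :
  isCokernel f q -> isCokernel (fm (lwh Z) f) (fm (lwh Z) q).
Proof.
move=> fq; apply: isCokernelP; first exact/lwh_epi/(cokernel_epi fq).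
  by rewrite -fcomp fq.1 f0.
move=> W g gf; have [h hq] : exists h, h \oc q = ladj g.
  by apply: cokernel_fac fq _; rewrite -ladj_comp gf ladj0.
by exists (ladjV h); apply: ladj_inj; rewrite ladj_comp ladjVK.
Qed.

Lemma lwh_kernel Z X Y K (f : mor X Y) (i : mor K X) :
  isKernel f i -> isKernel (fm (lwh Z) f) (fm (lwh Z) i).
Proof.
move=> fi; apply: isKernelP; first exact/lwh_mono/(kernel_monic fi).
  by rewrite -fcomp fi.1 f0.
move=> W g fg; have [h ih] : exists h, i \oc h = radj g.
  by apply: kernel_fac fi _; rewrite -radj_comp fg radj0.
by exists (radjV h); apply: radj_inj; rewrite radj_comp radjVK.
Qed.

(** Conjugation by the braiding transfers exactness from one tensor argument to the other. *)
Lemma rwhE Z Z' (b : mor Z Z') Y :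
  rwh b Y = braid Y Z' \oc (fm (lwh Y) b \oc braid Z Y).
Proof.
have -> : fm (lwh Y) b \oc braid Z Y = braid Z' Y \oc rwh b Y by rewrite /rwh braid_nat.
by rewrite compA braid_sym comp1m.
Qed.

Lemma lwhE Z Z' (b : mor Z Z') Y :
  fm (lwh Y) b = braid Z' Y \oc (rwh b Y \oc braid Y Z).
Proof.
have -> : rwh b Y \oc braid Y Z = braid Y Z' \oc fm (lwh Y) b by rewrite /rwh braid_nat.
by rewrite compA braid_sym comp1m.
Qed.

Lemma rwh_cokernel X Y Q (f : mor X Y) (q : mor Y Q) V :
  isCokernel f q -> isCokernel (rwh f V) (rwh q V).
Proof.
move=> /(lwh_cokernel V) fq; apply: isCokernelP.
- rewrite rwhE compA; apply: epi_comp; first exact: iso_epi (braid_sym _ _).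
  by apply: epi_comp; [exact: cokernel_epi fq | exact: iso_epi (braid_sym _ _)].
- rewrite !rwhE -!compA (tl2 (braid_sym _ _)) comp1m (tl2 fq.1).
  by rewrite comp0m compm0.
move=> W g gf; have [h hq] : exists h, h \oc fm (lwh V) q = g \oc braid V Y.
  by apply: cokernel_fac fq _; rewrite lwhE -!compA (tl2 (braid_sym _ _)) comp1m (tl2 gf) comp0m.
exists (h \oc braid Q V); rewrite rwhE -!compA (tl2 (braid_sym _ _)) comp1m.
by rewrite compA hq -compA braid_sym compm1.
Qed.

Lemma rwh_kernel X Y K (f : mor X Y) (i : mor K X) V :
  isKernel f i -> isKernel (rwh f V) (rwh i V).
Proof.
move=> /(lwh_kernel V) fi; apply: isKernelP.
- rewrite rwhE; apply: mono_comp; last exact: iso_mono (braid_sym _ _).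
  by apply: mono_comp; [exact: iso_mono (braid_sym _ _) | exact: kernel_monic fi].
- rewrite !rwhE -!compA (tl2 (braid_sym _ _)) comp1m (tl2 fi.1).
  by rewrite comp0m compm0.
move=> W g fg; have [h ih] : exists h, fm (lwh V) i \oc h = braid X V \oc g.
  apply: kernel_fac fi _; rewrite lwhE -!compA (tl2 (braid_sym _ _)) comp1m.
  by rewrite fg compm0.
exists (braid V K \oc h); rewrite rwhE -!compA (tl2 (braid_sym _ _)) comp1m ih.
by rewrite (tl2 (braid_sym _ _)) comp1m.
Qed.

Lemma rwh_epi Z Z' (b : mor Z Z') Y : isEpi b -> isEpi (rwh b Y).
Proof.
move=> b_epi; rewrite rwhE compA; apply: epi_comp; first exact: iso_epi (braid_sym _ _).
by apply: epi_comp; [exact: lwh_epi | exact: iso_epi (braid_sym _ _)].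
Qed.

Lemma rwh_mono Z Z' (b : mor Z Z') Y : isMono b -> isMono (rwh b Y).
Proof.
move=> b_mono; rewrite rwhE; apply: mono_comp; last exact: iso_mono (braid_sym _ _).
by apply: mono_comp; [exact: iso_mono (braid_sym _ _) | exact: lwh_mono].
Qed.

(** * The dimension of an object and its additivity *)

Lemma dim_exists Z : exists d : k, forall Y, ptrace (idm (lwh Z Y)) = d *: idm Y.
Proof.
have [g _ gK] := end_unit C.
exists (g (ev Z \oc (braid Z (dual Z) \oc coev Z))) => Y.
rewrite /ptrace fid comp1m dcapE dcupE betE -!compA (tl2 (ascK _ _ _)) comp1m (tl2 (ascK _ _ _)) comp1m.
rewrite (tl2 (rwh2 Y erefl)) (tl2 (rwh2 Y erefl)) -compA.
by rewrite -[X in rwh X Y]gK rwhZ rwh_id compZl compZr comp1m lunVK.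
Qed.

Definition dimo Z : k := projT1 (cid (dim_exists Z)).

Lemma dimo_ptrace Z Y : ptrace (idm (lwh Z Y)) = dimo Z *: idm Y.
Proof. by rewrite /dimo; case: (cid (dim_exists Z)) => d dP; apply: dP. Qed.

Lemma tunit_nonzero : ~ isZero (tunit : C).
Proof.
move=> [/(_ _ (idm _)) id0 _]; have [g gK _] := end_unit C.
have e : 1 *: idm (tunit : C) = 0 *: idm tunit by rewrite id0 !scaler0.
by have /eqP := congr1 g e; rewrite (gK 1) (gK 0) oner_eq0.
Qed.

Lemma scalar_inj (a b : k) : a *: idm (tunit : C) = b *: idm tunit -> a = b.
Proof. by have [g gK _] := end_unit C; apply: (can_inj gK). Qed.

(** Under the adjunction, composing with a transpose becomes precomposing with the original map
    tensored with [W], so the universal property of a cokernel turns into that of a kernel. *)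
Lemma mate_kernel L Z S (i : mor L Z) (q : mor Z S)
    (bi : forall Y, mor (lwh (dual Z) Y) (lwh (dual L) Y))
    (bq : forall Y, mor (lwh (dual S) Y) (lwh (dual Z) Y)) Y :
  isCokernel i q ->
  cap' L Y \oc fm (lwh L) (bi Y) = cap' Z Y \oc rwh i _ ->
  cap' Z Y \oc fm (lwh Z) (bq Y) = cap' S Y \oc rwh q _ ->
  isKernel (bi Y) (bq Y).
Proof.
move=> iq Hi Hq.
have Bi W (f : mor W (lwh (dual Z) Y)) : ladjV (bi Y \oc f) = ladjV f \oc rwh i W.
  by rewrite /ladjV fcomp compA Hi -!compA lwh_rwh.
have Bq W (f : mor W (lwh (dual S) Y)) : ladjV (bq Y \oc f) = ladjV f \oc rwh q W.
  by rewrite /ladjV fcomp compA Hq -!compA lwh_rwh.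
have V0 A W : ladjV (0 : mor W (lwh (dual A) Y)) = 0 by rewrite /ladjV f0 compm0.
have V_inj A W : injective (@ladjV A W Y) by apply: can_inj (@ladjVK A W Y).
apply: isKernelP.
- move=> W g h /(congr1 (@ladjV _ _ _)); rewrite !Bq => /(rwh_epi (cokernel_epi iq)).
  exact: V_inj.
- by apply: V_inj; rewrite V0 Bi -[bq Y]compm1 Bq -compA -rwh_comp iq.1 rwh0 compm0.
move=> W g; move=> /(congr1 (@ladjV _ _ _)); rewrite Bi V0 => gi.
have [h hq] := cokernel_fac (rwh_cokernel W iq) gi.
by exists (ladj h); apply: V_inj; rewrite Bq ladjK.
Qed.

(* The coevaluation of Z factors through the kernel K of Z* Z -> L* S, which is
   spanned by Z* L and S* Z; on each of the two the evaluation of Z is the sum of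
   those of L and S. *)
Theorem dimo_exact L Z S (i : mor L Z) (q : mor Z S) :
  shortExact i q -> dimo Z = dimo L + dimo S.
Proof.
move=> [qi iq]; have q_epi := cokernel_epi iq; have i_mono := kernel_monic qi.
have [bi [bi_cap [bi_cup [bi_nat bi_bet]]]] := dual_mate i.
have [bq [bq_cap [bq_cup [bq_nat bq_bet]]]] := dual_mate q.
have bi_bq Y : isKernel (bi Y) (bq Y).
  apply: mate_kernel iq _ _; rewrite !cap'E -!compA.
    by rewrite -bi_bet (tl22 (esym (bi_cap Y))) -bet_nat1.
  by rewrite -bq_bet (tl22 (esym (bq_cap Y))) -bet_nat1.
pose Y := tunit : C.
have wi V : isKernel (fm (lwh V) (rwh q Y)) (fm (lwh V) (rwh i Y)).
  exact/lwh_kernel/rwh_kernel.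
have wq_epi V : isEpi (fm (lwh V) (rwh q Y)) by apply/lwh_epi/rwh_epi.
pose dcoev V := bet V (dual V) Y \oc dcup V Y.
pose phi := fm (lwh (dual L)) (rwh q Y) \oc bi (lwh Z Y).
have [K [kap kapP]] : exists K (kap : mor K (lwh (dual Z) (lwh Z Y))), isKernel phi kap.
  by exists (kerob phi), (kerm phi); apply: kermP.
have kap_mono := kernel_monic kapP.
have qi0 V : fm (lwh V) (rwh q Y) \oc fm (lwh V) (rwh i Y) = 0 := (wi V).1.
have [c0 c0P] : exists c0, kap \oc c0 = dcoev Z.
  apply: kernel_fac kapP _.
  by rewrite /phi /dcoev -compA bi_cup (tl2 (qi0 _)) comp0m.
have [a aP] : exists a, fm (lwh (dual L)) (rwh i Y) \oc a = bi _ \oc kap.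
  by apply: kernel_fac (wi _) _; rewrite compA; apply: kapP.1.
have [b bP] : exists b, bq _ \oc b = fm (lwh (dual Z)) (rwh q Y) \oc kap.
  apply: kernel_fac (bi_bq _) _.
  by rewrite (tl22 (bi_nat _ _ (rwh q Y))) compA; apply: kapP.1.
have ac0 : a \oc c0 = dcoev L.
  by apply: (kernel_monic (wi _)); rewrite compA aP -compA c0P bi_cup.
have bc0 : b \oc c0 = dcoev S.
  by apply: (kernel_monic (bi_bq _)); rewrite compA bP -compA c0P -bq_cup.
pose u := dcap Z Y \oc kap - dcap L Y \oc a - dcap S Y \oc b.
have [j1 j1P] : exists j1, kap \oc j1 = fm (lwh (dual Z)) (rwh i Y).
  apply: kernel_fac kapP _.
  by rewrite /phi -compA bi_nat (tl2 (qi0 _)) comp0m.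
have [j2 j2P] : exists j2, kap \oc j2 = bq (lwh Z Y).
  by apply: kernel_fac kapP _; rewrite /phi -compA (bi_bq _).1 compm0.
have aj1 : a \oc j1 = bi _.
  by apply: (kernel_monic (wi _)); rewrite compA aP -compA j1P bi_nat.
have bj1 : b \oc j1 = 0.
  by apply: (kernel_monic (bi_bq _)); rewrite compA bP -compA j1P qi0 compm0.
have aj2 : a \oc j2 = 0.
  by apply: (kernel_monic (wi _)); rewrite compA aP -compA j2P (bi_bq _).1 compm0.
have bj2 : b \oc j2 = fm (lwh (dual S)) (rwh q Y).
  by apply: (kernel_monic (bi_bq _)); rewrite compA bP -compA j2P bq_nat.
have b_epi : isEpi b.
  move=> W g h /(congr1 (fun f => f \oc j2)); rewrite -!compA bj2; exact: wq_epi.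
(* The epimorphism [b] is a cokernel of some [g], and [g] factors through [j1]. Hence [u], which
   vanishes on [j1], factors through [b]. *)
have [A [g [bg bU]]] := epic_normal b_epi.
have [t tP] : exists t, j1 \oc t = g.
  have [t tP] : exists t, fm (lwh (dual Z)) (rwh i Y) \oc t = kap \oc g.
    by apply: kernel_fac (wi _) _; rewrite compA -bP -compA bg compm0.
  by exists t; apply: kap_mono; rewrite compA j1P.
have uj1 : u \oc j1 = 0.
  rewrite /u !compDl !compNl -!compA j1P aj1 bj1 compm0 oppr0 addr0.
  by rewrite bi_cap subrr.
have [u' [u'P _]] : exists! u', u' \oc b = u by apply: bU; rewrite -tP compA uj1 comp0m.
(* [u] also vanishes on [j2], and [b \oc j2] is still an epimorphism. *)
have u'0 : u' = 0.
  apply: (epi_eq0 (wq_epi (dual S))); rewrite -bj2 compA u'P /u.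
  by rewrite !compDl !compNl -!compA j2P aj2 bj2 compm0 oppr0 addr0 bq_cap subrr.
have dE V : dcap V Y \oc dcoev V = dimo V *: idm Y.
  by rewrite -dimo_ptrace /ptrace fid comp1m.
have : u \oc c0 = 0 by rewrite -u'P u'0 !comp0m.
rewrite /u !compDl !compNl -!compA c0P ac0 bc0 !dE -addrA -opprD -scalerDl => /eqP.
by rewrite subr_eq0 => /eqP /scalar_inj.
Qed.

Lemma ptrace0 Z Y Y' : ptrace (0 : mor (lwh Z Y) (lwh Z Y')) = 0.
Proof. by rewrite /ptrace f0 comp0m compm0. Qed.

Lemma ptraceD Z Y Y' (f g : mor (lwh Z Y) (lwh Z Y')) :
  ptrace (f + g) = ptrace f + ptrace g.
Proof. by have := ptrace_lin 1 f g; rewrite !scale1r. Qed.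

Lemma ptraceZ Z Y Y' a (f : mor (lwh Z Y) (lwh Z Y')) : ptrace (a *: f) = a *: ptrace f.
Proof. by have := ptrace_lin a f 0; rewrite ptrace0 !addr0. Qed.

Lemma ptraceN Z Y Y' (f : mor (lwh Z Y) (lwh Z Y')) : ptrace (- f) = - ptrace f.
Proof. by rewrite -!scaleN1r ptraceZ. Qed.

Lemma dimo_tens Z V : dimo (Z \ox V) = dimo Z * dimo V.
Proof.
apply: scalar_inj; rewrite -dimo_ptrace -ptrace_tens comp1m ascVK dimo_ptrace.
by rewrite ptraceZ dimo_ptrace scalerA.
Qed.

(** The four-term sequence from kernel to cokernel is cut at the coimage into two short exact
    sequences. *)
Lemma dimo_ker_coker Y Z (f : mor Y Z) :
  dimo (kerob f) + dimo Z = dimo (cokerob f) + dimo Y.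
Proof.
have iK := kermP f; have qQ := cokermP f.
have qI := cokermP (kerm f).
have [j jP] := cokernel_fac qI iK.1.
have q_epi := cokernel_epi qI.
(* If [j] kills [t], the epimorphism from [Y] to the cokernel of [t] is a cokernel of some [h] with
   [f \oc h = 0]. Then [h] factors through the kernel of [f], which gives [cokerm t] a left inverse
   and forces [t = 0]. *)
have j_mono : isMono j.
  suff j0 W (t : mor W _) : j \oc t = 0 -> t = 0.
    move=> W g h gh; apply/eqP; rewrite -subr_eq0; apply/eqP/j0.
    by rewrite compDr compNr gh subrr.
  move=> jt; have cP := cokermP t; have c_epi := cokernel_epi cP.
  have [j' j'P] := cokernel_fac cP jt.
  have [A [h hP]] := epic_normal (epi_comp q_epi c_epi).
  have fh : f \oc h = 0 by rewrite -jP -j'P -!compA (compA (cokerm t)) hP.1 compm0.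
  have [s sP] := kernel_fac iK fh.
  have qh : cokerm (kerm f) \oc h = 0 by rewrite -sP compA qI.1 comp0m.
  have [v vP] := cokernel_fac hP qh.
  have vc : v \oc cokerm t = idm _ by apply: q_epi; rewrite -compA vP comp1m.
  by rewrite -(comp1m t) -vc -compA cP.1 compm0.
have s1 : shortExact (kerm f) (cokerm (kerm f)).
  split=> //; apply: isKernelP; [exact: kernel_monic iK | exact: qI.1 |].
  move=> W g qg; apply: kernel_fac iK _.
  by rewrite -jP -compA qg compm0.
have s2 : shortExact j (cokerm f).
  have cj : isCokernel j (cokerm f).
    apply: isCokernelP; first exact: cokernel_epi qQ.
      by apply: (epi_eq0 q_epi); rewrite -compA jP qQ.1.
    by move=> W g gj; apply: cokernel_fac qQ _; rewrite -jP compA gj comp0m.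
  split=> //; apply: isKernelP => //; first exact: cj.1.
  have [A [g gP]] := monic_normal j_mono.
  move=> W h ch; apply: (kernel_fac gP).
  have [v vP] := cokernel_fac cj gP.1.
  by rewrite -vP -compA ch compm0.
by rewrite (dimo_exact s1) (dimo_exact s2); ring.
Qed.

End Exactness.

(** * Symmetric powers by iterated cokernels *)

Section Tower.
Variables (k : fieldType) (C : linCategory k) (T : quadData C).
Variables (zo : C) (zoP : isZero zo).
(* [V n] is the n-th iterate of [T] on [V 0], up to the given isomorphisms. *)
Variables (V : nat -> C) (up : forall n, mor (T (V n)) (V n.+1)).
Variable upV : forall n, mor (V n.+1) (T (V n)).
Hypothesis upK : forall n, upV n \oc up n = idm _.
Hypothesis upVK : forall n, up n \oc upV n = idm _.
Hypothesis cokernel_ex :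
  forall X Y (f : mor X Y), exists (Q : C) (q : mor Y Q), isCokernel f q.
(** A right adjoint of [T], kept abstract so that one adjoint of X (x) - can be used in the category
    and the other one in its opposite. *)
Variables (R : C -> C) (adj : forall Y W, mor (T Y) W -> mor Y (R W)).
Hypothesis adj_comp : forall Y Y' W (g : mor (T Y) W) (f : mor Y' Y),
  adj (g \oc fm T f) = adj g \oc f.
Hypothesis adj_bij : forall Y W, bijective (@adj Y W).
Hypothesis qrel_epi : forall X Y (f : mor X Y), isEpi f -> isEpi (fm (qrel T) f).

Lemma adj_inj Y W : injective (@adj Y W).
Proof. exact: bij_inj (adj_bij Y W). Qed.

Lemma Tepi X Y (f : mor X Y) : isEpi f -> isEpi (fm T f).
Proof.
by move=> f_epi W g h /(congr1 (@adj _ _)); rewrite !adj_comp => /f_epi /adj_inj.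
Qed.

(** The next symmetric power is the cokernel of a map built from the previous multiplication, so the
    recursion has to carry that multiplication together with its two ends. *)
Record stage := Stage { sgA : C; sgB : C; sgm : mor (T sgA) sgB }.

Definition stage_rel s := fm T (sgm s) \oc qk T (sgA s).

Definition stage_next s : stage :=
  let e := cid (cokernel_ex (stage_rel s)) in
  @Stage (sgB s) (projT1 e) (projT1 (cid (projT2 e))).

Lemma stage_nextP s : isCokernel (stage_rel s) (sgm (stage_next s)).
Proof. by rewrite /stage_next /=; case: cid => Q q0 /=; case: cid. Qed.

(** The zero object in degree -1 makes the first relation zero, so that degree 1 is [T (V 0)], up to
    isomorphism. *)
Fixpoint stg n : stage :=
  if n is m.+1 then stage_next (stg m) else Stage (0 : mor (T zo) (V 0)).

Definition tow_ob n : C := if n is m.+2 then sgA (stg m) else zo.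

Definition tow_mu n : mor (T (tow_ob n)) (tow_ob n.+1) :=
  match n with 0 => 0 | 1 => 0 | m.+2 => sgm (stg m) end.

Lemma tow_zero n : (n < 3)%N -> isZero (tow_ob n).
Proof. by case: n => [|[|[|]]]. Qed.

Lemma tow_rel n : tow_mu n.+1 \oc (fm T (tow_mu n) \oc qk T (tow_ob n)) = 0.
Proof.
by case: n => [|[|n]] /=; rewrite ?comp0m //; apply: (stage_nextP _).1.
Qed.

Lemma tow_fac n W (g : mor (T (tow_ob n.+1)) W) :
  g \oc (fm T (tow_mu n) \oc qk T (tow_ob n)) = 0 -> exists h, h \oc tow_mu n.+1 = g.
Proof.
case: n g => [|[|n]] g /= g0; last exact: cokernel_fac (stage_nextP _) g0.
  by exists 0; rewrite comp0m; apply/esym/(fob_zero T zoP).1.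
by exists 0; rewrite comp0m; apply/esym/(fob_zero T zoP).1.
Qed.

Lemma tow_epi n : isEpi (tow_mu n.+3).
Proof. exact: cokernel_epi (stage_nextP _). Qed.

Definition tower : symTower T := SymTower tow_zero tow_rel tow_fac tow_epi
  (fun n => Tepi (@tow_epi n)).

(* [annih g]: the map [g] kills every copy of the quadratic relations in [V n];
   those not touching the first factor are reached through the adjunction. *)
Fixpoint annih n : forall W, mor (V n) W -> Prop :=
  match n return forall W, mor (V n) W -> Prop with
  | 0 => fun _ _ => True
  | n'.+1 => fun W g =>
      match n' return mor (V n'.+1) W -> Prop with
      | 0 => fun _ => True
      | m.+1 => fun g => g \oc (up m.+1 \oc (fm T (up m) \oc qk T (V m))) = 0
      end g /\ @annih n' (R W) (adj (g \oc up n'))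
  end.

Fixpoint towq n : mor (V n) (tower n.+3) :=
  match n return mor (V n) (tower n.+3) with
  | 0 => idm _
  | m.+1 => mu tower m.+3 \oc (fm T (towq m) \oc upV m)
  end.

Lemma towqS n : towq n.+1 \oc up n = mu tower n.+3 \oc fm T (towq n).
Proof. by rewrite /= -!compA upK compm1. Qed.

Lemma towq_epi n : isEpi (towq n).
Proof.
elim: n => [|n IHn] /=; first exact: iso_epi (comp1m _).
apply: epi_comp; last exact: tow_epi.
by apply: epi_comp; [exact: iso_epi (upK n) | exact: Tepi].
Qed.

(** By induction the adjoint condition makes [g] factor through T applied to the previous power. The
    relation on the first two factors is then tested after cancelling the epimorphism [qrel T] of
    [towq], where it is the hypothesis of [mu_fac]. *)
Lemma annihP n W (g : mor (V n) W) : annih g <-> exists h, h \oc towq n = g.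
Proof.
elim: n W g => [|n IHn] W g; first by split=> // _; exists g; rewrite compm1.
have adjP : annih (adj (g \oc up n)) <-> exists h, h \oc fm T (towq n) = g \oc up n.
  rewrite IHn; split=> [[h hq]|[h <-]]; last by exists (adj h); rewrite adj_comp.
  have [adV _ adVK] := adj_bij (tower n.+3) W.
  by exists (adV h); apply: adj_inj; rewrite adj_comp adVK.
have g_up h : h \oc towq n.+1 = g <-> h \oc (mu tower n.+3 \oc fm T (towq n)) = g \oc up n.
  rewrite -towqS compA; split=> [->//|]; exact: iso_epi (upVK n) _ _ _.
split=> [[gk /adjP[h hq]]|[h /g_up hq]].
  suff [h' h'P] : exists h', h' \oc mu tower n.+3 = h.
    by exists h'; apply/g_up; rewrite compA h'P.
  apply: (mu_fac (s := tower)).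
  case: n IHn g gk adjP g_up h hq => [|n] _ g gk _ _ h hq.
    by rewrite (zero_Tdom (mu tower 2) 0) // f0 comp0m compm0.
  apply: (epi_eq0 (qrel_epi (@towq_epi n))).
  rewrite -!compA -qk_nat (tl2 (fm2 T (esym (towqS n)))) fcomp -compA (tl2 hq) -compA.
  exact: gk.
split; last by apply/adjP; exists (h \oc mu tower n.+3); rewrite -compA.
case: n IHn g adjP g_up h hq => [//|n] _ g _ _ h hq.
have rel := mu_rel tower n.+3.
rewrite (compA g) -hq -!compA (tl2 (fm2 T (towqS n))) fcomp -!compA qk_nat.
by rewrite (tl3 rel) comp0m compm0.
Qed.

(** Vanishing depends only on the maps out of the tensor power that kill the relations. This makes
    the tower comparable with [symPow] and [extPow] without constructing an isomorphism. *)
Lemma tower_zeroP n : isZero (tower n.+3) <-> forall W (g : mor (V n) W), annih g -> g = 0.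
Proof.
split=> [[z _] W g /annihP[h <-]|z]; first by rewrite (z _ h) comp0m.
apply: isZero_id; apply: (epi_eq0 (@towq_epi n)); rewrite comp1m.
by apply: z; apply/annihP; exists (idm _); rewrite comp1m.
Qed.

End Tower.

(** * Symmetric and exterior powers of an object *)

Section Opposite.
Variables (k : fieldType) (C : linCategory k).

Definition opCat : linCategory k := @LinCategory k C
  (fun X Y => @mor k C Y X) (fun X => @idm k C X) (fun X Y Z g f => @mcomp k C Z Y X f g)
  (fun X Y Z W h g f => esym (compA f g h))
  (fun X Y f => compm1 f) (fun X Y f => comp1m f)
  (fun X Y Z f a g h => @comp_linr k C Z Y X f a g h)
  (fun X Y Z g a f h => @comp_linl k C Z Y X g a f h).

Definition opFun (F : linFunctor C) : linFunctor opCat := @LinFunctor k opCat F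
  (fun X Y f => @fm k C F Y X f) (fun X => fid F X)
  (fun X Y Z g f => @fcomp k C F Z Y X f g)
  (fun X Y a f g => @flin k C F Y X a f g).

End Opposite.

Section Instances.
Variables (k : fieldType) (C : tensorCategory k) (X : C).
Implicit Types A P W Y Z : C.

Let i : mor (sob (alt2 X)) (X \ox X) := sinc (alt2 X).
Let q : mor (X \ox X) (quot (alt2 X)) := cokerm i.
Let c : mor (X \ox X) (X \ox X) := braid X X.

Lemma alt2_coker : isCokernel i q. Proof. exact: cokermP. Qed.

Lemma alt2_ker : isKernel q i.
Proof.
have iK : isKernel (cokerm (idm (X \ox X) - c)) i := kermP _.
apply: isKernelP; [exact: kernel_monic iK | exact: alt2_coker.1 |].
move=> W g qg; have [v vP] := cokernel_fac alt2_coker iK.1.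
by apply: kernel_fac iK _; rewrite -vP -compA qg compm0.
Qed.

Lemma alt2_im : exists r, idm (X \ox X) - c = i \oc r.
Proof.
have iK : isKernel (cokerm (idm (X \ox X) - c)) i := kermP _.
by have [r rP] := kernel_fac iK (cokermP _).1; exists r.
Qed.

(** As c is an involution, 1 + c kills 1 - c, hence factors through its cokernel and kills its
    image. This is valid in every characteristic. *)
Lemma alt2_anti : c \oc i = - i.
Proof.
have iK : isKernel (cokerm (idm (X \ox X) - c)) i := kermP _.
have : (idm _ + c) \oc (idm _ - c) = 0.
  by rewrite compDl !compDr !compNr comp1m !compm1 comp1m /c braid_sym addrA subrK subrr.
move=> /(cokernel_fac (cokermP _)) [d dP].
apply/eqP; rewrite -addr_eq0 addrC -{1}(comp1m i) -compDl -dP -compA iK.1.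
by rewrite compm0.
Qed.

Lemma sym2_sw : q \oc c = q.
Proof.
have [r rP] := alt2_im.
have : q \oc (idm _ - c) = 0 by rewrite rP compA alt2_coker.1 comp0m.
by rewrite compDr compNr compm1 => /eqP; rewrite subr_eq0 => /eqP.
Qed.

Lemma sym2_norm : exists d, idm (X \ox X) + c = d \oc q.
Proof.
have [d dP] : exists d, d \oc q = idm (X \ox X) + c.
  by apply: cokernel_fac alt2_coker _; rewrite compDl comp1m alt2_anti subrr.
by exists d.
Qed.

Definition altk Y : mor (lwh (sob (alt2 X)) Y) (lwh X (lwh X Y)) :=
  locked (asc X X Y \oc rwh i Y).

Definition symq Y : mor (lwh X (lwh X Y)) (lwh (quot (alt2 X)) Y) :=
  locked (rwh q Y \oc ascV X X Y).

Lemma altkE Y : altk Y = asc X X Y \oc rwh i Y. Proof. by rewrite /altk -lock. Qed.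
Lemma symqE Y : symq Y = rwh q Y \oc ascV X X Y. Proof. by rewrite /symq -lock. Qed.

Lemma altk_nat Y Y' (f : mor Y Y') :
  fm (lwh X) (fm (lwh X) f) \oc altk Y = altk Y' \oc fm (lwh (sob (alt2 X))) f.
Proof. by rewrite !altkE compA -asc_nat3 -!compA lwh_rwh. Qed.

Lemma symq_nat Y Y' (f : mor Y Y') :
  symq Y' \oc fm (lwh X) (fm (lwh X) f) = fm (lwh (quot (alt2 X))) f \oc symq Y.
Proof. by rewrite !symqE compA lwh_rwh -!compA ascV_nat3. Qed.

Lemma bet_altk Y : bet X X Y \oc altk Y = - altk Y.
Proof.
by rewrite altkE compA bet_asc -compA (rwh2 Y alt2_anti) rwhN compNr.
Qed.

Lemma symq_bet Y : symq Y \oc bet X X Y = symq Y.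
Proof.
by rewrite symqE betE -compA (tl2 (ascK _ _ _)) comp1m compA (rwh2 Y sym2_sw).
Qed.

Lemma bet_rwh Y : bet X X Y = asc X X Y \oc (rwh c Y \oc ascV X X Y).
Proof. exact: betE. Qed.

Lemma altk_im Y : exists r, idm _ - bet X X Y = altk Y \oc r.
Proof.
have [r rP] := alt2_im; exists (rwh r Y \oc ascV X X Y).
rewrite altkE -compA (tl2 (rwh2 Y (esym rP))) rwhD rwhN rwh_id.
by rewrite compDl comp1m compNl compDr compNr ascVK -bet_rwh.
Qed.

Lemma symq_norm Y : exists r, idm _ + bet X X Y = r \oc symq Y.
Proof.
have [d dP] := sym2_norm; exists (asc X X Y \oc rwh d Y).
rewrite symqE -compA (tl2 (rwh2 Y (esym dP))) rwhD rwh_id.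
by rewrite compDl comp1m compDr ascVK -bet_rwh.
Qed.

Lemma bet_altk_pass P Y :
  bet X P (lwh X Y) \oc (fm (lwh X) (bet X P Y) \oc altk (lwh P Y))
  = fm (lwh P) (altk Y) \oc bet (sob (alt2 X)) P Y.
Proof.
rewrite !altkE (tl3 (esym (bet_hexV P X X Y))) -compA bet_nat1.
by rewrite compA -fcomp.
Qed.

Lemma bet_hex' A Y : fm (lwh X) (bet A X Y) \oc bet A X (lwh X Y)
  = asc X X (lwh A Y) \oc (bet A (X \ox X) Y \oc fm (lwh A) (ascV X X Y)).
Proof.
rewrite (tl2 (bet_hex A X X Y)) -!compA (fm2 (lwh A) (ascVK X X Y)) fid compm1.
by [].
Qed.

Lemma bet_symq_pass P Y :
  symq (lwh P Y) \oc (fm (lwh X) (bet P X Y) \oc bet P X (lwh X Y))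
  = bet P (quot (alt2 X)) Y \oc fm (lwh P) (symq Y).
Proof.
rewrite bet_hex' !symqE -compA (tl2 (ascK _ _ _)) comp1m.
by rewrite fcomp compA -bet_nat2 -compA.
Qed.

Fact sw_braid Y : bet X X (lwh X Y) \oc (fm (lwh X) (bet X X Y) \oc bet X X (lwh X Y))
  = fm (lwh X) (bet X X Y) \oc (bet X X (lwh X Y) \oc fm (lwh X) (bet X X Y)).
Proof. exact: esym (bet_braid X X X Y). Qed.

Definition symQuad : quadData C := @QuadData k C (lwh X) (bet X X)
  (fun Y Y' f => bet_nat3 X X f) (bet_inv X X) sw_braid (lwh (sob (alt2 X)))
  altk altk_nat bet_altk altk_im (fun Y => ex_intro _ _ (bet_altk_pass X Y))
  (@ptrace k C X) (@ptrace_lin k C X) (@ptrace_natl k C X) (@ptrace_natr k C X)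
  (ptrace_bet X) (dimo X) (dimo_ptrace X).

Let nbet Y : mor (lwh X (lwh X Y)) (lwh X (lwh X Y)) := - bet X X Y.

Fact nbet_nat Y Y' (f : mor Y' Y) :
  fm (lwh X) (fm (lwh X) f) \oc nbet Y' = nbet Y \oc fm (lwh X) (fm (lwh X) f).
Proof. by rewrite /nbet compNl compNr bet_nat3. Qed.

Fact nbet_inv Y : nbet Y \oc nbet Y = idm _.
Proof. by rewrite /nbet compNl compNr opprK bet_inv. Qed.

Fact nbet_braid Y : (nbet (lwh X Y) \oc fm (lwh X) (nbet Y)) \oc nbet (lwh X Y)
  = (fm (lwh X) (nbet Y) \oc nbet (lwh X Y)) \oc fm (lwh X) (nbet Y).
Proof. by rewrite /nbet !fN !(compNl, compNr) -!compA sw_braid. Qed.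

Fact symq_nat' Y Y' (f : mor Y' Y) :
  symq Y \oc fm (lwh X) (fm (lwh X) f) = fm (lwh (quot (alt2 X))) f \oc symq Y'.
Proof. exact: symq_nat. Qed.

Fact symq_nbet Y : symq Y \oc nbet Y = - symq Y.
Proof. by rewrite compNr symq_bet. Qed.

Fact symq_norm' Y : exists r, idm _ - nbet Y = r \oc symq Y.
Proof. by rewrite opprK; apply: symq_norm. Qed.

Fact nbet_pass Y : exists r,
  (symq (lwh X Y) \oc fm (lwh X) (nbet Y)) \oc nbet (lwh X Y) = r \oc fm (lwh X) (symq Y).
Proof.
exists (bet X (quot (alt2 X)) Y).
by rewrite /nbet fN !(compNl, compNr) opprK -compA bet_symq_pass.
Qed.

(** The sign is forced by [qtr_sw]: the trace of the braiding -c has to be the identity. It turns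
    the dimension into - dim X. *)
Definition ntr Y Y' (f : mor (lwh X Y') (lwh X Y)) : mor Y' Y := - ptrace f.

Fact ntr_lin Y Y' a (f g : mor (lwh X Y') (lwh X Y)) :
  ntr (a *: f + g) = a *: ntr f + ntr g.
Proof. by rewrite /ntr ptrace_lin opprD scalerN. Qed.

Fact ntr_natl V Y Z (g : mor Z Y) (f : mor (lwh X Y) (lwh X V)) :
  ntr (f \oc fm (lwh X) g) = ntr f \oc g.
Proof. by rewrite /ntr ptrace_natr compNl. Qed.

Fact ntr_natr V Y Z (g : mor (lwh X Z) (lwh X Y)) (f : mor Y V) :
  ntr (fm (lwh X) f \oc g) = f \oc ntr g.
Proof. by rewrite /ntr ptrace_natl compNr. Qed.

Fact ntr_nbet Y : ntr (nbet Y) = idm _.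
Proof. by rewrite /ntr ptraceN opprK ptrace_bet. Qed.

Fact ntr_id Y : ntr (idm (lwh X Y)) = (- dimo X) *: idm Y.
Proof. by rewrite /ntr dimo_ptrace scaleNr. Qed.

(* In the opposite category with the sign-twisted braiding, exterior powers
   play the role of symmetric powers. *)
Definition extQuad : quadData (opCat C) := @QuadData k (opCat C) (opFun (lwh X)) nbet
  nbet_nat nbet_inv nbet_braid (opFun (lwh (quot (alt2 X))))
  symq symq_nat' symq_nbet symq_norm' nbet_pass
  ntr ntr_lin ntr_natl ntr_natr ntr_nbet (- dimo X) ntr_id.

End Instances.

(** * Comparison with symPow and extPow *)

Section Bridge.
Variables (k : fieldType) (C : tensorCategory k) (X : C).
Implicit Types Y Z W : C.

Fact coker_ex Y Z (f : mor Y Z) : exists (Q : C) (q : mor Z Q), isCokernel f q.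
Proof. by exists (cokerob f), (cokerm f); apply: cokermP. Qed.

Fact ker_ex Y Z (f : mor Z Y) : exists (Q : C) (q : mor Q Z), isKernel f q.
Proof. by exists (kerob f), (kerm f); apply: kermP. Qed.

Fact ladj_bij Y W : bijective (@ladj k C X Y W).
Proof. by exists (@ladjV k C X Y W); [exact: ladjK | exact: ladjVK]. Qed.

Fact radj_bij Y W : bijective (@radj k C X Y W).
Proof. by exists (@radjV k C X Y W); [exact: radjK | exact: radjVK]. Qed.

Let ip n : mor (lwh X (tpow X n)) (tpow X n.+1) := idm _.
Let ipV n : mor (tpow X n.+1) (lwh X (tpow X n)) := idm _.
Fact ipK n : ipV n \oc ip n = idm _. Proof. exact: comp1m. Qed.

Definition symTow : symTower (symQuad X) :=
  @tower k C (symQuad X) zob (zobP C) (tpow X) coker_ex (lwh (dual X))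
    (@ladj k C X) (@ladj_comp k C X) ladj_bij.

Lemma isZero_op Z : isZero (C := opCat C) Z <-> isZero Z.
Proof. by split=> -[]. Qed.

Definition extTow : symTower (extQuad X) :=
  @tower k (opCat C) (extQuad X) zob (((isZero_op _).2) (zobP C)) (tpow X)
    (fun Y Z f => @ker_ex Y Z f) (lwh (dual X))
    (fun Y W g => @radj k C X Y W g) (fun Y Y' W g f => @radj_comp k C X Y Y' W g f)
    (fun Y W => radj_bij Y W).

Definition symAnnih n W (g : mor (tpow X n) W) : Prop :=
  @annih k C (symQuad X) (tpow X) ip (lwh (dual X)) (@ladj k C X) n W g.

Definition extAnnih n W (g : mor W (tpow X n)) : Prop :=
  @annih k (opCat C) (extQuad X) (tpow X) ipV (lwh (dual X))
    (fun Y W g => @radj k C X Y W g) n W g.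

Lemma symTow_zeroP n : isZero (symTow n.+3) <->
  forall W (g : mor (tpow X n) W), symAnnih g -> g = 0.
Proof.
apply: (@tower_zeroP k C (symQuad X) zob (zobP C) (tpow X) ip ipV ipK ipK) => Y Z f.
exact: lwh_epi.
Qed.

Lemma extTow_zeroP n : isZero (C := opCat C) (extTow n.+3) <->
  forall W (g : mor W (tpow X n)), extAnnih g -> g = 0.
Proof.
apply: (@tower_zeroP k (opCat C) (extQuad X) zob ((isZero_op _).2 (zobP C)) (tpow X)
  ipV ip ipK ipK) => Y Z f.
exact: (@lwh_mono k C _ Z Y f).
Qed.

Lemma imSub_kill Y Z W (f : mor Y Z) (g : mor Z W) :
  g \oc sinc (imSub f) = 0 <-> g \oc f = 0.
Proof.
have iK : isKernel (cokerm f) (sinc (imSub f)) := kermP _.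
split=> [gi|gf].
  have [h <-] := kernel_fac iK (cokermP f).1.
  by rewrite compA gi comp0m.
have [h <-] := cokernel_fac (cokermP f) gf.
by rewrite -compA iK.1 compm0.
Qed.

Fixpoint killsAll Y W (s : seq (subobject Y)) (g : mor Y W) : Prop :=
  if s is M :: s' then g \oc sinc M = 0 /\ killsAll s' g else True.

Lemma pr1_in2 (A B : C) : pr1 A B \oc in2 A B = 0.
Proof.
have := congr1 (fun f => pr1 A B \oc (f \oc in2 A B)) (bip_id A B).
rewrite !(compDl, compDr) -!compA pr2_in2 compm1 comp1m (tl2 (pr1_in1 _ _)).
by rewrite comp1m -[RHS]addr0 => /addrI.
Qed.

Lemma pr2_in1 (A B : C) : pr2 A B \oc in1 A B = 0.
Proof.
have := congr1 (fun f => pr2 A B \oc (f \oc in1 A B)) (bip_id A B).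
rewrite !(compDl, compDr) -!compA pr1_in1 compm1 comp1m (tl2 (pr2_in2 _ _)).
by rewrite comp1m -[RHS]add0r => /addIr.
Qed.

Lemma killsAll_sum Y W (s : seq (subobject Y)) (g : mor Y W) :
  killsAll s g <-> g \oc sinc (\big[@subSum k C Y / subBot Y]_(M <- s) M) = 0.
Proof.
elim: s => [|M s IH]; first by rewrite big_nil; split=> // _; apply/imSub_kill; rewrite compm0.
rewrite big_cons /=; set N := bigop _ _ _ in IH *.
rewrite IH imSub_kill; split=> [[gM gN]|gMN].
  by rewrite compDr !compA gM gN !comp0m addr0.
split.
  have := congr1 (fun f => f \oc in1 (sob M) (sob N)) gMN.
  by rewrite /= comp0m compDr compDl -!compA pr1_in1 pr2_in1 compm1 !compm0 addr0.
have := congr1 (fun f => f \oc in2 (sob M) (sob N)) gMN.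
by rewrite /= comp0m compDr compDl -!compA pr2_in2 pr1_in2 compm1 !compm0 add0r.
Qed.

Lemma altsS n : alts X n.+2 = imSub (asc X X (tpow X n) \oc rwh (sinc (alt2 X)) (tpow X n))
  :: [seq imSub (idm X \om sinc M) | M <- alts X n.+1].
Proof. by []. Qed.

Lemma symAnnihS n W (g : mor (tpow X n.+2) W) : symAnnih g
  <-> g \oc altk X (tpow X n) = 0 /\ symAnnih (@ladj k C X (tpow X n.+1) W g).
Proof.
have -> : symAnnih g = (g \oc (ip n.+1 \oc (fm (lwh X) (ip n) \oc altk X (tpow X n))) = 0
    /\ symAnnih (@ladj k C X (tpow X n.+1) W (g \oc ip n.+1))) by [].
by rewrite /ip fid !comp1m compm1.
Qed.

(** Both recursions have the same shape: the head is the relation on the first two factors, and a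
    map kills X (x) M exactly when its adjoint kills M. *)
Lemma symAnnihP n W (g : mor (tpow X n) W) : symAnnih g <-> killsAll (alts X n) g.
Proof.
elim: n W g => [|[|n] IHn] W g //; rewrite symAnnihS IHn altsS altkE.
have adjE s : @killsAll (tpow X n.+1) _ s (@ladj k C X (tpow X n.+1) W g)
    <-> @killsAll (tpow X n.+2) W [seq imSub (idm X \om sinc M) | M <- s] g.
  elim: s => //= M s ->; rewrite (imSub_kill (idm X \om sinc M)).
  rewrite -[idm X \om sinc M]/(fm (lwh X) (sinc M)) -ladj_comp.
  by split=> -[gM sM]; split=> //; [apply: ladj_inj; rewrite gM ladj0 | rewrite gM ladj0].
have consE N s : @killsAll (tpow X n.+2) W (N :: s) g
    <-> g \oc sinc N = 0 /\ killsAll s g by [].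
by rewrite adjE consE imSub_kill.
Qed.

Lemma symTow_symPow n : isZero (symTow n.+3) <-> isZero (symPow X n).
Proof.
rewrite symTow_zeroP /symPow /quot; set S := bigop _ _ _.
have qP := cokermP (sinc S).
split=> [z|[z _] W g /symAnnihP/killsAll_sum gS].
  apply: isZero_id; apply: (epi_eq0 (cokernel_epi qP)); rewrite comp1m.
  by apply: z; apply/symAnnihP/killsAll_sum; apply: qP.1.
by have [h <-] := cokernel_fac qP gS; rewrite (z _ h) comp0m.
Qed.

Fixpoint liesIn Y W (s : seq (subobject Y)) (g : mor W Y) : Prop :=
  if s is M :: s' then cokerm (sinc M) \oc g = 0 /\ liesIn s' g else True.

Lemma coker_imSub A B Q W (f : mor A B) (r : mor B Q) (g : mor W B) :
  isCokernel f r -> (cokerm (sinc (imSub f)) \oc g = 0 <-> r \oc g = 0).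
Proof.
move=> fr.
have [u uP] : exists u, u \oc cokerm (sinc (imSub f)) = r.
  by apply: cokernel_fac (cokermP _) _; apply/imSub_kill; apply: fr.1.
have [v vP] : exists v, v \oc r = cokerm (sinc (imSub f)).
  by apply: cokernel_fac fr _; apply/imSub_kill; apply: (cokermP _).1.
by split=> H; [rewrite -uP | rewrite -vP]; rewrite -compA H compm0.
Qed.

(** Intersections are kernels by construction. Carrying one map [r] with that kernel gives a single
    test for membership, dual to [killsAll_sum]. *)
Lemma liesIn_cap Y (s : seq (subobject Y)) : exists Q (r : mor Y Q),
  isKernel r (sinc (\big[@subCap k C Y / subTop Y]_(M <- s) M)) /\
  forall W (g : mor W Y), liesIn s g <-> r \oc g = 0.
Proof.
elim: s => [|M s IH].
  rewrite big_nil; exists zob, 0; split; first exact: kermP.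
  by move=> W g /=; rewrite comp0m.
rewrite big_cons; set N := bigop _ _ _ in IH *.
have [Q [r [rN rP]]] := IH.
exists _, (in1 (quot M) (quot N) \oc cokerm (sinc M) + in2 (quot M) (quot N) \oc cokerm (sinc N)).
split; first exact: kermP.
have NP W (g : mor W Y) : cokerm (sinc N) \oc g = 0 <-> r \oc g = 0.
  split=> [H|/(kernel_fac rN) [h <-]]; last by rewrite compA (cokermP _).1 comp0m.
  have [v <-] := cokernel_fac (cokermP (sinc N)) rN.1.
  by rewrite -compA H compm0.
move=> W g /=; rewrite rP -NP; split=> [[gM gN]|gMN].
  by rewrite compDl -!compA gM gN !compm0 addr0.
split.
  have := congr1 (fun f => pr1 (quot M) (quot N) \oc f) gMN.
  rewrite compm0 !(compDl, compDr) -!compA (tl2 (pr1_in1 _ _)) (tl2 (pr1_in2 _ _)).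
  by rewrite comp1m comp0m addr0.
have := congr1 (fun f => pr2 (quot M) (quot N) \oc f) gMN.
rewrite compm0 !(compDl, compDr) -!compA (tl2 (pr2_in1 _ _)) (tl2 (pr2_in2 _ _)).
by rewrite comp1m comp0m add0r.
Qed.

Lemma extAnnihS n W (g : mor W (tpow X n.+2)) : extAnnih g
  <-> symq X (tpow X n) \oc g = 0 /\ extAnnih (@radj k C X (tpow X n.+1) W g).
Proof.
have -> : extAnnih g = (((symq X (tpow X n) \oc fm (lwh X) (ipV n)) \oc ipV n.+1) \oc g = 0
    /\ extAnnih (@radj k C X (tpow X n.+1) W (ipV n.+1 \oc g))) by [].
by rewrite /ipV fid !compm1 comp1m.
Qed.

Lemma extAnnihP n W (g : mor W (tpow X n)) : extAnnih g <-> liesIn (alts X n) g.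
Proof.
elim: n W g => [|[|n] IHn] W g //; rewrite extAnnihS IHn altsS.
have adjE s : @liesIn (tpow X n.+1) _ s (@radj k C X (tpow X n.+1) W g)
    <-> @liesIn (tpow X n.+2) W [seq imSub (idm X \om sinc M) | M <- s] g.
  elim: s => //= M s ->.
  rewrite (coker_imSub g (lwh_cokernel X (cokermP (sinc M)))) -radj_comp.
  by split=> -[gM sM]; split=> //; [apply: radj_inj; rewrite gM radj0 | rewrite gM radj0].
have consE N s : @liesIn (tpow X n.+2) W (N :: s) g
    <-> cokerm (sinc N) \oc g = 0 /\ liesIn s g by [].
rewrite adjE consE; have iq := rwh_cokernel (tpow X n) (alt2_coker X).
suff iq' : isCokernel (asc X X (tpow X n) \oc rwh (sinc (alt2 X)) (tpow X n)) (symq X (tpow X n)).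
  by rewrite (coker_imSub g iq').
rewrite symqE; apply: isCokernelP.
- by apply: epi_comp; [exact: iso_epi (ascK _ _ _) | exact: cokernel_epi iq].
- by rewrite -compA (tl2 (ascK _ _ _)) comp1m; apply: iq.1.
move=> V h; rewrite compA => /(cokernel_fac iq) [u uP].
by exists u; rewrite compA uP -compA ascVK compm1.
Qed.

Lemma extTow_extPow n : isZero (extTow n.+3) <-> isZero (extPow X n).
Proof.
rewrite extTow_zeroP /extPow; set S := bigop _ _ _.
have [Q [r [rS rP]]] : exists Q (r : mor (tpow X n) Q), isKernel r (sinc S) /\
  forall W (g : mor W (tpow X n)), liesIn (alts X n) g <-> r \oc g = 0 := liesIn_cap (alts X n).
split=> [z|[_ z] W g /extAnnihP/rP gS].
  apply: isZero_id; apply: (mono_eq0 (kernel_monic rS)); rewrite compm1.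
  by apply: z; apply/extAnnihP/rP; apply: rS.1.
by have [h <-] := kernel_fac rS gS; rewrite (z _ h) compm0.
Qed.

End Bridge.

(** * Second and third powers *)

Section Squares.
Variables (k : fieldType) (C : tensorCategory k) (X : C).
Implicit Types A P W Y Z : C.

Let L : C := sob (alt2 X).
Let Q : C := quot (alt2 X).
Let i : mor L (X \ox X) := sinc (alt2 X).
Let q : mor (X \ox X) Q := cokerm i.

Lemma symq_altk Y : symq X Y \oc altk X Y = 0.
Proof.
rewrite symqE altkE -compA (tl2 (ascK _ _ _)) comp1m -rwh_comp.
by rewrite (alt2_coker X).1 rwh0.
Qed.

Lemma symq_coker Y : isCokernel (altk X Y) (symq X Y).
Proof.
have iq : isCokernel (rwh i Y) (rwh q Y) by apply/rwh_cokernel/alt2_coker.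
apply: isCokernelP; last move=> W g.
- by rewrite symqE; apply: epi_comp; [exact: iso_epi (ascK _ _ _) | exact: cokernel_epi iq].
- exact: symq_altk.
rewrite altkE compA => /(cokernel_fac iq) [u uP].
by exists u; rewrite symqE compA uP -compA ascVK compm1.
Qed.

Lemma altk_ker Y : isKernel (symq X Y) (altk X Y).
Proof.
have qi : isKernel (rwh q Y) (rwh i Y) by apply/rwh_kernel/alt2_ker.
apply: isKernelP; last move=> W g.
- by rewrite altkE; apply: mono_comp; [exact: kernel_monic qi | exact: iso_mono (ascK _ _ _)].
- exact: symq_altk.
rewrite symqE -compA => /(kernel_fac qi) [u uP].
by exists u; rewrite altkE -compA uP (tl2 (ascVK _ _ _)) comp1m.
Qed.

Lemma bet_symq A Y : bet A Q Y \oc fm (lwh A) (symq X Y)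
  = symq X (lwh A Y) \oc (fm (lwh X) (bet A X Y) \oc bet A X (lwh X Y)).
Proof. by rewrite bet_symq_pass. Qed.

Lemma bet_symq' A Y : bet Q A Y \oc symq X (lwh A Y)
  = fm (lwh A) (symq X Y) \oc (bet X A (lwh X Y) \oc fm (lwh X) (bet X A Y)).
Proof.
by rewrite !symqE (tl22 (bet_nat1 q A Y)) bet_ascV fcomp -!compA.
Qed.

Lemma bet_altk2 A Y : fm (lwh A) (altk X Y) \oc bet L A Y
  = bet X A (lwh X Y) \oc (fm (lwh X) (bet X A Y) \oc altk X (lwh A Y)).
Proof. by rewrite bet_altk_pass. Qed.

Lemma bet_altk2' A Y : altk X (lwh A Y) \oc bet A L Y
  = fm (lwh X) (bet A X Y) \oc (bet A X (lwh X Y) \oc fm (lwh A) (altk X Y)).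
Proof.
rewrite !altkE -compA -bet_nat2 fcomp (tl3 (esym (bet_hex A X X Y))) -compA.
by [].
Qed.

(** Cyclicity moves the quotient map to the other end of [g], and the trace over the tensor square
    is an iterated trace. *)
Lemma ptrace_symq Y Y' (g : mor (lwh Q Y) (lwh X (lwh X Y'))) :
  ptrace (symq X Y' \oc g) = ptrace (ptrace (g \oc symq X Y)).
Proof.
rewrite symqE -compA ptrace_dinat -ptrace_tens symqE -!compA.
by rewrite (tl2 (ascVK _ _ _)) comp1m.
Qed.

Lemma ptrace_altk Y Y' (g : mor (lwh X (lwh X Y')) (lwh L Y)) :
  ptrace (g \oc altk X Y') = ptrace (ptrace (altk X Y \oc g)).
Proof.
rewrite altkE compA -ptrace_dinat -ptrace_tens altkE -!compA.
by rewrite ascVK compm1.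
Qed.

Fact sym2_fac Y W (g : mor (lwh X (lwh X Y)) W) :
  g \oc altk X Y = 0 -> exists h, h \oc symq X Y = g.
Proof. exact: cokernel_fac (symq_coker Y). Qed.

Fact sym2_pi Y : bet X Q Y \oc fm (lwh X) (symq X Y)
  = symq X (lwh X Y) \oc (fm (lwh X) (fm (lwh X) (idm _) \oc bet X X Y) \oc bet X X (lwh X Y)).
Proof. by rewrite fid comp1m bet_symq. Qed.

Fact sym2_tau Y : bet Q Q Y \oc symq X (lwh Q Y)
  = fm (lwh Q) (symq X Y) \oc (bet X Q (lwh X Y) \oc fm (lwh X) (bet X Q Y \oc fm (lwh X) (idm _))).
Proof. by rewrite fid compm1 bet_symq'. Qed.

Definition symPow2 : powData (symQuad X) 2 := @PowData k C (symQuad X) 2 (lwh Q)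
  (symq X) (fun Y Y' f => symq_nat X f) (symq_altk) sym2_fac
  (fun Y => cokernel_epi (symq_coker Y)) (fun Y => lwh_epi (cokernel_epi (symq_coker Y)))
  (bet X Q) (fun Y Y' f => bet_nat3 X Q f) sym2_pi
  (fun Y => ex_intro _ _ (bet_altk_pass X Q Y))
  (bet Q Q) sym2_tau (@ptrace k C Q) (@ptrace_lin k C Q) (@ptrace_natl k C Q)
  (@ptrace_natr k C Q) ptrace_symq (ptrace_bet Q) (dimo Q) (dimo_ptrace Q).

Fact ext2_nat Y Y' (f : mor Y' Y) :
  fm (lwh X) (fm (lwh X) f) \oc altk X Y' = altk X Y \oc fm (lwh L) f.
Proof. exact: altk_nat. Qed.

Fact ext2_fac Y W (g : mor W (lwh X (lwh X Y))) :
  symq X Y \oc g = 0 -> exists h, altk X Y \oc h = g.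
Proof. exact: kernel_fac (altk_ker Y). Qed.

Fact ext2_rho_nat Y Y' (f : mor Y' Y) :
  fm (lwh X) (fm (lwh L) f) \oc bet L X Y' = bet L X Y \oc fm (lwh L) (fm (lwh X) f).
Proof. by rewrite bet_nat3. Qed.

Fact ext2_pi Y : fm (lwh X) (altk X Y) \oc bet L X Y
  = ((- bet X X (lwh X Y)) \oc fm (lwh X) ((- bet X X Y) \oc fm (lwh X) (idm _))) \oc altk X (lwh X Y).
Proof. by rewrite fid compm1 fN compNl compNr opprK bet_altk2 compA. Qed.

Fact ext2_pass Y : exists r,
  (symq X (lwh L Y) \oc fm (lwh X) (bet L X Y)) \oc bet L X (lwh X Y)
  = r \oc fm (lwh L) (symq X Y).
Proof. by exists (bet L Q Y); rewrite -compA bet_symq_pass. Qed.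

Fact ext2_tau Y : altk X (lwh L Y) \oc bet L L Y
  = (fm (lwh X) (fm (lwh X) (idm _) \oc bet L X Y) \oc bet L X (lwh X Y)) \oc fm (lwh L) (altk X Y).
Proof. by rewrite fid comp1m bet_altk2' compA. Qed.

Fact ext2_tr Y Y' (g : mor (lwh X (lwh X Y')) (lwh L Y)) :
  ptrace (g \oc altk X Y') = ntr (ntr (altk X Y \oc g)).
Proof. by rewrite /ntr ptraceN opprK ptrace_altk. Qed.

(** Crossing Lambda^2 passes two factors, so the signs of the twisted braiding cancel and [bet],
    [ptrace] and [dimo] occur without sign. *)
Definition extPow2 : powData (extQuad X) 2 := @PowData k (opCat C) (extQuad X) 2 (opFun (lwh L))
  (altk X) ext2_nat (symq_altk) ext2_fac
  (fun Y W g h => @kernel_monic k C _ _ _ _ _ (altk_ker Y) W g h)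
  (fun Y W g h => @lwh_mono k C X _ _ _ (kernel_monic (altk_ker Y)) W g h)
  (bet L X) ext2_rho_nat ext2_pi ext2_pass
  (bet L L) ext2_tau (fun Y Y' f => @ptrace k C L Y' Y f)
  (fun Y Y' a f g => @ptrace_lin k C L Y' Y a f g)
  (fun V Y Z g f => @ptrace_natr k C L Z Y V f g)
  (fun V Y Z g f => @ptrace_natl k C L Z Y V f g) ext2_tr (ptrace_bet L) (dimo L) (dimo_ptrace L).

Lemma dimo_square : dimo L + dimo Q = dimo X ^+ 2.
Proof.
by rewrite expr2 -dimo_tens (dimo_exact (conj (alt2_ker X) (alt2_coker X))).
Qed.

End Squares.

Section Cubes.
Variables (k : fieldType) (C : tensorCategory k) (X : C).
Implicit Types A W Y Z : C.

Let L : C := sob (alt2 X).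
Let Q : C := quot (alt2 X).
Let i : mor L (X \ox X) := sinc (alt2 X).
Let q : mor (X \ox X) Q := cokerm i.
Let X3 : C := X \ox (X \ox X).

Definition asc3 Y : mor (lwh X3 Y) (lwh X (lwh X (lwh X Y))) :=
  locked (fm (lwh X) (asc X X Y) \oc asc X (X \ox X) Y).

Definition asc3V Y : mor (lwh X (lwh X (lwh X Y))) (lwh X3 Y) :=
  locked (ascV X (X \ox X) Y \oc fm (lwh X) (ascV X X Y)).

Lemma asc3E Y : asc3 Y = fm (lwh X) (asc X X Y) \oc asc X (X \ox X) Y.
Proof. by rewrite /asc3 -lock. Qed.

Lemma asc3VE Y : asc3V Y = ascV X (X \ox X) Y \oc fm (lwh X) (ascV X X Y).
Proof. by rewrite /asc3V -lock. Qed.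

Lemma asc3K Y : asc3V Y \oc asc3 Y = idm _.
Proof.
by rewrite asc3E asc3VE -compA (tl2 (fm2 (lwh X) (ascK _ _ _))) fid comp1m ascK.
Qed.

Lemma asc3VK Y : asc3 Y \oc asc3V Y = idm _.
Proof.
by rewrite asc3E asc3VE -compA (tl2 (ascVK _ _ _)) comp1m -fcomp ascVK fid.
Qed.

Lemma asc3_nat Y Y' (f : mor Y Y') :
  fm (lwh X) (fm (lwh X) (fm (lwh X) f)) \oc asc3 Y = asc3 Y' \oc fm (lwh X3) f.
Proof.
by rewrite !asc3E -!compA asc_nat3 (tl22 (fm22 (lwh X) (asc_nat3 X X f))).
Qed.

Lemma bet_asc3 A Y : fm (lwh A) (asc3 Y) \oc bet X3 A Y
  = bet X A (lwh X (lwh X Y)) \oc (fm (lwh X) (bet X A (lwh X Y))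
    \oc (fm (lwh X) (fm (lwh X) (bet X A Y)) \oc asc3 (lwh A Y))).
Proof.
rewrite !asc3E fcomp -compA bet_hexV -(tl22 (bet_nat3 X A (asc X X Y))).
rewrite (tl2 (fm2 (lwh X) (bet_hexV A X X Y))) !fcomp -!compA.
by [].
Qed.

Lemma bet_asc3' A Y : asc3 (lwh A Y) \oc bet A X3 Y
  = fm (lwh X) (fm (lwh X) (bet A X Y)) \oc (fm (lwh X) (bet A X (lwh X Y))
    \oc (bet A X (lwh X (lwh X Y)) \oc fm (lwh A) (asc3 Y))).
Proof.
rewrite !asc3E fcomp -compA bet_hex (tl2 (fm2 (lwh X) (bet_hex A X X Y))) !fcomp -!compA.
by rewrite -(tl22 (bet_nat3 A X (asc X X Y))).
Qed.

Lemma ptrace_asc3 Y Y' (f : mor (lwh X3 Y) (lwh X3 Y')) :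
  ptrace f = ptrace (ptrace (ptrace (asc3 Y' \oc (f \oc asc3V Y)))).
Proof.
rewrite -ptrace_tens -ptrace_tens -ptrace_natr -ptrace_natl asc3E asc3VE -!compA.
by [].
Qed.

(* Its cokernel is the symmetric cube and its kernel the exterior cube. *)
Definition altsym : mor (lwh L X) (lwh X Q) :=
  fm (lwh X) q \oc altk X X.

Definition cubq : mor X3 (cokerob altsym) := cokerm altsym \oc fm (lwh X) q.
Definition cubi : mor (kerob altsym) X3 := altk X X \oc kerm altsym.

Definition sym3 Y : mor (lwh X (lwh X (lwh X Y))) (lwh (cokerob altsym) Y) :=
  locked (rwh cubq Y \oc asc3V Y).
Definition ext3 Y : mor (lwh (kerob altsym) Y) (lwh X (lwh X (lwh X Y))) :=
  locked (asc3 Y \oc rwh cubi Y).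

Lemma sym3E Y : sym3 Y = rwh cubq Y \oc asc3V Y. Proof. by rewrite /sym3 -lock. Qed.
Lemma ext3E Y : ext3 Y = asc3 Y \oc rwh cubi Y. Proof. by rewrite /ext3 -lock. Qed.

Lemma altk_left Y : altk X (lwh X Y) \oc asc L X Y = asc3 Y \oc rwh (altk X X) Y.
Proof.
rewrite !altkE -compA -asc_nat1 asc3E rwh_comp (tl2 (penta X X X Y)) -!compA.
by [].
Qed.

Lemma altk_right Y : fm (lwh X) (altk X Y) \oc asc X L Y = asc3 Y \oc rwh (fm (lwh X) i) Y.
Proof. by rewrite altkE fcomp -compA -asc_nat2 asc3E -compA. Qed.

Lemma symq_left Y : symq X (lwh X Y) \oc asc3 Y = asc Q X Y \oc rwh (symq X X) Y.
Proof.
rewrite !symqE asc3E -!compA (tl2 (ascV_ascV X X X Y)) -!compA ascK compm1.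
by rewrite -(tl22 (asc_nat1 q X Y)) -rwh_comp.
Qed.

Lemma symq_right Y : fm (lwh X) (symq X Y) \oc asc3 Y = asc X Q Y \oc rwh (fm (lwh X) q) Y.
Proof.
by rewrite symqE fcomp asc3E -compA (tl2 (fm2 (lwh X) (ascK _ _ _))) fid comp1m asc_nat2.
Qed.

Lemma sym3_left Y : sym3 Y \oc altk X (lwh X Y) = 0.
Proof.
apply: (epi_eq0 (iso_epi (ascVK L X Y))); rewrite -compA altk_left sym3E -!compA.
rewrite (tl2 (asc3K Y)) comp1m -rwh_comp /cubq -compA -/altsym.
by rewrite (cokermP altsym).1 rwh0.
Qed.

Lemma sym3_right Y : sym3 Y \oc fm (lwh X) (altk X Y) = 0.
Proof.
apply: (epi_eq0 (iso_epi (ascVK X L Y))); rewrite -compA altk_right sym3E -!compA.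
rewrite (tl2 (asc3K Y)) comp1m -rwh_comp /cubq -(compA (cokerm _)).
by rewrite (fm2 (lwh X) (alt2_coker X).1) f0 compm0 rwh0.
Qed.

(** The two relations are divided out in turn: first X (x) Lambda^2, leaving X (x) Sym^2, and then
    the image of Lambda^2 (x) X under [altsym]. *)
Lemma sym3_fac Y W (g : mor (lwh X (lwh X (lwh X Y))) W) :
  g \oc altk X (lwh X Y) = 0 /\ g \oc fm (lwh X) (altk X Y) = 0 ->
  exists h, h \oc sym3 Y = g.
Proof.
move=> [gl gr].
have [u uP] : exists u, u \oc rwh (fm (lwh X) q) Y = g \oc asc3 Y.
  apply: cokernel_fac (rwh_cokernel Y (lwh_cokernel X (alt2_coker X))) _.
  by rewrite -compA -altk_right (tl2 gr) comp0m.
have [v vP] : exists v, v \oc rwh (cokerm altsym) Y = u.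
  apply: cokernel_fac (rwh_cokernel Y (cokermP altsym)) _.
  by rewrite /altsym rwh_comp compA uP -compA -altk_left (tl2 gl) comp0m.
exists v; rewrite sym3E /cubq rwh_comp -!compA (tl2 vP) (tl2 uP) -compA.
by rewrite asc3VK compm1.
Qed.

Lemma sym3_epi Y : isEpi (sym3 Y).
Proof.
rewrite sym3E; apply: epi_comp; first exact: iso_epi (asc3K Y).
apply/rwh_epi/epi_comp; first exact/lwh_epi/(cokernel_epi (alt2_coker X)).
exact: cokernel_epi (cokermP altsym).
Qed.

Lemma ext3_left Y : symq X (lwh X Y) \oc ext3 Y = 0.
Proof.
rewrite ext3E (tl22 (symq_left Y)) -rwh_comp /cubi (tl2 (symq_altk X X)).
by rewrite comp0m rwh0 compm0.
Qed.

Lemma ext3_right Y : fm (lwh X) (symq X Y) \oc ext3 Y = 0.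
Proof.
rewrite ext3E (tl22 (symq_right Y)) -rwh_comp /cubi compA -/altsym.
by rewrite (kermP altsym).1 rwh0 compm0.
Qed.

Lemma ext3_fac Y W (g : mor W (lwh X (lwh X (lwh X Y)))) :
  symq X (lwh X Y) \oc g = 0 /\ fm (lwh X) (symq X Y) \oc g = 0 ->
  exists h, ext3 Y \oc h = g.
Proof.
move=> [gl gr].
have [u uP] : exists u, rwh (altk X X) Y \oc u = asc3V Y \oc g.
  apply: kernel_fac (rwh_kernel Y (altk_ker X X)) _.
  apply: (mono_eq0 (iso_mono (ascK Q X Y))).
  by rewrite (tl2 (esym (symq_left Y))) -compA (tl2 (asc3VK Y)) comp1m.
have [v vP] : exists v, rwh (kerm altsym) Y \oc v = u.
  apply: kernel_fac (rwh_kernel Y (kermP altsym)) _.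
  rewrite /altsym rwh_comp -compA uP.
  apply: (mono_eq0 (iso_mono (ascK X Q Y))).
  by rewrite (tl2 (esym (symq_right Y))) -compA (tl2 (asc3VK Y)) comp1m.
exists v; rewrite ext3E /cubi rwh_comp -!compA vP uP.
by rewrite (tl2 (asc3VK Y)) comp1m.
Qed.

Lemma ext3_mono Y : isMono (ext3 Y).
Proof.
rewrite ext3E; apply: mono_comp; last exact: iso_mono (asc3K Y).
apply/rwh_mono/mono_comp; first exact: kernel_monic (kermP altsym).
exact: kernel_monic (altk_ker X X).
Qed.

Lemma sym3_nat Y Y' (f : mor Y Y') :
  sym3 Y' \oc fm (lwh X) (fm (lwh X) (fm (lwh X) f)) = fm (lwh (cokerob altsym)) f \oc sym3 Y.
Proof.
have E : asc3V Y' \oc fm (lwh X) (fm (lwh X) (fm (lwh X) f)) = fm (lwh X3) f \oc asc3V Y.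
  exact: esym (flip_square (asc3VK _) (asc3K _) (esym (asc3_nat f))).
by rewrite !sym3E compA lwh_rwh -!compA E.
Qed.

Lemma ext3_nat Y' Y (f : mor Y' Y) :
  fm (lwh X) (fm (lwh X) (fm (lwh X) f)) \oc ext3 Y' = ext3 Y \oc fm (lwh (kerob altsym)) f.
Proof. by rewrite !ext3E compA asc3_nat -!compA lwh_rwh. Qed.

Let P := cokerob altsym.
Let E := kerob altsym.

Lemma bet_sym3 A Y : bet A P Y \oc fm (lwh A) (sym3 Y)
  = sym3 (lwh A Y) \oc (fm (lwh X) (fm (lwh X) (bet A X Y))
    \oc (fm (lwh X) (bet A X (lwh X Y)) \oc bet A X (lwh X (lwh X Y)))).
Proof.
have H : fm (lwh A) (asc3 Y) \oc fm (lwh A) (asc3V Y) = idm _ by rewrite -fcomp asc3VK fid.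
apply: (iso_epi H); rewrite !sym3E -!compA.
rewrite -(bet_asc3' A Y) (tl2 (asc3K _)) comp1m -bet_nat2 !fcomp -!compA.
by rewrite (fm2 (lwh A) (asc3K Y)) fid compm1.
Qed.

Lemma bet_sym3' A Y : bet P A Y \oc sym3 (lwh A Y)
  = fm (lwh A) (sym3 Y) \oc (bet X A (lwh X (lwh X Y))
    \oc (fm (lwh X) (bet X A (lwh X Y)) \oc fm (lwh X) (fm (lwh X) (bet X A Y)))).
Proof.
have H : asc3 (lwh A Y) \oc asc3V (lwh A Y) = idm _ by exact: asc3VK.
apply: (iso_epi H); rewrite !sym3E -!compA -(bet_asc3 A Y) asc3K compm1 bet_nat1.
by rewrite fcomp -compA (tl2 (fm2 (lwh A) (asc3K Y))) fid comp1m.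
Qed.

Lemma bet_ext3 A Y : fm (lwh A) (ext3 Y) \oc bet E A Y
  = bet X A (lwh X (lwh X Y)) \oc (fm (lwh X) (bet X A (lwh X Y))
    \oc (fm (lwh X) (fm (lwh X) (bet X A Y)) \oc ext3 (lwh A Y))).
Proof.
by rewrite !ext3E fcomp -compA -bet_nat1 (tl2 (bet_asc3 A Y)) -!compA.
Qed.

Lemma bet_ext3' A Y : ext3 (lwh A Y) \oc bet A E Y
  = fm (lwh X) (fm (lwh X) (bet A X Y)) \oc (fm (lwh X) (bet A X (lwh X Y))
    \oc (bet A X (lwh X (lwh X Y)) \oc fm (lwh A) (ext3 Y))).
Proof.
by rewrite !ext3E fcomp -compA -bet_nat2 (tl2 (bet_asc3' A Y)) -!compA.
Qed.

Lemma ptrace_sym3 Y Y' (g : mor (lwh P Y) (lwh X (lwh X (lwh X Y')))) :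
  ptrace (sym3 Y' \oc g) = ptrace (ptrace (ptrace (g \oc sym3 Y))).
Proof.
rewrite sym3E -compA ptrace_dinat ptrace_asc3 sym3E -!compA.
by rewrite (tl2 (asc3VK _)) comp1m.
Qed.

Lemma ptrace_ext3 Y Y' (g : mor (lwh X (lwh X (lwh X Y'))) (lwh E Y)) :
  ptrace (g \oc ext3 Y') = ptrace (ptrace (ptrace (ext3 Y \oc g))).
Proof.
rewrite ext3E compA -ptrace_dinat ptrace_asc3 ext3E -!compA.
by rewrite asc3VK compm1.
Qed.

Fact sym3_pi Y : bet X P Y \oc fm (lwh X) (sym3 Y)
  = sym3 (lwh X Y) \oc (fm (lwh X) (fm (lwh X) (fm (lwh X) (idm _) \oc bet X X Y)
      \oc bet X X (lwh X Y)) \oc bet X X (lwh X (lwh X Y))).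
Proof. by rewrite fid comp1m fcomp -!compA bet_sym3. Qed.

Fact sym3_tau Y : bet P P Y \oc sym3 (lwh P Y)
  = fm (lwh P) (sym3 Y) \oc (bet X P (lwh X (lwh X Y)) \oc fm (lwh X)
      (bet X P (lwh X Y) \oc fm (lwh X) (bet X P Y \oc fm (lwh X) (idm _)))).
Proof. by rewrite fid compm1 fcomp bet_sym3'. Qed.

Definition symPow3 : powData (symQuad X) 3 := @PowData k C (symQuad X) 3 (lwh P)
  sym3 sym3_nat (fun Y => conj (sym3_left Y) (sym3_right Y)) sym3_fac
  sym3_epi (fun Y => lwh_epi (@sym3_epi Y))
  (bet X P) (fun Y Y' f => bet_nat3 X P f) sym3_pi
  (fun Y => ex_intro _ _ (bet_altk_pass X P Y))
  (bet P P) sym3_tau (@ptrace k C P) (@ptrace_lin k C P) (@ptrace_natl k C P)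
  (@ptrace_natr k C P) ptrace_sym3 (ptrace_bet P) (dimo P) (dimo_ptrace P).

(** Crossing Lambda^3 passes three factors, and crossing it with itself involves nine
    transpositions; both numbers are odd, so the sign survives here, in [nrho_tau] and in the
    trace. *)
Let nrho Y : mor (lwh E (lwh X Y)) (lwh X (lwh E Y)) := - bet E X Y.

Fact nrho_nat Y Y' (f : mor Y' Y) :
  fm (lwh X) (fm (lwh E) f) \oc nrho Y' = nrho Y \oc fm (lwh E) (fm (lwh X) f).
Proof. by rewrite /nrho compNl compNr bet_nat3. Qed.

Fact nrho_pi Y : fm (lwh X) (ext3 Y) \oc nrho Y
  = ((- bet X X (lwh X (lwh X Y))) \oc fm (lwh X) ((- bet X X (lwh X Y))
      \oc fm (lwh X) ((- bet X X Y) \oc fm (lwh X) (idm _)))) \oc ext3 (lwh X Y).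
Proof.
by rewrite fid compm1 /nrho !(fN, fcomp, compNl, compNr) !opprK bet_ext3 -!compA.
Qed.

Fact nrho_pass Y : exists r,
  (symq X (lwh E Y) \oc fm (lwh X) (nrho Y)) \oc nrho (lwh X Y) = r \oc fm (lwh E) (symq X Y).
Proof.
exists (bet E Q Y); rewrite /nrho fN !(compNl, compNr) opprK -compA.
exact: bet_symq_pass.
Qed.

Fact nrho_tau Y : ext3 (lwh E Y) \oc (- bet E E Y)
  = (fm (lwh X) (fm (lwh X) (fm (lwh X) (idm _) \oc nrho Y) \oc nrho (lwh X Y))
      \oc nrho (lwh X (lwh X Y))) \oc fm (lwh E) (ext3 Y).
Proof.
by rewrite fid comp1m /nrho !(fN, fcomp, compNl, compNr) !opprK bet_ext3' -!compA.
Qed.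

Let etr Y Y' (f : mor (lwh E Y') (lwh E Y)) : mor Y' Y := - ptrace f.

Fact etr_lin Y Y' a (f g : mor (lwh E Y') (lwh E Y)) :
  etr (a *: f + g) = a *: etr f + etr g.
Proof. by rewrite /etr ptrace_lin opprD scalerN. Qed.

Fact etr_natl V Y Z (g : mor Z Y) (f : mor (lwh E Y) (lwh E V)) :
  etr (f \oc fm (lwh E) g) = etr f \oc g.
Proof. by rewrite /etr ptrace_natr compNl. Qed.

Fact etr_natr V Y Z (g : mor (lwh E Z) (lwh E Y)) (f : mor Y V) :
  etr (fm (lwh E) f \oc g) = f \oc etr g.
Proof. by rewrite /etr ptrace_natl compNr. Qed.

Fact etr_pi Y Y' (g : mor (lwh X (lwh X (lwh X Y'))) (lwh E Y)) :
  etr (g \oc ext3 Y') = ntr (ntr (ntr (ext3 Y \oc g))).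
Proof. by rewrite /etr /ntr !ptraceN opprK ptrace_ext3. Qed.

Fact etr_tau Y : etr (- bet E E Y) = idm _.
Proof. by rewrite /etr ptraceN opprK ptrace_bet. Qed.

Fact etr_id Y : etr (idm (lwh E Y)) = (- dimo E) *: idm Y.
Proof. by rewrite /etr dimo_ptrace scaleNr. Qed.

Definition extPow3 : powData (extQuad X) 3 := @PowData k (opCat C) (extQuad X) 3 (opFun (lwh E))
  ext3 (fun Y Y' f => ext3_nat f) (fun Y => conj (ext3_left Y) (ext3_right Y)) ext3_fac
  (fun Y W g h => @ext3_mono Y W g h)
  (fun Y W g h => @lwh_mono k C X _ _ _ (@ext3_mono Y) W g h)
  nrho nrho_nat nrho_pi nrho_pass
  (fun Y => - bet E E Y) nrho_tau etr etr_lin etr_natl etr_natr etr_pi etr_tau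
  (- dimo E) etr_id.

(** Write 1 - c as the inclusion of Lambda^2 after [r]. In the other order the composite is 2, since
    c is -1 on Lambda^2; cyclicity compares the traces, and that of c is d. *)
Lemma dimo_alt2 : dimo L + dimo L = dimo X ^+ 2 - dimo X.
Proof.
have [r rP] := alt2_im X.
have ri : r \oc i = 2%:R *: idm _.
  apply: (kernel_monic (alt2_ker X)); rewrite compA -rP compDl compNl comp1m alt2_anti.
  by rewrite opprK compZr compm1 scaler_nat mulr2n.
apply: (@scalar_inj k C).
have <- : ptrace (rwh (r \oc i) tunit) = (dimo L + dimo L) *: idm tunit.
  by rewrite ri rwhZ rwh_id ptraceZ dimo_ptrace scalerA mulr_natl mulr2n.
rewrite rwh_comp -ptrace_dinat -rwh_comp -rP rwhD rwhN rwh_id ptraceD ptraceN dimo_ptrace.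
rewrite scalerBl expr2 -dimo_tens; congr (_ - _).
by rewrite -ptrace_tens -betE ptrace_bet dimo_ptrace.
Qed.

(** Additivity along [altsym] gives d times dim Sym^2 - dim Lambda^2, and this difference is d by
    [dimo_alt2]. *)
Lemma dimo_cube : dimo P - dimo E = dimo X ^+ 2.
Proof.
have := dimo_ker_coker altsym; rewrite -/P -/E (dimo_tens X Q) (dimo_tens L X).
have := dimo_square X; have := dimo_alt2; rewrite -/L -/Q => L2 LQ EP.
have QE : dimo Q = dimo L + dimo X.
  by apply: (addrI (dimo L)); rewrite LQ addrA L2 subrK.
apply: (addIr (dimo E)); rewrite subrK; apply: (addIr (dimo L * dimo X)).
by rewrite -EP QE; ring.
Qed.

End Cubes.

(** * The congruence *)

(** A positive least bound that is not attained could be lowered by one; [A 0] covers the bound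
    0. *)
Lemma nsup_max (A : nat -> Prop) m : A 0%N -> nsup A = Some m ->
  A m /\ forall n, (m < n)%N -> ~ A n.
Proof.
rewrite /nsup; case: pselect => // bd A0 [<-]; case: ex_minnP => b /asboolP Ab b_min.
split=> [|n b_n /Ab]; last by rewrite leqNgt b_n.
apply: contrapT => nAb; case: b Ab b_min nAb => [|b] Ab b_min nAb; first exact: nAb.
suff /b_min : `[< forall n, A n -> (n <= b)%N >] by rewrite ltnn.
apply/asboolP => n An; have := Ab n An; rewrite leq_eqVlt => /orP[/eqP nb|//].
by case: nAb; rewrite -nb.
Qed.

Lemma two_bin2 n : (2 * 'C(n, 2) + n = n * n)%N.
Proof. by elim: n => // n IHn; rewrite binS bin1; lia. Qed.

Lemma six_bin3 m : (6 * 'C(m, 3) + 3 * (m * m) = m * m * m + 2 * m)%N.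
Proof. by elim: m => // m IHm; rewrite binS; have := two_bin2 m; nia. Qed.

(** The second sum is what remains of the top-degree identities for Sym^2 and Lambda^2 at d = n once
    dim Sym^2 + dim Lambda^2 = n^2 is removed. Twice it is (m+n)^2 + (m+n), so m + n = 2u forces u
    to be even. *)
Lemma dvdn4_bin2 m n : (2 %| m + n)%N ->
  (2 %| m * n.+1 + 'C(m, 2) + n + 'C(n, 2))%N -> (4 %| m + n)%N.
Proof.
have := two_bin2 m; have := two_bin2 n; set a := 'C(n, 2); set b := 'C(m, 2).
move=> Ha Hb /dvdnP[u Hu] /dvdnP[t Ht].
have : (4 * (u * u) + 2 * u = 4 * t)%N by nia.
move: (u * u)%N => v Hv; apply/dvdnP; exists (t - v)%N; lia.
Qed.

(** With m + n = 3u, six times the second sum is a polynomial in u and n whose terms are all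
    multiples of 9 except 6u. As it is also 18t, 3 divides u. *)
Lemma dvdn9_bin3 m n : (3 %| m + n)%N ->
  (3 %| 'C(m, 3) + 'C(n, 3) + n * n)%N -> (9 %| m + n)%N.
Proof.
have := six_bin3 m; have := six_bin3 n; set a := 'C(n, 3); set b := 'C(m, 3).
move=> Ha Hb /dvdnP[u Hu] /dvdnP[t Ht].
have Hm : (m%:Z = 3%:Z * u%:Z - n%:Z)%R by lia.
have key : (6%:Z * (b%:Z + a%:Z) + 3%:Z * (m%:Z * m%:Z + n%:Z * n%:Z)
  = m%:Z * m%:Z * m%:Z + n%:Z * n%:Z * n%:Z + 2%:Z * (m%:Z + n%:Z))%R by lia.
have Ht' : (b%:Z + a%:Z = 3%:Z * t%:Z - n%:Z * n%:Z)%R by lia.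
rewrite Ht' Hm in key.
(* One ninth of what the identity [key] leaves after m = 3u - n, the term 6u apart. *)
pose v : int := (t%:Z * 2%:Z - 2%:Z * u%:Z * n%:Z + 3%:Z * u%:Z * u%:Z
  + (3%:Z * u%:Z - n%:Z) * n%:Z * u%:Z - 3%:Z * u%:Z * u%:Z * u%:Z)%R.
have : (9%:Z * v = 6%:Z * u%:Z)%R.
  apply/eqP; rewrite -subr_eq0; move/eqP: key; rewrite -subr_eq0 => /eqP <-; apply/eqP.
  by rewrite /v; ring.
move: v => v Hv; have : (3 %| u)%N by lia.
by move=> /dvdnP[w Hw]; apply/dvdnP; exists w; lia.
Qed.

Section TopDegrees.
Variables (k : fieldType) (C : tensorCategory k) (X : C) (m n : nat).
Hypotheses (hm : symDeg X = Some m) (hn : extDeg X = Some n).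

Lemma sym_top : ~ isZero (symTow X m.+3) /\ forall j, (m < j)%N -> isZero (symTow X j.+3).
Proof.
have S0 : ~ isZero (symPow X 0) by rewrite -symTow_symPow; exact: tunit_nonzero.
have [Sm Sj] := nsup_max S0 hm; split; first by rewrite symTow_symPow.
by move=> j /Sj /contrapT; rewrite symTow_symPow.
Qed.

Lemma ext_top : ~ isZero (C := opCat C) (extTow X n.+3) /\
  forall j, (n < j)%N -> isZero (C := opCat C) (extTow X j.+3).
Proof.
have E0 : ~ isZero (extPow X 0).
  by rewrite -extTow_extPow -/(isZero _) isZero_op; exact: tunit_nonzero.
have [En Ej] := nsup_max E0 hn; split; first by rewrite extTow_extPow.
by move=> j /Ej /contrapT; rewrite extTow_extPow.
Qed.

Lemma dimo_sym_top : dimo X = - m%:R.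
Proof. by have [Sm Sj] := sym_top; apply: (top_dim Sm); apply: (Sj m.+1). Qed.

Lemma dimo_ext_top : dimo X = n%:R.
Proof.
have [En Ej] := ext_top; apply: oppr_inj.
by apply: (top_dim (S := extTow X) En); apply: (Ej n.+1).
Qed.

End TopDegrees.

Theorem proposition5p2p4 (k : closedFieldType) (p : nat)
    (p23 : p = 2%N \/ p = 3%N) (charp : p \in [pchar k]%R)
    (C : tensorCategory k) (X : C) (N : nat)
    (hN : totalDeg X = Some N) :
  (p ^ 2 %| N)%N.
Proof.
move: hN; rewrite /totalDeg.
case hm : (symDeg X) => [m|//]; case hn : (extDeg X) => [n|//] [<-].
have dm := dimo_sym_top hm; have dn := dimo_ext_top hn.
have [Sm Sj] := sym_top hm; have [En Ej] := ext_top hn.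
have p_mn : (p %| m + n)%N.
  by rewrite (dvdn_pcharf charp) natrD -dn dm addrN.
case: p23 charp p_mn => -> charp p_mn.
  have HS := top_square (symPow2 X) Sm (Sj m.+2 (leqnSn _)).
  (* In the opposite category [qdim] is - dim X, while [pdim] is dim Lambda^2 with no sign. *)
  have HE := top_square (S := extTow X) (extPow2 X) En (Ej n.+2 (leqnSn _)).
  have D := dimo_square X.
  apply: dvdn4_bin2 => //; rewrite (dvdn_pcharf charp) !natrD natrM -natr1 -dn.
  have := congr2 +%R HS HE; rewrite /= dn in D *; rewrite addr0 => H.
  rewrite -H -subr_eq0; apply/eqP; move/eqP: D; rewrite -subr_eq0 => /eqP D.
  by rewrite -[RHS]oppr0 -[in RHS]D; ring.
have k3 : (3%:R : k) = 0 by apply/eqP; rewrite -(dvdn_pcharf charp).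
(* In characteristic 3 the inverse of 2 is 2 itself. *)
have e2 : (2%:R : k) + 2%:R = 1.
  by rewrite -natrD (natrD _ 1 3) k3 addr0.
have HS := top_cube (symPow3 X) e2 Sm (Sj m.+3 (leqW (leqnSn _))).
(* Here [pdim] is - dim Lambda^3, so adding the two identities produces the difference evaluated by
   [dimo_cube]. *)
have HE := top_cube (S := extTow X) (extPow3 X) e2 En (Ej n.+3 (leqW (leqnSn _))).
have D := dimo_cube X.
(* Natural subtraction truncates at [j = 0], where both sides vanish. *)
have predR j : j%:R * (j - 1)%:R = j%:R * (j%:R - 1) :> k.
  by case: j => [|j]; rewrite ?mul0r // subSS subn0 -natr1 addrK.
have mn : m%:R = - n%:R :> k by rewrite -dn dm opprK.
apply: dvdn9_bin3 => //; rewrite (dvdn_pcharf charp) !natrD natrM.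
move: HS HE; rewrite !predR /= mn dn in D * => HS HE.
have := congr2 +%R HS HE; rewrite /= addr0 => H; apply/eqP.
by rewrite expr2 in D; rewrite -H -D; ring.
Qed.
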